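(* Let $u$ be the local solution of the surface growth equation $u_t=-u_{xxxx}-(u_x^2)_{xx}$ with initial value $u(0)\in H^1$ and maximal existence time $\tau(u(0))$, let $\varphi$ be an approximation on $[0,T]$, let $d:=u-\varphi$ and $\mathrm{Res}:=\varphi_t+\varphi_{xxxx}+(\varphi_x^2)_{xx}$. Let $K:=7^7/4$, $K^*:=(8K)^{-1/4}=(2\cdot7^7)^{-1/4}$ and $$A(t):=-\frac14t+18\int_0^t\|\varphi_{xx}(\tau)\|_{L^\infty}^2\,d\tau .$$ As long as $$\|d(0)\|_{H^1}^2\,e^{A(t)}+2\int_0^t\|\mathrm{Res}(s)\|_{H^{-1}}^2\,e^{A(t)-A(s)}\,ds\le K^*$$ (that is, for every $t\in[0,T]$ with $t<\tau(u(0))$ such that this condition holds at all times in $[0,t]$), one has $$\|d(t)\|_{H^1}^2\le\|d(0)\|_{H^1}^2\,e^{A(t)}+2\int_0^t\|\mathrm{Res}(s)\|_{H^{-1}}^2\,e^{A(t)-A(s)}\,ds .$$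
   Context: All functions are real valued, $2\pi$-periodic in $x\in[0,2\pi]$ and have zero mean, $\int_0^{2\pi}u(x,t)\,dx=0$. For $p\ge1$, $\|u\|_{H^p}:=\|\partial_x^pu\|_{L^2(0,2\pi)}$, and $\|\cdot\|_{H^{-1}}$ is the dual norm, $\|f\|_{H^{-1}}=\sup\{\langle f,v\rangle: \int_0^{2\pi} v\,dx=0,\ \|v\|_{H^1}\le1\}$, with $\langle\cdot,\cdot\rangle$ the $L^2$ pairing. Known local existence theory (may be assumed): for every $u_0\in H^1$ there is a maximal time $\tau(u_0)\in(0,\infty]$ and a unique solution $u\in C^0([0,\tau(u_0)),H^1)$ of the equation with $u(0)=u_0$; it is $C^\infty$ in space and time on $(0,\tau(u_0))\times[0,2\pi]$, and if $\tau(u_0)<\infty$ then $\limsup_{t\to\tau(u_0)}\|u(t)\|_{H^1}=\infty$. An approximation $\varphi=\varphi(x,t)$ on $[0,T]$ is an arbitrary function satisfying the periodic boundary conditions and the zero-mean condition which is $H^4_{\mathrm{per}}$ in space and $H^1$ in time, i.e. $\varphi\in H^1([0,T];H^4_{\mathrm{per}})$. *)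

(* Defs.v *)
(* A function u(x,t) of space and time is curried as u : R -> R -> R with the
   TIME argument first, so that u t : R -> R is the spatial profile at time t.
   Functions on the circle are 2 pi-periodic functions on R. *)
From HB Require Import structures.
From mathcomp Require Import all_boot all_order all_algebra.
From mathcomp Require Import all_classical all_reals all_analysis.
Set Implicit Arguments.
Unset Strict Implicit.
Unset Printing Implicit Defensive.
Import Order.TTheory GRing.Theory Num.Theory.
Import numFieldNormedType.Exports.
Local Open Scope classical_set_scope.
Local Open Scope ring_scope.

Section SpatialSpaces.
Context {R : realType}.
Local Notation mu := (@lebesgue_measure R).
Implicit Types (u v w psi : R -> R) (p k : nat).

Definition circle : set R := `[0, pi *+ 2].

Definition L2norm u : \bar R := 'N[mu]_2%:E[EFin \o (u \_ circle)].

Definition Linftynorm u : \bar R := 'N[mu]_+oo[EFin \o (u \_ circle)].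

Definition L2per u : Prop :=
  [/\ periodic u (pi *+ 2), measurable_fun setT u & (L2norm u < +oo)%E].

Definition zero_mean u : Prop := (\int[mu]_(x in circle) u x = 0)%R.

Definition test_function psi : Prop :=
  periodic psi (pi *+ 2) /\ forall (k : nat) (x : R), derivable (derive1n k psi) x 1.

Definition is_wderiv k u v : Prop := forall psi, test_function psi ->
  (\int[mu]_(x in circle) (u x * derive1n k psi x) =
   (-1) ^+ k * \int[mu]_(x in circle) (v x * psi x))%R.

(* A representative of the weak derivative of order k, which is unique up to
   null sets; it is only meaningful if u has such a derivative in L^2. *)
Definition wderiv k u : R -> R :=
  xget (cst 0) [set v | L2per v /\ is_wderiv k u v].

(* All spaces consist of zero-mean functions. *)
Definition Hper p u : Prop :=
  [/\ L2per u, zero_mean u &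
      forall k, (k <= p)%N -> exists2 v, L2per v & is_wderiv k u v].

Definition Hnorm p u : \bar R := L2norm (wderiv p u).

Definition Hm1norm (f : R -> R) : \bar R :=
  ereal_sup [set (\int[mu]_(x in circle) (f x * v x)%:E)%E
            | v in [set v | Hper 1 v /\ (Hnorm 1 v <= 1)%E]].

End SpatialSpaces.

Section Solutions.
Context {R : realType}.
Implicit Types (u v : R -> R -> R) (tau : \bar R).

Definition dt u : R -> R -> R := fun t x => derive1 (u^~ x) t.
Definition dx u : R -> R -> R := fun t x => derive1 (u t) x.

(* Iterated partial derivative: true stands for dt, false for dx. *)
Definition pderiv (s : seq bool) u : R -> R -> R :=
  foldr (fun b v => if b then dt v else dx v) u s.

(* C^oo on (0, tau) x R: all iterated partial derivatives exist and are
   (jointly) continuous. *)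
Definition smooth_until tau u : Prop :=
  forall (s : seq bool) (t x : R), 0 < t -> (t%:E < tau)%E ->
    [/\ derivable ((pderiv s u)^~ x) t 1,
        derivable (pderiv s u t) x 1 &
        {for (t, x), continuous (fun z : R * R => pderiv s u z.1 z.2)}].

Definition growth_equation_at u (t x : R) : Prop :=
  derive1 (u^~ x) t =
    - derive1n 4 (u t) x - derive1n 2 (fun y => derive1 (u t) y ^+ 2) x.

Definition H1_continuous_until tau u : Prop :=
  forall t0 : R, 0 <= t0 -> (t0%:E < tau)%E ->
    Hnorm 1 (u t \- u t0)
      @[t --> within [set t : R | 0 <= t /\ (t%:E < tau)%E] (nbhs t0)] --> 0%E.

(* u in C^0([0, tau), H^1), smooth and solving the equation for positive
   times. *)
Definition solution_on tau u : Prop :=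
  [/\ (0 < tau)%E,
      forall t : R, 0 <= t -> (t%:E < tau)%E -> Hper 1 (u t),
      H1_continuous_until tau u,
      smooth_until tau u &
      forall t x : R, 0 < t -> (t%:E < tau)%E -> growth_equation_at u t x].

Definition maximal_solution tau u : Prop :=
  solution_on tau u /\
  forall tau' v, solution_on tau' v -> v 0 = u 0 -> (tau' <= tau)%E.

End Solutions.

Section Approximations.
Context {R : realType}.
Local Notation mu := (@lebesgue_measure R).
Variables (T : R) (phi phit : R -> R -> R).

(* g in L^2(0, T; H^p): since H^p (p >= 1) is separable and embeds into the
   continuous functions, strong measurability in time amounts to having a
   jointly measurable representative, which g is taken to be. *)
Definition L2_time_Hper p (g : R -> R -> R) : Prop :=
  [/\ measurable_fun (`[0, T] `*` setT) (fun z : R * R => g z.1 z.2),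
      {ae mu, forall t : R, t \in `[0, T] -> Hper p (g t)} &
      (\int[mu]_(t in `[0%R, T]) (Hnorm p (g t) ^+ 2) < +oo)%E].

(* phi in H^1([0, T]; H^4) with time derivative phit: phit is in
   L^2(0, T; H^4) and phi(t) = phi(0) + \int_0^t phit(s) ds for every t in
   [0, T], an identity between elements of H^4, i.e. for a.e. x.  This fixes
   the representative which is continuous in time with values in H^4, so that
   phi(t) makes sense for every t. *)
Definition approximation_on : Prop :=
  [/\ forall t : R, t \in `[0, T] -> Hper 4 (phi t),
      L2_time_Hper 4 phit &
      forall t : R, t \in `[0, T] ->
        {ae mu, forall x : R,
          phi t x = phi 0 x + (\int[mu]_(s in `[0%R, t]) phit s x)%R}].

Definition Res (t x : R) : R :=
  phit t x + wderiv 4 (phi t) x +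
  wderiv 2 (fun y => wderiv 1 (phi t) y ^+ 2) x.

(* The integral is finite for t in [0, T] when phi is an approximation, as
   H^1([0, T]; H^4) embeds into C^0([0, T]; W^{2, oo}). *)
Definition A (t : R) : R :=
  - (1 / 4) * t +
  18 * fine (\int[mu]_(s in `[0%R, t]) (Linftynorm (wderiv 2 (phi s)) ^+ 2))%E.

Definition error_bound (d0 : R -> R) (t : R) : \bar R :=
  (Hnorm 1 d0 ^+ 2 * (expR (A t))%:E +
   2%:E * \int[mu]_(s in `[0%R, t])
            (Hm1norm (Res s) ^+ 2 * (expR (A t - A s))%:E))%E.

End Approximations.

Definition K {R : realType} : R := 7 ^+ 7 / 4.

Definition Kstar {R : realType} : R := (8 * K) `^ (- (1 / 4)).

(* Main.v *)
Require Import Defs.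
From HB Require Import structures.
From mathcomp Require Import all_boot all_order all_algebra.
From mathcomp Require Import all_classical all_reals all_analysis.
From mathcomp Require Import measurable_realfun ess_sup_inf.
From mathcomp Require Import ring lra.
Set Implicit Arguments.
Unset Strict Implicit.
Unset Printing Implicit Defensive.
Import Order.TTheory GRing.Theory Num.Theory.
Import numFieldNormedType.Exports.
Local Open Scope classical_set_scope.
Local Open Scope ring_scope.

(** Let [d = u - phi] be the error and [E] the square of the L^2 norm of its
    derivative [d1]; write [d2], [d3] for the further derivatives and [f2] for the
    second derivative of [phi]. As [E] is minus the pairing of [d] with [d2],
    subtracting the equations of [u] and [phi] gives
    [E' = - 2 |d3|^2 + 2 (d2^3 + d2^2 f2 - 2 d1 d3 f2 + Res d2)], where the
    bracket stands for its integral over the circle. The cubic term is of higher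
    order: [d2] is bounded by [|d3|], and [|d2|^2 <= |d1| |d3|], so that the
    dissipation absorbs it while [E <= 1 / 25] ([cubic_bound]). Young's
    inequality bounds the terms with [f2] by [18 |f2|^2 E], with the maximum norm
    of [f2], and the residual by twice the square of its dual norm, each at the
    cost of a quarter of the dissipation. By the Poincare inequality the rest of
    the dissipation is at least [E / 4]. Hence [E' <= A' E + 2 |Res|^2]
    ([energy_inequality]), and Gronwall's lemma is the estimate to be proved, as
    long as [E <= 1 / 25]. This holds up to any time at which the estimate is
    assumed to have right-hand side at most [Kstar], because [Kstar < 1 / 25] and
    [E] is continuous ([energy_below_threshold]).

    Four points need care.

    The function [phi] is only weakly differentiable in time, so [E] has no
    evident derivative. Its increments are pairings of the increments of [d] with
    sums of two values of [d2], which is uniformly continuous; adding them up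
    along a subdivision shows that [E] is the primitive of its formal derivative
    ([increment_rint], [energy_ac]).

    Functions with weak derivatives are replaced by continuous representatives
    which are primitives of one another ([weak_primitive], [Hper4_rep]). This
    rests on the fundamental lemma of the calculus of variations, proved with
    trigonometric polynomials as test functions. Testing with them also shows
    that [phi] is Hoelder continuous in time with values in C^2.

    The dual norm of the residual is a supremum over an uncountable family and
    is not evidently measurable in time. The integral of a nonnegative function
    is a supremum over simple functions, hence monotone regardless of the
    measurability of the larger function, which is all that is used
    ([dominated_lower_integral]).

    The solution is smooth at positive times only; at time [0] it is continuous
    with values in H^1. The estimate is proved on [[s, t]] for [s > 0], and [s]
    tends to [0] ([gronwall0]). *)

(** * Integrals over segments *)

Section Segments.
Context {R : realType}.
Local Notation mu := (@lebesgue_measure R).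
Implicit Types (a b c : R) (f g h : R -> R).

Definition itg a b f := mu.-integrable `[a, b] (EFin \o f).
Definition rint a b f : R := \int[mu]_(x in `[a, b]) f x.
Definition cts a b f := {within `[a, b], continuous f}.
Definition sqi a b f := measurable_fun `[a, b] f /\ itg a b (fun x => f x ^+ 2).

Lemma aeS (P Q : R -> Prop) : {ae mu, forall x, P x} ->
  (forall x, P x -> Q x) -> {ae mu, forall x, Q x}.
Proof. by move=> h PQ; apply: filterS h; first exact: (ae_filter_ringOfSetsType mu). Qed.

Lemma aeS2 (P Q S : R -> Prop) : {ae mu, forall x, P x} -> {ae mu, forall x, Q x} ->
  (forall x, P x -> Q x -> S x) -> {ae mu, forall x, S x}.
Proof.
by move=> h h' PQ; apply: filterS2 h h'; first exact: (ae_filter_ringOfSetsType mu).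
Qed.

Lemma itgD a b f g : itg a b f -> itg a b g -> itg a b (fun x => f x + g x).
Proof. by move=> fi gi; exact: (integrableD _ fi gi). Qed.

Lemma itgB a b f g : itg a b f -> itg a b g -> itg a b (fun x => f x - g x).
Proof. by move=> fi gi; exact: (integrableB _ fi gi). Qed.

Lemma itgZ a b f k : itg a b f -> itg a b (fun x => k * f x).
Proof. by move=> fi; exact: (integrableZl _ k fi). Qed.

Lemma itgN a b f : itg a b f -> itg a b (fun x => - f x).
Proof. by move=> fi; exact: (integrableN fi). Qed.

Lemma itgS a b c d f : a <= c -> d <= b -> itg a b f -> itg c d f.
Proof.
move=> ac db; apply: integrableS => //.
by apply: subset_itv; rewrite bnd_simp.
Qed.

Lemma itg_norm a b f : itg a b f -> itg a b (fun x => `|f x|).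
Proof. exact: integrable_norm. Qed.

Lemma cts_itg a b f : cts a b f -> itg a b f.
Proof. by move=> cf; apply: continuous_compact_integrable => //; exact: segment_compact. Qed.

Lemma itg_measurable a b f : itg a b f -> measurable_fun `[a, b] f.
Proof. by move=> /(measurable_int mu)/measurable_EFinP. Qed.

Lemma cts_measurable a b f : cts a b f -> measurable_fun `[a, b] f.
Proof. by move/cts_itg/itg_measurable. Qed.

Lemma eq_itg a b f g : (forall x, a <= x <= b -> f x = g x) -> itg a b f -> itg a b g.
Proof.
move=> fg; apply: eq_integrable => // x; rewrite inE/= in_itv/= => xab.
by rewrite fg.
Qed.

Lemma le_itg a b f g : measurable_fun `[a, b] f ->
  (forall x, a <= x <= b -> `|f x| <= `|g x|) -> itg a b g -> itg a b f.
Proof.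
by move=> mf fg; apply: le_integrable => //; exact/measurable_EFinP.
Qed.

Lemma eq_rint a b f g : (forall x, a <= x <= b -> f x = g x) -> rint a b f = rint a b g.
Proof.
by move=> fg; apply: eq_Rintegral => x; rewrite inE/= in_itv/= => /fg.
Qed.

Lemma rintD a b f g : itg a b f -> itg a b g ->
  rint a b (fun x => f x + g x) = rint a b f + rint a b g.
Proof. by move=> *; exact: RintegralD. Qed.

Lemma rintB a b f g : itg a b f -> itg a b g ->
  rint a b (fun x => f x - g x) = rint a b f - rint a b g.
Proof. by move=> *; exact: RintegralB. Qed.

Lemma rintZ a b f k : itg a b f -> rint a b (fun x => k * f x) = k * rint a b f.
Proof. by move=> *; exact: RintegralZl. Qed.

Lemma rintN a b f : itg a b f -> rint a b (fun x => - f x) = - rint a b f.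
Proof.
by move=> fi; rewrite -mulN1r -rintZ//; apply: eq_rint => x _; rewrite mulN1r.
Qed.

Lemma le_rint a b f g : itg a b f -> itg a b g ->
  (forall x, a <= x <= b -> f x <= g x) -> rint a b f <= rint a b g.
Proof.
move=> fi gi fg; apply: le_Rintegral => // x /=; rewrite in_itv/=; exact: fg.
Qed.

Lemma rint_ge0 a b f : (forall x, a <= x <= b -> 0 <= f x) -> 0 <= rint a b f.
Proof. by move=> f0; apply: Rintegral_ge0 => x /=; rewrite in_itv/=; exact: f0. Qed.

Lemma normr_rint a b f : itg a b f -> `|rint a b f| <= rint a b (fun x => `|f x|).
Proof. by move=> fi; exact: le_normr_Rintegral. Qed.

Lemma rint_cst a b k : a <= b -> rint a b (fun=> k) = k * (b - a).
Proof.
move=> ab; rewrite /rint Rintegral_cst//= lebesgue_measure_itv/= lte_fin.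
by case: (ltgtP a b) ab => //= -> _; rewrite subrr mulr0.
Qed.

Lemma itg_cst a b k : itg a b (fun=> k).
Proof. by apply: cts_itg => x; exact: cvg_cst. Qed.

Lemma rint_pt a f : rint a a f = 0.
Proof. by rewrite /rint set_itv1 Rintegral_set1. Qed.

Lemma rint_cat a b c f : a <= b -> b <= c -> itg a c f ->
  rint a c f = rint a b f + rint b c f.
Proof.
move=> ab bc fi; apply/eqP; rewrite addrC -subr_eq; apply/eqP.
rewrite /rint Rintegral_itvB ?bnd_simp// Rintegral_itv_obnd_cbnd//.
by apply: integrableS fi => //; apply: subset_itvr; rewrite bnd_simp.
Qed.

Lemma ae_eq_itg a b f g : measurable_fun `[a, b] g ->
  {ae mu, forall x, a <= x <= b -> f x = g x} -> itg a b f -> itg a b g.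
Proof.
move=> mg fg /integrableP[mf fi]; apply/integrableP; split.
  exact/measurable_EFinP.
rewrite (le_lt_trans _ fi)//.
apply: ae_ge0_le_integral => //.
- by apply: measurableT_comp => //; exact/measurable_EFinP.
- exact: measurableT_comp.
- by apply: (aeS fg) => x fx /=; rewrite in_itv/= => /fx ->.
Qed.

Lemma ae_eq_rint a b f g : measurable_fun `[a, b] f -> measurable_fun `[a, b] g ->
  {ae mu, forall x, a <= x <= b -> f x = g x} -> rint a b f = rint a b g.
Proof.
move=> mf mg fg; congr fine; apply: ae_eq_integral => //.
- exact/measurable_EFinP.
- exact/measurable_EFinP.
- by apply: (aeS fg) => x fx; rewrite /= in_itv/= => /fx ->.
Qed.

Lemma ctsD a b f g : cts a b f -> cts a b g -> cts a b (fun x => f x + g x).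
Proof. by move=> cf cg x; apply: cvgD; [exact: cf|exact: cg]. Qed.
Lemma ctsB a b f g : cts a b f -> cts a b g -> cts a b (fun x => f x - g x).
Proof. by move=> cf cg x; apply: cvgB; [exact: cf|exact: cg]. Qed.
Lemma ctsM a b f g : cts a b f -> cts a b g -> cts a b (fun x => f x * g x).
Proof. by move=> cf cg x; apply: cvgM; [exact: cf|exact: cg]. Qed.
Lemma cts_cst a b k : cts a b (fun=> k).
Proof. by move=> x; exact: cvg_cst. Qed.
Lemma ctsX a b f n : cts a b f -> cts a b (fun x => f x ^+ n).
Proof.
move=> cf; elim: n => [|n ih]; first by under eq_fun do rewrite expr0; exact: cts_cst.
by under eq_fun do rewrite exprS; exact: ctsM.
Qed.
Lemma cts_norm a b f : cts a b f -> cts a b (fun x => `|f x|).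
Proof. by move=> cf x; apply: cvg_norm; exact: cf. Qed.
Lemma ctsS a b c d f : a <= c -> d <= b -> cts a b f -> cts c d f.
Proof.
by move=> ac db; apply: continuous_subspaceW; apply: subset_itv; rewrite bnd_simp.
Qed.
Lemma continuous_cts a b f : continuous f -> cts a b f.
Proof. by move=> cf; exact: continuous_subspaceT. Qed.
Lemma eq_cts a b f g : (forall x, a <= x <= b -> f x = g x) -> cts a b f -> cts a b g.
Proof.
by move=> fg; apply/subspace_eq_continuous => x; rewrite inE/= in_itv/= => /fg.
Qed.

Lemma ctsP a b f : cts a b f <-> forall x, a <= x <= b -> forall e, 0 < e ->
  exists2 d, 0 < d & forall y, a <= y <= b -> `|y - x| < d -> `|f y - f x| < e.
Proof.
split=> [cf x xab e e0|cf].
- have /subspace_continuousP/(_ x) := cf.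
  rewrite /= in_itv/= => /(_ xab)/cvgrPdist_lt/(_ _ e0).
  rewrite near_withinE => -[d /= d0 dx]; exists d => // y yab yx.
  by rewrite distrC; apply: (dx y) => /=; rewrite ?in_itv//= distrC.
- apply/subspace_continuousP => x /=; rewrite in_itv/= => xab.
  apply/cvgrPdist_lt => e e0; have [d d0 dx] := cf _ xab _ e0.
  rewrite near_withinE; exists d => //= y /= yx; rewrite in_itv/= => yab.
  by rewrite distrC; apply: dx => //; rewrite distrC.
Qed.

Lemma cts_bounded a b f : cts a b f ->
  exists2 M, 0 < M & forall x, a <= x <= b -> `|f x| <= M.
Proof.
move=> cf; have [ab|ba] := leP a b; last first.
  by exists 1 => // x /andP[ax xb]; move: (le_trans ax xb); rewrite leNgt ba.
have [c _ cM] := EVT_max ab (cts_norm cf).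
exists (`|f c| + 1); first by rewrite ltr_wpDl.
by move=> x xab; rewrite (le_trans (cM x _)) ?in_itv//= lerDl.
Qed.

Lemma itgM_cts a b f g : itg a b f -> cts a b g -> itg a b (fun x => f x * g x).
Proof.
move=> fi cg; have [M M0 gM] := cts_bounded cg.
apply: (@le_itg _ _ _ (fun x => M * f x)); last exact: itgZ.
- by apply: measurable_funM; [exact: itg_measurable|exact: cts_measurable].
- by move=> x xab; rewrite !normrM mulrC ler_wpM2r// (le_trans (gM _ xab))// ler_norm.
Qed.

Lemma rint_primitive_cts a b f : a <= b -> itg a b f -> cts a b (rint a ^~ f).
Proof. exact: parameterized_integral_continuous. Qed.

Lemma cts_unif a b f : cts a b f -> forall e, 0 < e -> exists2 d, 0 < d &
  forall x y, a <= x <= b -> a <= y <= b -> `|y - x| < d -> `|f y - f x| < e.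
Proof.
move=> cf e e0; have := @segment_compact R a b.
move=> /compact_near_coveringP/near_covering_withinP.
move=> /(_ _ ((0:R)^'+) (fun d x => forall y, a <= y <= b -> `|y - x| < d ->
  `|f y - f x| < e)).
have e20 : 0 < e / 2 by rewrite divr_gt0.
case => [x /=|d /= d0 dP].
  rewrite in_itv/= => xab.
  have [d d0 dx] := (ctsP a b f).1 cf _ xab _ e20.
  have d20 : 0 < d / 2 by rewrite divr_gt0.
  near=> x' t => /=; rewrite in_itv/= => x'ab y yab yx'.
  have x'x : `|x' - x| < d / 2.
    by rewrite distrC; near: x'; exact: nbhsx_ballx.
  have td : t < d / 2 by near: t; exact: nbhs_right_lt.
  have fx' : `|f x' - f x| < e / 2 by apply: dx => //; lra.
  have fy : `|f y - f x| < e / 2.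
    apply: dx => //; rewrite (_ : y - x = (y - x') + (x' - x)); last by ring.
    by rewrite (le_lt_trans (ler_normD _ _))//; lra.
  rewrite (_ : f y - f x' = (f y - f x) + (f x - f x')); last by ring.
  rewrite (le_lt_trans (ler_normD _ _))// (distrC (f x)); lra.
exists (d / 2); first by rewrite divr_gt0.
move=> x y xab yab yx.
apply: (dP (d / 2) _ _ x _ y) => //=.
- by rewrite sub0r normrN gtr0_norm; lra.
- by rewrite divr_gt0.
Unshelve. all: by end_near. Qed.

Lemma sqi_measurable a b f : sqi a b f -> measurable_fun `[a, b] f.
Proof. by case. Qed.

Lemma cts_sqi a b f : cts a b f -> sqi a b f.
Proof. by move=> cf; split; [exact: cts_measurable|apply/cts_itg/ctsX]. Qed.

Lemma sqiM a b f g : sqi a b f -> sqi a b g -> itg a b (fun x => f x * g x).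
Proof.
move=> [mf f2] [mg g2]; apply: (le_itg _ _ (itgD f2 g2)).
  exact: measurable_funM.
move=> x _; rewrite (ger0_norm (addr_ge0 (sqr_ge0 _) (sqr_ge0 _))).
have := sqr_ge0 (`|f x| - `|g x|); rewrite sqrrB -(normrX 2) -(normrX 2 (g x)).
by rewrite !(ger0_norm (sqr_ge0 _)) normrM; move: (`|f x| * _) (f x ^+ 2) (g x ^+ 2)
  (mulr_ge0 (normr_ge0 (f x)) (normr_ge0 (g x))) => *; lra.
Qed.

Lemma sqi_itg a b f : sqi a b f -> itg a b f.
Proof.
move=> sf; have := sqiM sf (cts_sqi (@cts_cst a b 1)).
by apply: eq_itg => x _; rewrite mulr1.
Qed.

Lemma sqiD a b f g : sqi a b f -> sqi a b g -> sqi a b (fun x => f x + g x).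
Proof.
move=> sf sg; split.
  by apply: measurable_funD; exact: sqi_measurable.
have := itgD (itgD (proj2 sf) (proj2 sg)) (itgZ 2 (sqiM sf sg)).
by apply: eq_itg => x _; ring.
Qed.

Lemma sqiZ a b f k : sqi a b f -> sqi a b (fun x => k * f x).
Proof.
move=> sf; split; first by apply: measurable_funM => //; exact: sqi_measurable.
by have := itgZ (k ^+ 2) (proj2 sf); apply: eq_itg => x _; ring.
Qed.

Lemma sqiB a b f g : sqi a b f -> sqi a b g -> sqi a b (fun x => f x - g x).
Proof.
move=> sf sg; have := sqiD sf (sqiZ (-1) sg).
by under eq_fun do rewrite mulN1r.
Qed.

Lemma ae_eq_sqi a b f g : measurable_fun `[a, b] g ->
  {ae mu, forall x, a <= x <= b -> f x = g x} -> sqi a b f -> sqi a b g.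
Proof.
move=> mg fg [mf f2]; split => //; apply: ae_eq_itg f2.
  exact: measurable_funX.
by apply: (aeS fg) => x fx /fx ->.
Qed.

Lemma rint_sqr_ge0 a b f : 0 <= rint a b (fun x => f x ^+ 2).
Proof. by apply: rint_ge0 => x _; exact: sqr_ge0. Qed.

(** Cauchy-Schwarz, from the discriminant of
    [k |-> rint a b ((f + k g) ^ 2)]. *)
Lemma rint_CS a b f g : sqi a b f -> sqi a b g ->
  rint a b (fun x => f x * g x) ^+ 2 <=
  rint a b (fun x => f x ^+ 2) * rint a b (fun x => g x ^+ 2).
Proof.
move=> sf sg; set F := rint a b (fun x => f x ^+ 2); set G := rint a b (fun x => g x ^+ 2).
set H := rint a b _.
have F0 : 0 <= F by exact: rint_sqr_ge0.
have G0 : 0 <= G by exact: rint_sqr_ge0.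
have key k l : 0 <= k ^+ 2 * F + 2 * k * l * H + l ^+ 2 * G.
  rewrite -(rintZ (k ^+ 2) (proj2 sf)) -(rintZ (l ^+ 2) (proj2 sg)).
  rewrite -(rintZ (2 * k * l) (sqiM sf sg)) -rintD; last 2 first.
  - exact: itgZ (proj2 sf).
  - exact: itgZ (sqiM sf sg).
  rewrite -rintD; last 2 first.
  - by apply: itgD; [exact: itgZ (proj2 sf)|exact: itgZ (sqiM sf sg)].
  - exact: itgZ (proj2 sg).
  apply: rint_ge0 => x _.
  rewrite (_ : _ + _ = (k * f x + l * g x) ^+ 2); first exact: sqr_ge0.
  by ring.
have [G00|G00] := eqVneq G 0.
  suff -> : H = 0 by rewrite expr2 mul0r G00 mulr0.
  apply/eqP; apply: contraT => H0.
  have := key 1 (- ((F + 1) / (2 * H))); rewrite G00.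
  rewrite (_ : _ + _ = -1); last by field.
  by rewrite ler0N1.
have Gp : 0 < G by rewrite lt_neqAle eq_sym G00.
have := key G (- H); rewrite (_ : _ + _ = G * (F * G - H ^+ 2)); last by ring.
by rewrite pmulr_rge0// subr_ge0.
Qed.

End Segments.

(** * Primitives of integrable functions *)

Section Primitives.
Context {R : realType}.
Local Notation mu := (@lebesgue_measure R).
Implicit Types (a b c s t : R) (f g h F G m : R -> R).

(** On [[a, b]] this says that [F] is absolutely continuous and that [f] is its
    derivative almost everywhere. *)
Definition ac a b F f :=
  itg a b f /\ forall x, a <= x <= b -> F x = F a + rint a x f.

(** The difference of [F] and a primitive of [g] has variation at most
    [eps * rint a b m] for every [eps], as the local estimates add up along a
    subdivision. It turns local estimates of first order into exact
    integral formulas. *)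
Lemma increment_rint a b F g m : a <= b -> itg a b g -> itg a b m ->
  (forall e, 0 < e -> exists2 d, 0 < d & forall s t, a <= s -> s <= t -> t <= b ->
     t - s < d -> `|F t - F s - rint s t g| <= e * rint s t m) ->
  F b - F a = rint a b g.
Proof.
move=> ab ig im loc; apply/eqP; rewrite -subr_eq0 -normr_le0.
have step e : 0 < e -> `|F b - F a - rint a b g| <= e * rint a b m.
  move=> e0; have [d d0 dP] := loc _ e0.
  have ind n : forall s t, a <= s -> s <= t -> t <= b -> t - s < n%:R * (d / 2) ->
      `|F t - F s - rint s t g| <= e * rint s t m.
    elim: n => [|n ih] s t as_ st tb; first by rewrite mul0r; lra.
    rewrite -natr1 mulrDl mul1r => tsn.
    have [tsd|tsd] := ltP (t - s) d; first exact: dP.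
    pose r := t - d / 2.
    have sr : s <= r by rewrite /r; lra.
    have rt : r <= t by rewrite /r; lra.
    have igst : itg s t g by apply: itgS ig.
    have imst : itg s t m by apply: itgS im.
    rewrite (rint_cat sr rt igst) (rint_cat sr rt imst) mulrDr.
    rewrite (_ : _ - _ = (F r - F s - rint s r g) + (F t - F r - rint r t g)); last by ring.
    rewrite (le_trans (ler_normD _ _))// lerD//.
      by apply: ih => //; rewrite /r; lra.
    by apply: dP => //; rewrite /r; lra.
  have [n nP] : exists n : nat, b - a < n%:R * (d / 2).
    have ba0 : 0 <= (b - a) / (d / 2) by rewrite divr_ge0 ?subr_ge0// divr_ge0// ltW.
    exists (Num.truncn ((b - a) / (d / 2))).+1.
    by rewrite -ltr_pdivrMr ?divr_gt0// truncnS_gt.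
  exact: (ind n).
set M := rint a b m in step *.
apply/ler_addgt0Pr => e e0; rewrite add0r.
have [M0|M0] := leP M 0.
  by rewrite (le_trans (step _ e0))// (le_trans (mulr_ge0_le0 (ltW e0) M0))// ltW.
by have := step (e / M); rewrite divr_gt0// mulrVK ?unitfE ?gt_eqF//; apply.
Qed.

Lemma acS a b c d F f : a <= c -> c <= d -> d <= b -> ac a b F f -> ac c d F f.
Proof.
move=> ac_ cd db [fi fF]; split; first exact: itgS fi.
move=> x /andP[cx xd]; rewrite (fF x) ?(fF c); last 2 first.
- by rewrite ac_ (le_trans cd).
- by rewrite (le_trans ac_)//= (le_trans xd).
by rewrite (rint_cat ac_ cx) ?addrA//; apply: itgS fi => //; exact: le_trans db.
Qed.

Lemma ac_rint a b F f : a <= b -> ac a b F f -> rint a b f = F b - F a.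
Proof. by move=> ab [_ /(_ b) ->]; rewrite ?ab ?lexx// addrC addKr. Qed.

Lemma ac_increment a b F f s t : a <= s -> s <= t -> t <= b ->
  ac a b F f -> F t - F s = rint s t f.
Proof. by move=> as_ st tb aF; rewrite (@ac_rint s t F)//; exact: acS aF. Qed.

Lemma ac_cts a b F f : a <= b -> ac a b F f -> cts a b F.
Proof.
move=> ab [fi fF].
apply: (@eq_cts _ _ _ (fun x => F a + rint a x f)).
  by move=> x xab; rewrite (fF _ xab).
by apply: ctsD; [exact: cts_cst|exact: rint_primitive_cts].
Qed.

Lemma increment_ac a b F g m : itg a b g -> itg a b m ->
  (forall e, 0 < e -> exists2 d, 0 < d & forall s t, a <= s -> s <= t -> t <= b ->
     t - s < d -> `|F t - F s - rint s t g| <= e * rint s t m) ->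
  ac a b F g.
Proof.
move=> ig im loc; split=> // x /andP[ax xb].
rewrite -(@increment_rint a x F g m) ?subrKC//.
- exact: itgS ig.
- exact: itgS im.
- move=> e /loc[d d0 dP]; exists d => // s t as_ st tx.
  by apply: dP => //; exact: le_trans xb.
Qed.

Lemma rint_ac a b f : a <= b -> itg a b f -> ac a b (rint a ^~ f) f.
Proof. by move=> ab fi; split=> // x _; rewrite rint_pt add0r. Qed.

Lemma eq_ac a b F G f : (forall x, a <= x <= b -> F x = G x) -> a <= b ->
  ac a b F f -> ac a b G f.
Proof. by move=> FG ab [fi fF]; split=> // x xab; rewrite -!FG ?lexx ?ab// fF. Qed.

Lemma eq_acr a b F f g : (forall x, a <= x <= b -> f x = g x) ->
  ac a b F f -> ac a b F g.
Proof.
move=> fg [fi fF]; split; first exact: eq_itg fi.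
move=> x /[dup] /andP[ax xb] /fF ->; congr +%R; apply: eq_rint => y /andP[ay yx].
by apply: fg; rewrite ay (le_trans yx).
Qed.

Lemma ae_eq_ac a b F f g : measurable_fun `[a, b] g ->
  {ae mu, forall x, a <= x <= b -> f x = g x} -> ac a b F f -> ac a b F g.
Proof.
move=> mg fg [fi fF]; split; first exact: ae_eq_itg fi.
move=> x /[dup] /andP[ax xb] /fF ->; congr +%R; apply: ae_eq_rint.
- by apply: measurable_funS (itg_measurable fi) => //; apply: subset_itvl; rewrite bnd_simp.
- by apply: measurable_funS mg => //; apply: subset_itvl; rewrite bnd_simp.
- by apply: (aeS fg) => y fgy /andP[ay yx]; apply: fgy; rewrite ay (le_trans yx).
Qed.

Lemma acD a b F f G g : ac a b F f -> ac a b G g ->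
  ac a b (fun x => F x + G x) (fun x => f x + g x).
Proof.
move=> [fi fF] [gi gG]; split; first exact: itgD.
move=> x /[dup] xab /andP[ax xb].
by rewrite (rintD (itgS (lexx a) xb fi) (itgS (lexx a) xb gi)) (fF x)// (gG x)//; ring.
Qed.

Lemma acZ a b F f k : ac a b F f -> ac a b (fun x => k * F x) (fun x => k * f x).
Proof.
move=> [fi fF]; split; first exact: itgZ.
move=> x /[dup] xab /andP[ax xb].
by rewrite (rintZ _ (itgS (lexx a) xb fi)) (fF x)// mulrDr.
Qed.

Lemma acB a b F f G g : ac a b F f -> ac a b G g ->
  ac a b (fun x => F x - G x) (fun x => f x - g x).
Proof.
move=> aF aG; have := acD aF (acZ (-1) aG).
by under eq_fun do rewrite mulN1r; under [in X in ac _ _ _ X -> _]eq_fun do rewrite mulN1r.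
Qed.

Lemma ac_cst a b k : ac a b (fun=> k) (fun=> 0).
Proof.
split; first exact: itg_cst.
by move=> x /andP[ax _]; rewrite rint_cst// mul0r addr0.
Qed.

(** The product rule: on a short segment [[s, t]] the increment of [F G] is
    [F s * (G t - G s) + (F t - F s) * G t], where [F s] and [G t] are close to
    [F] and [G]. *)
Lemma acM a b F f G g : a <= b -> ac a b F f -> ac a b G g ->
  ac a b (fun x => F x * G x) (fun x => f x * G x + F x * g x).
Proof.
move=> ab aF aG; have cF := ac_cts ab aF; have cG := ac_cts ab aG.
have fG : itg a b (fun x => f x * G x) by exact: itgM_cts aF.1 cG.
have Fg : itg a b (fun x => F x * g x).
  by apply: eq_itg (itgM_cts aG.1 cF) => x _; rewrite mulrC.
apply: (increment_ac (itgD fG Fg) (itgD (itg_norm aF.1) (itg_norm aG.1))).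
move=> e e0; have [d1 d10 d1P] := cts_unif cF e0; have [d2 d20 d2P] := cts_unif cG e0.
exists (Num.min d1 d2); first by rewrite lt_min d10.
move=> s t as_ st tb; rewrite lt_min => /andP[td1 td2].
have sS h : itg a b h -> itg s t h by apply: itgS.
rewrite (_ : _ - _ = rint s t (fun x => f x * (G t - G x)) +
    rint s t (fun x => (F s - F x) * g x)); last first.
  have -> : rint s t (fun x => f x * (G t - G x)) = G t * rint s t f - rint s t (fun x => f x * G x).
    rewrite -rintZ; last exact: sS aF.1.
    rewrite -rintB; [|exact/itgZ/sS/aF.1|exact: sS].
    by apply: eq_rint => x _; ring.
  have -> : rint s t (fun x => (F s - F x) * g x) = F s * rint s t g - rint s t (fun x => F x * g x).
    rewrite -rintZ; last exact: sS aG.1.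
    rewrite -rintB; [|exact/itgZ/sS/aG.1|exact: sS].
    by apply: eq_rint => x _; ring.
  rewrite rintD; [|exact: sS..].
  by rewrite -(ac_increment as_ st tb aF) -(ac_increment as_ st tb aG); ring.
have small h H : itg a b h -> cts s t H -> (forall x, s <= x <= t -> `|H x| <= e) ->
    `|rint s t (fun x => h x * H x)| <= e * rint s t (fun x => `|h x|).
  move=> hi cH He; have hH : itg s t (fun x => h x * H x) by exact: itgM_cts (sS _ hi) cH.
  rewrite (le_trans (normr_rint hH))// -rintZ; last exact/itg_norm/sS.
  apply: le_rint; [exact: itg_norm|exact/itgZ/itg_norm/sS|].
  by move=> x xst; rewrite normrM mulrC ler_wpM2r// He.
rewrite (rintD (itg_norm (sS _ aF.1)) (itg_norm (sS _ aG.1))) mulrDr.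
rewrite (le_trans (ler_normD _ _))// lerD//.
- apply: small => //; first exact: aF.1.
    by apply: ctsB; [exact: cts_cst|exact: ctsS cG].
  move=> x /andP[sx xt]; apply/ltW/d2P.
  + by rewrite (le_trans as_)//= (le_trans xt).
  + by rewrite (le_trans as_)//= (le_trans st).
  + by rewrite ger0_norm ?subr_ge0//; lra.
- under eq_rint do rewrite mulrC.
  apply: small => //; first exact: aG.1.
    by apply: ctsB; [exact: cts_cst|exact: ctsS cF].
  move=> x /andP[sx xt]; apply/ltW/d1P.
  + by rewrite (le_trans as_)//= (le_trans xt).
  + by rewrite as_ (le_trans st).
  + by rewrite ler0_norm ?subr_le0//; lra.
Qed.

Lemma ac_derivable a b F : a <= b -> (forall x, a <= x <= b -> derivable F x 1) ->
  cts a b (derive1 F) -> ac a b F (derive1 F).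
Proof.
move=> ab dF cF; split; first exact: cts_itg.
move=> x /andP[ax xb]; have [<-|ax'] := eqVneq a x; first by rewrite rint_pt addr0.
have {}ax' : a < x by rewrite lt_neqAle ax'.
apply/eqP; rewrite addrC -subr_eq; apply/eqP.
rewrite /rint /Rintegral (@continuous_FTC2 _ (derive1 F) F a x)//.
- exact: ctsS cF.
- split.
  + by move=> y; rewrite in_itv/= => /andP[ay yx]; apply: dF; lra.
  + by apply/cvg_at_right_filter/differentiable_continuous/derivable1_diffP/dF; lra.
  + by apply/cvg_at_left_filter/differentiable_continuous/derivable1_diffP/dF; lra.
Qed.

Lemma ac_is_derive a b F f : a <= b ->
  (forall x, a <= x <= b -> is_derive x 1 F (f x)) -> cts a b f -> ac a b F f.
Proof.
move=> ab dF cf.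
have E x : a <= x <= b -> f x = derive1 F x.
  by move=> /dF[_ <-]; rewrite derive1E.
have [||fi fF] := @ac_derivable a b F ab.
- by move=> x /dF[].
- by apply: eq_cts cf => x /E.
split; first exact: cts_itg.
move=> x /[dup] xab /andP[ax xb]; rewrite fF//; congr +%R.
by apply: eq_rint => y /andP[ay yx]; rewrite E// ay (le_trans yx).
Qed.

End Primitives.

(** * Poincare inequalities on the circle *)

Section Poincare.
Context {R : realType}.
Local Notation L := (@pi R *+ 2 : R).
Implicit Types (a b c s t m x y : R) (f g F G : R -> R).

(** The interval [[x, y]] and its complement in the circle carry opposite
    integrals of [f], so [F] varies by at most half of the L^1 norm of [f]. *)
Lemma periodic_osc F f x y : ac 0 L F f -> F L = F 0 -> 0 <= y -> y <= x -> x <= L ->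
  2 * `|F x - F y| <= rint 0 L (fun z => `|f z|).
Proof.
move=> aF FL y0 yx xL.
have fi : itg 0 L f by exact: aF.1.
have E1 := ac_increment y0 yx xL aF.
have E2 : F x - F y = - (rint 0 y f + rint x L f).
  rewrite -(ac_increment (lexx 0) y0 (le_trans yx xL) aF).
  rewrite -(ac_increment (le_trans y0 yx) xL (lexx L) aF) FL; ring.
have ni := itg_norm fi.
rewrite mulr_natl mulr2n {1}E1 E2 normrN.
have y0L : y <= L by exact: le_trans xL.
rewrite (rint_cat y0 y0L ni) (rint_cat yx xL); last exact: itgS ni.
have n1 : `|rint y x f| <= rint y x (fun z => `|f z|) by apply/normr_rint/itgS/fi.
have n2 : `|rint 0 y f| <= rint 0 y (fun z => `|f z|) by apply/normr_rint/itgS/fi.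
have n3 : `|rint x L f| <= rint x L (fun z => `|f z|).
  by apply/normr_rint/itgS/fi => //; exact: le_trans yx.
by have := ler_normD (rint 0 y f) (rint x L f); lra.
Qed.

Lemma twopi_gt0 : 0 < L. Proof. by rewrite mulrn_wgt0// pi_gt0. Qed.
Hint Resolve twopi_gt0 : core.

Lemma twopi_ge0 : 0 <= L. Proof. exact: ltW. Qed.
Hint Resolve twopi_ge0 : core.

Lemma rint_circle_cst (k : R) : rint 0 L (fun=> k) = k * L.
Proof. by rewrite rint_cst ?subr0. Qed.

Lemma twopi_le8 : L <= 8.
Proof. have := @pihalf_lt2 R; rewrite -mulr_natr; lra. Qed.

(** A function of zero mean is bounded by its oscillation, hence by half of the
    L^1 norm of its derivative; the constant comes from the Cauchy-Schwarz
    inequality and [2 pi <= 8]. *)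
Lemma zero_mean_sup F f x : ac 0 L F f -> sqi 0 L f -> F L = F 0 -> rint 0 L F = 0 ->
  0 <= x <= L -> F x ^+ 2 <= 2 * rint 0 L (fun z => f z ^+ 2).
Proof.
move=> aF sf FL F0 /andP[x0 xL].
set N := rint 0 L (fun z => `|f z|).
have osc y : 0 <= y <= L -> `|F x - F y| <= N / 2.
  move=> /andP[y0 yL]; rewrite ler_pdivlMr// mulrC.
  by have [yx|/ltW xy] := leP y x; [|rewrite distrC]; apply: periodic_osc.
have cF : cts 0 L F by exact: ac_cts aF.
have dF : cts 0 L (fun y => F x - F y) by apply: ctsB => //; exact: cts_cst.
have xN : `|F x| <= N / 2.
  rewrite -(ler_pM2r twopi_gt0) -{1}(ger0_norm twopi_ge0) -normrM.
  rewrite (_ : F x * L = rint 0 L (fun y => F x - F y)); last first.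
    by rewrite (rintB (@itg_cst R 0 L (F x)) (cts_itg cF)) F0 rint_cst// !subr0.
  rewrite (le_trans (normr_rint (cts_itg dF)))// -[leRHS](_ : rint 0 L (fun=> N / 2) = _).
    by apply: le_rint; [exact/itg_norm/cts_itg|exact: itg_cst|exact: osc].
  by rewrite rint_cst// subr0.
have CS : N ^+ 2 <= L * rint 0 L (fun z => f z ^+ 2).
  have nf : sqi 0 L (fun z => `|f z|).
    split; first by apply: measurableT_comp => //; exact: sf.1.
    by apply: eq_itg sf.2 => y _; rewrite real_normK ?num_real.
  have := rint_CS nf (cts_sqi (@cts_cst R 0 L 1)).
  rewrite (_ : rint 0 L (fun=> 1 ^+ 2) = L) ?rint_cst ?expr1n ?mul1r ?subr0//.
  rewrite (@eq_rint _ _ _ _ (fun z => `|f z|)); last by move=> y _; rewrite mulr1.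
  rewrite [X in _ <= X * _ -> _](@eq_rint _ _ _ _ (fun z => f z ^+ 2)); last first.
    by move=> y _; rewrite real_normK ?num_real.
  by rewrite mulrC.
have xN2 : F x ^+ 2 <= (N / 2) ^+ 2.
  by rewrite -[F x ^+ 2]real_normK ?num_real// lerXn2r ?nnegrE// (le_trans _ xN).
have f0 := rint_sqr_ge0 0 L f.
have : L * rint 0 L (fun z => f z ^+ 2) <= 8 * rint 0 L (fun z => f z ^+ 2).
  by rewrite ler_wpM2r// twopi_le8.
move: xN2; rewrite exprMn exprVn; lra.
Qed.

(** With [T = k tan(k(x - m))], which satisfies [T' = k^2 + T^2], one has
    [g^2 - k^2 G^2 + (T G^2)' = (g + T G)^2 >= 0]. *)
Lemma wirtinger_segment s t m k G g : 0 < k -> k < 1 -> s <= t ->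
  m - pi / 2 <= s -> t <= m + pi / 2 -> ac s t G g -> sqi s t g ->
  k ^+ 2 * rint s t (fun x => G x ^+ 2) <= rint s t (fun x => g x ^+ 2) +
   k * (G t ^+ 2 * tan (k * (t - m)) - G s ^+ 2 * tan (k * (s - m))).
Proof.
move=> k0 k1 st ms tm aG sg.
pose T (x : R) : R := k * tan (k * (x - m)).
pose T' (x : R) : R := k ^+ 2 + T x ^+ 2.
have cosk x : s <= x <= t -> cos (k * (x - m)) != 0.
  move=> /andP[sx xt]; rewrite gt_eqF//; apply: cos_gt0_pihalf.
  have := @pi_gt0 R => p0.
  have [xm|xm] := leP 0 (x - m).
    apply/andP; split; first by rewrite (@lt_le_trans _ _ 0)//; [lra|rewrite mulr_ge0// ltW].
    rewrite (@le_lt_trans _ _ (k * (pi / 2)))//; first by rewrite ler_pM2l//; lra.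
    by rewrite gtr_pMl//; lra.
  apply/andP; split; last by rewrite (@le_lt_trans _ _ 0)//; [rewrite mulr_ge0_le0//; lra|lra].
  rewrite ltrNl -mulrN (@le_lt_trans _ _ (k * (pi / 2)))//; first by rewrite ler_pM2l//; lra.
  by rewrite gtr_pMl//; lra.
have dT x : s <= x <= t -> is_derive x 1 T (T' x).
  move=> /cosk ck; have dt := is_derive_tan ck.
  have -> : T = k \*o (tan \o (fun x => k * (x - m))) by [].
  have d1 : is_derive x 1 (fun y : R => k * (y - m)) k.
    by apply: is_derive_eq; rewrite subr0 /GRing.scale/= mulr1.
  apply: is_derive_eq; rewrite cos2_tan2// /T' /T /GRing.scale/=; ring.
have cT : cts s t T.
  apply: derivable_within_continuous => x; by rewrite in_itv/= => /dT[].
have cT' : cts s t T' by apply: ctsD; [exact: cts_cst|exact: ctsX].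
have aT : ac s t T T' by exact: ac_is_derive.
have cG : cts s t G by exact: ac_cts aG.
have aGGT := acM st (acM st aG aG) aT.
have := ac_rint st aGGT; rewrite /= => E.
pose h (x : R) : R := g x + T x * G x.
have sh : sqi s t h by apply: sqiD => //; exact/cts_sqi/ctsM.
have := rint_sqr_ge0 s t h.
have -> : rint s t (fun x => h x ^+ 2) = rint s t (fun x => g x ^+ 2) +
   (rint s t (fun x => (g x * G x + G x * g x) * T x + G x * G x * T' x) -
    k ^+ 2 * rint s t (fun x => G x ^+ 2)).
  rewrite -rintZ; last exact/cts_itg/ctsX.
  rewrite -rintB; [|exact: aGGT.1|exact/itgZ/cts_itg/ctsX].
  rewrite -rintD; [|exact: sg.2|apply: itgB; [exact: aGGT.1|exact/itgZ/cts_itg/ctsX]].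
  by apply: eq_rint => x _; rewrite /h /T'; ring.
by rewrite E /T; lra.
Qed.

(** [F] takes the same value at two antipodal points [x0] and [x0 + pi].
    Subtracting it makes the function vanish at both, and the inequality on
    segments applies to the two half circles; the boundary terms at [0] and
    [2 pi] cancel. The subtraction only increases the L^2 norm of a function of
    zero mean. The sharp constant [1] is the limit [k = 1], for which the
    tangents become infinite; [k = 19 / 20] is enough here. *)
Lemma wirtinger F f : ac 0 L F f -> sqi 0 L f -> F L = F 0 -> rint 0 L F = 0 ->
  9 / 10 * rint 0 L (fun z => F z ^+ 2) <= rint 0 L (fun z => f z ^+ 2).
Proof.
move=> aF sf FL F0; have pi0 := @pi_gt0 R.
have LE : L = pi + pi by rewrite mulr2n.
have [k [k0 k1 k9]] : exists k : R, [/\ 0 < k, k < 1 & 9 / 10 <= k ^+ 2].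
  exists (19 / 20); split; [lra|lra|].
  by rewrite expr_div_n ler_pdivlMr ?exprn_gt0// mulrAC ler_pdivrMr//; lra.
have cF : cts 0 L F by exact: ac_cts aF.
have [x0 x0pi Fx0] : exists2 x0 : R, 0 <= x0 <= pi & F x0 - F (x0 + pi) = 0.
  have cH : cts 0 pi (fun x => F x - F (x + pi)).
    apply: ctsB; first by apply: ctsS cF => //; lra.
    apply/ctsP => x xpi e e0.
    have [|d d0 dP] := (ctsP 0 L F).1 cF (x + pi) _ _ e0; first by lra.
    exists d => // y ypi yx; apply: dP; first by lra.
    by rewrite (_ : _ - _ = y - x)//; ring.
  have [|x0] := @IVT R _ 0 pi 0 (ltW pi0) cH; last by rewrite in_itv/=; exists x0.
  rewrite add0r -mulr2n FL.
  by have [h|h] := leP (F 0 - F pi) (F pi - F 0); lra.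
have {}Fx0 : F (x0 + pi) = F x0 by move/eqP : Fx0; rewrite subr_eq0 => /eqP.
have /andP[x00 x0p] := x0pi.
pose G (x : R) : R := F x - F x0.
have aG : ac 0 L G f.
  by have := acB aF (@ac_cst R 0 L (F x0)); under [in X in ac _ _ _ X -> _]eq_fun do rewrite subr0.
have cG : cts 0 L G by exact: ac_cts aG.
have GG : rint 0 L (fun z => F z ^+ 2) <= rint 0 L (fun z => G z ^+ 2).
  rewrite (_ : rint 0 L (fun z => G z ^+ 2) = rint 0 L (fun z => F z ^+ 2) +
     (- (2 * F x0) * rint 0 L F + F x0 ^+ 2 * L)).
    by rewrite F0 mulr0 add0r lerDl mulr_ge0// sqr_ge0.
  have iF := itgZ (- (2 * F x0)) (cts_itg cF).
  have ic := @itg_cst R 0 L (F x0 ^+ 2).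
  rewrite -(rintZ _ (cts_itg cF)) (_ : F x0 ^+ 2 * L = rint 0 L (fun=> F x0 ^+ 2)); last first.
    by rewrite rint_cst// subr0.
  rewrite -(rintD iF ic) -(rintD (cts_itg (@ctsX R 0 L F 2 cF)) (itgD iF ic)).
  by apply: eq_rint => z _; rewrite /G; ring.
have x1L : x0 + pi <= L by lra.
have x01 : x0 <= x0 + pi by lra.
have x10 : 0 <= x0 + pi by lra.
have x0L : x0 <= L by lra.
have sqS h s t : 0 <= s -> t <= L -> sqi 0 L h -> sqi s t h.
  move=> s0 tL [mh h2]; split; last exact: itgS h2.
  by apply: measurable_funS mh => //; apply: subset_itv; rewrite bnd_simp.
have W1 : k ^+ 2 * rint 0 x0 (fun x => G x ^+ 2) <= rint 0 x0 (fun x => f x ^+ 2) +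
   k * (G x0 ^+ 2 * tan (k * (x0 - (x0 - pi / 2))) - G 0 ^+ 2 * tan (k * (0 - (x0 - pi / 2)))).
  apply: (wirtinger_segment k0 k1 x00); [lra|lra| |exact: sqS].
  exact: acS aG.
have W2 : k ^+ 2 * rint x0 (x0 + pi) (fun x => G x ^+ 2) <= rint x0 (x0 + pi) (fun x => f x ^+ 2) +
   k * (G (x0 + pi) ^+ 2 * tan (k * (x0 + pi - (x0 + pi / 2)))
        - G x0 ^+ 2 * tan (k * (x0 - (x0 + pi / 2)))).
  apply: (wirtinger_segment k0 k1 x01); [lra|lra| |exact: sqS].
  exact: acS aG.
have W3 : k ^+ 2 * rint (x0 + pi) L (fun x => G x ^+ 2) <= rint (x0 + pi) L (fun x => f x ^+ 2) +
   k * (G L ^+ 2 * tan (k * (L - (x0 + pi + pi / 2)))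
        - G (x0 + pi) ^+ 2 * tan (k * (x0 + pi - (x0 + pi + pi / 2)))).
  apply: (wirtinger_segment k0 k1 x1L);
    [by rewrite addrK|by move: LE x00; clear; lra| |exact: sqS].
  exact: acS aG.
have split h : itg 0 L h -> rint 0 L h = rint 0 x0 h + rint x0 (x0 + pi) h + rint (x0 + pi) L h.
  move=> hi; rewrite (rint_cat x00 x0L)// (rint_cat x01 x1L) ?addrA//.
  exact: itgS hi.
have GL : G L = G 0 by rewrite /G FL.
have tanE : tan (k * (L - (x0 + pi + pi / 2))) = tan (k * (0 - (x0 - pi / 2))).
  by congr (tan (_ * _)); rewrite LE; field.
have G0 : G x0 = 0 by rewrite /G subrr.
have G1 : G (x0 + pi) = 0 by rewrite /G Fx0 subrr.
rewrite GL tanE G1 in W3; rewrite G0 in W1; rewrite G0 G1 in W2.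
have iG2 : itg 0 L (fun z => G z ^+ 2) by exact/cts_itg/ctsX.
have W : k ^+ 2 * rint 0 L (fun x => G x ^+ 2) <= rint 0 L (fun x => f x ^+ 2).
  rewrite (split _ sf.2) (split _ iG2) !mulrDr; move: W1 W2 W3.
  rewrite expr0n/= !mul0r !subr0 sub0r mulr0 addr0 mulrN.
  move: (rint 0 x0 (fun x => f x ^+ 2)) (rint x0 (x0 + pi) (fun x => f x ^+ 2))
    (rint (x0 + pi) L (fun x => f x ^+ 2)) (k * (G 0 ^+ 2 * _))
    (k ^+ 2 * _) (k ^+ 2 * _) (k ^+ 2 * _).
  by clear => *; lra.
by apply: le_trans W; apply: ler_pM => //; exact: rint_sqr_ge0.
Qed.

End Poincare.
#[global] Hint Resolve twopi_gt0 twopi_ge0 : core.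

(** * Trigonometric polynomials and the fundamental lemma *)

Section Trigonometric.
Context {R : realType}.
Local Notation mu := (@lebesgue_measure R).
Local Notation L := (@pi R *+ 2 : R).
Implicit Types (a b c e s t m x y : R) (f g h F G psi : R -> R) (k n : nat).

Inductive trig : (R -> R) -> Prop :=
| trig_cst c : trig (fun=> c)
| trig_cos k : trig (fun x => cos (k%:R * x))
| trig_sin k : trig (fun x => sin (k%:R * x))
| trigD f g : trig f -> trig g -> trig (fun x => f x + g x)
| trigZ c f : trig f -> trig (fun x => c * f x).

Lemma trig_derive f : trig f ->
  exists2 g, trig g & forall x, is_derive x 1 f (g x).
Proof.
have lin k x : is_derive x 1 (fun y : R => k%:R * y) (k%:R : R).
  by apply: is_derive_eq; rewrite /GRing.scale/= mulr1.
elim=> {f} [c|k|k|f g _ [f' tf' df] _ [g' tg' dg]|c f _ [f' tf' df]].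
- by exists (fun=> 0); [exact: trig_cst|move=> x; exact: is_derive_cst].
- exists (fun x => - k%:R * sin (k%:R * x)); first exact/trigZ/trig_sin.
  move=> x; have -> : (fun x => cos (k%:R * x)) = cos \o (fun y : R => k%:R * y) by [].
  by apply: is_derive_eq; rewrite /GRing.scale/=; ring.
- exists (fun x => k%:R * cos (k%:R * x)); first exact/trigZ/trig_cos.
  move=> x; have -> : (fun x => sin (k%:R * x)) = sin \o (fun y : R => k%:R * y) by [].
  by apply: is_derive_eq; rewrite /GRing.scale/=; ring.
- by exists (fun x => f' x + g' x); [exact: trigD|move=> x; exact: is_deriveD].
- by exists (fun x => c * f' x); [exact: trigZ|move=> x; exact: is_deriveZ].
Qed.

Lemma trig_antiderivative f : trig f -> exists F c, trig F /\
  forall x, is_derive x 1 F (f x - c).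
Proof.
elim=> {f} [c|k|k|f g _ [F [c [tF dF]]] _ [G [d [tG dG]]]|c f _ [F [d [tF dF]]]].
- by exists (fun=> 0), c; split; [exact: trig_cst|move=> x; rewrite subrr; exact: is_derive_cst].
- have [->|k0] := eqVneq k 0%N.
    exists (fun=> 0), 1; split; first exact: trig_cst.
    by move=> x; rewrite mul0r cos0 subrr; exact: is_derive_cst.
  exists (fun x => k%:R^-1 * sin (k%:R * x)), 0; split; first exact/trigZ/trig_sin.
  move=> x; rewrite subr0.
  have lin : is_derive x 1 (fun y : R => k%:R * y) (k%:R : R).
    by apply: is_derive_eq; rewrite /GRing.scale/= mulr1.
  have -> : (fun x => k%:R^-1 * sin (k%:R * x)) = k%:R^-1 \*o (sin \o (fun y : R => k%:R * y)) by [].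
  apply: is_derive_eq; rewrite /GRing.scale/=; field.
  by rewrite pnatr_eq0.
- have [->|k0] := eqVneq k 0%N.
    exists (fun=> 0), 0; split; first exact: trig_cst.
    by move=> x; rewrite mul0r sin0 subrr; exact: is_derive_cst.
  exists (fun x => - k%:R^-1 * cos (k%:R * x)), 0; split; first exact/trigZ/trig_cos.
  move=> x; rewrite subr0.
  have lin : is_derive x 1 (fun y : R => k%:R * y) (k%:R : R).
    by apply: is_derive_eq; rewrite /GRing.scale/= mulr1.
  have -> : (fun x => - k%:R^-1 * cos (k%:R * x)) = (- k%:R^-1) \*o (cos \o (fun y : R => k%:R * y)) by [].
  apply: is_derive_eq; rewrite /GRing.scale/=; field.
  by rewrite pnatr_eq0.
- exists (fun x => F x + G x), (c + d); split; first exact: trigD.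
  by move=> x; apply: is_derive_eq; ring.
- exists (fun x => c * F x), (c * d); split; first exact: trigZ.
  move=> x; have -> : (fun x => c * F x) = c \*o F by [].
  by apply: is_derive_eq; rewrite /GRing.scale/=; ring.
Qed.

Lemma trig_continuous f : trig f -> continuous f.
Proof.
move=> /trig_derive[g _ df] x.
by have [/derivable1_diffP/differentiable_continuous] := df x.
Qed.

Lemma trig_periodic f : trig f -> periodic f L.
Proof.
have kL k x : k%:R * (x + L) = k%:R * x + L *+ k by rewrite mulrDr [k%:R * L]mulr_natl.
elim=> {f} [c|k|k|f g _ pf _ pg|c f _ pf] x //.
- by rewrite kL (periodicn (@cosD2pi R)).
- by rewrite kL (periodicn (@sinD2pi R)).
- by rewrite pf pg.
- by rewrite pf.
Qed.

Lemma trig_derive1n f k : trig f -> trig (derive1n k f).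
Proof.
move=> tf; elim: k => [//|k /trig_derive[g tg dg]].
rewrite derive1nS (_ : derive1 _ = g)//; apply/funext => x.
by have [_ <-] := dg x; rewrite derive1E.
Qed.

Lemma trig_test f : trig f -> test_function f.
Proof.
move=> tf; split; first exact: trig_periodic.
by move=> k x; have /trig_derive[g _ /(_ x)[]] := trig_derive1n k tf.
Qed.

Lemma eq_trig f g : (forall x, f x = g x) -> trig f -> trig g.
Proof. by move=> /funext ->. Qed.

Lemma trig_mulcos f : trig f -> trig (fun x => f x * cos x).
Proof.
elim=> {f} [c|k|k|f g _ pf _ pg|c f _ pf].
- by have := trigZ c (trig_cos 1); under eq_fun do rewrite mul1r.
- case: k => [|k].
    by apply: eq_trig (trig_cos 1) => x; rewrite mul0r cos0 !mul1r.
  apply: eq_trig (trigZ 2^-1 (trigD (trig_cos k.+2) (trig_cos k))) => x.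
  rewrite -!natr1 !mulrDl !mul1r.
  rewrite !cosD sinD; apply/eqP; rewrite -subr_eq0.
  rewrite (_ : _ - _ = 2^-1 * cos (k%:R * x) * (1 - (cos x ^+ 2 + sin x ^+ 2))).
    by rewrite cos2Dsin2 subrr mulr0.
  by field.
- case: k => [|k].
    by apply: eq_trig (trig_cst 0) => x; rewrite mul0r sin0 mul0r.
  apply: eq_trig (trigZ 2^-1 (trigD (trig_sin k.+2) (trig_sin k))) => x.
  rewrite -!natr1 !mulrDl !mul1r.
  rewrite !sinD cosD; apply/eqP; rewrite -subr_eq0.
  rewrite (_ : _ - _ = 2^-1 * sin (k%:R * x) * (1 - (cos x ^+ 2 + sin x ^+ 2))).
    by rewrite cos2Dsin2 subrr mulr0.
  by field.
- by have := trigD pf pg; under eq_fun do rewrite -mulrDl.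
- by have := trigZ c pf; under eq_fun do rewrite mulrA.
Qed.

Lemma trig_mulsin f : trig f -> trig (fun x => f x * sin x).
Proof.
elim=> {f} [c|k|k|f g _ pf _ pg|c f _ pf].
- by have := trigZ c (trig_sin 1); under eq_fun do rewrite mul1r.
- case: k => [|k].
    by apply: eq_trig (trig_sin 1) => x; rewrite mul0r cos0 !mul1r.
  apply: eq_trig (trigZ 2^-1 (trigD (trig_sin k.+2) (trigZ (-1) (trig_sin k)))) => x.
  rewrite -!natr1 !mulrDl !mul1r.
  rewrite !sinD !cosD; apply/eqP; rewrite -subr_eq0.
  rewrite (_ : _ - _ = 2^-1 * sin (k%:R * x) * (cos x ^+ 2 + sin x ^+ 2 - 1)).
    by rewrite cos2Dsin2 subrr mulr0.
  by field.
- case: k => [|k].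
    by apply: eq_trig (trig_cst 0) => x; rewrite mul0r sin0 mul0r.
  apply: eq_trig (trigZ 2^-1 (trigD (trig_cos k) (trigZ (-1) (trig_cos k.+2)))) => x.
  rewrite -!natr1 !mulrDl !mul1r.
  rewrite !cosD !sinD; apply/eqP; rewrite -subr_eq0.
  rewrite (_ : _ - _ = 2^-1 * cos (k%:R * x) * (1 - (cos x ^+ 2 + sin x ^+ 2))).
    by rewrite cos2Dsin2 subrr mulr0.
  by field.
- by have := trigD pf pg; under eq_fun do rewrite -mulrDl.
- by have := trigZ c pf; under eq_fun do rewrite mulrA.
Qed.

(* The kernel is [(1 + cos (x - y)) ^ n], expanded so that the dependence on [x]
   can be taken out of integrals over [y]. *)
Local Notation kernel n x := (fun y => (1 + cos x * cos y + sin x * sin y) ^+ n).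

Lemma kernel_cts n x : cts 0 L (kernel n x).
Proof.
by apply: ctsX; apply: ctsD; [apply: ctsD; first exact: cts_cst|];
  apply: ctsM; rewrite /=; try exact: cts_cst; apply: continuous_cts;
  [exact: continuous_cos|exact: continuous_sin].
Qed.

Lemma trig_convolution n f : cts 0 L f ->
  trig (fun x => rint 0 L (fun y => f y * kernel n x y)).
Proof.
have cc : cts 0 L (@cos R) by apply: continuous_cts; exact: continuous_cos.
have cs : cts 0 L (@sin R) by apply: continuous_cts; exact: continuous_sin.
elim: n f => [|n ih] f cf.
  by apply: eq_trig (trig_cst (rint 0 L (fun y => f y * 1))) => x.
have fc : cts 0 L (fun y => f y * cos y) by exact: ctsM.
have fs : cts 0 L (fun y => f y * sin y) by exact: ctsM.
apply: eq_trig (trigD (trigD (ih _ cf) (trig_mulcos (ih _ fc))) (trig_mulsin (ih _ fs))) => x.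
have kc := @kernel_cts n x.
have i1 := cts_itg (ctsM cf kc).
have i2 := itgZ (cos x) (cts_itg (ctsM fc kc)).
have i3 := itgZ (sin x) (cts_itg (ctsM fs kc)).
rewrite ![_ * cos x]mulrC ![_ * sin x]mulrC.
rewrite -(rintZ _ (cts_itg (ctsM fc kc))) -(rintZ _ (cts_itg (ctsM fs kc))).
rewrite -(rintD i1 i2) -(rintD (itgD i1 i2) i3).
by apply: eq_rint => y _; rewrite exprS; ring.
Qed.

(** The integral of [(1 + cos) ^ n] over the circle, see [rint_kernel]. *)
Fixpoint kernel_mass n : R :=
  if n is m.+1 then kernel_mass m * ((2 * m%:R + 1) / (m%:R + 1)) else L.

Lemma kernel_mass_gt0 n : 0 < kernel_mass n.
Proof.
elim: n => [|n ih] /=; first exact: twopi_gt0.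
by rewrite mulr_gt0// divr_gt0// ltr_wpDl// ?mulr_ge0.
Qed.

(** By periodicity, the derivative of
    [sin (x - y) (1 + cos (x - y)) ^ n] in [y] has integral [0]; this links
    the integrals of consecutive kernels. *)
Lemma rint_kernel n x : rint 0 L (kernel n x) = kernel_mass n.
Proof.
elim: n => [|n ih].
  by rewrite (@eq_rint _ _ _ _ (fun=> 1)) ?rint_circle_cst ?mul1r// => y _; rewrite expr0.
pose S (y : R) : R := sin x * cos y - cos x * sin y.
pose K (y : R) : R := 1 + cos x * cos y + sin x * sin y.
have dS y : is_derive y 1 S (1 - K y).
  have -> : S = (sin x \*o cos) \- (cos x \*o sin) by [].
  by apply: is_derive_eq; rewrite /K /GRing.scale/=; ring.
have dK y : is_derive y 1 K (S y).
  have -> : K = (cst 1 \+ (cos x \*o cos)) \+ (sin x \*o sin) by [].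
  by apply: is_derive_eq; rewrite /S /GRing.scale/=; ring.
have SK y : S y ^+ 2 = K y * (2 - K y).
  rewrite /S /K; apply/eqP; rewrite -subr_eq0.
  rewrite (_ : _ - _ = (cos x ^+ 2 + sin x ^+ 2) * (cos y ^+ 2 + sin y ^+ 2) - 1).
    by rewrite !cos2Dsin2 mulr1 subrr.
  by ring.
pose Q (y : R) : R := S y * K y ^+ n.
pose q (y : R) : R := (2 * n%:R + 1) * K y ^+ n - (n%:R + 1) * K y ^+ n.+1.
have dQ y : is_derive y 1 Q (q y).
  have -> : Q = S * (K ^+ n) by rewrite /Q exprfctE mulrfctE.
  rewrite /q; case: (n) => [|m].
    by rewrite expr0 mulr1 (_ : _ - _ = 1 - K y)// !expr0 expr1; ring.
  have dKm := is_deriveX m (dK y).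
  apply: is_derive_eq; rewrite /GRing.scale/= exprfctE.
  rewrite (_ : S y * _ = m.+1%:R * K y ^+ m * S y ^+ 2); last by ring.
  by rewrite SK -!natr1 !exprS; ring.
have i1 := cts_itg (@kernel_cts n x).
have i2 := cts_itg (@kernel_cts n.+1 x).
have aQ : ac 0 L Q q.
  apply: (ac_is_derive (@twopi_ge0 R) (fun y _ => dQ y)).
  by rewrite /q; apply: ctsB; apply: ctsM; try exact: cts_cst; exact: kernel_cts.
have := ac_rint (ltW (@twopi_gt0 R)) aQ.
rewrite /Q /S /K cos2pi sin2pi cos0 sin0 subrr => E.
move: E; rewrite (rintB (itgZ _ i1) (itgZ _ i2)) (rintZ _ i1) (rintZ _ i2) ih => E /=.
apply: (@mulfI _ (n%:R + 1)); first by rewrite gt_eqF// ltr_wpDl.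
rewrite mulrCA [RHS]mulrC; move/eqP : E; rewrite subr_eq0 => /eqP <-.
by field; rewrite gt_eqF// ltr_wpDl.
Qed.

(** Away from the diagonal of the circle [1 - cos (x - y)] is bounded below and
    [f] is bounded; near it [f] varies little. *)
Lemma periodic_modulus f e : cts 0 L f -> f L = f 0 -> 0 < e ->
  exists2 C, 0 < C & forall x y, 0 <= x <= L -> 0 <= y <= L ->
    `|f y - f x| <= e + C * (1 - cos (x - y)).
Proof.
move=> cf fL e0; have e20 : 0 < e / 2 by rewrite divr_gt0.
have pi0 := @pi_gt0 R.
have LE : L = pi + pi by rewrite mulr2n.
have [d d0 dP] := cts_unif cf e20; have [M M0 MP] := cts_bounded cf.
pose r := Num.min d pi.
have r0 : 0 < r by rewrite lt_min d0.
have rd : r <= d by rewrite ge_min lexx.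
have rpi : r <= pi by rewrite ge_min lexx orbT.
have cosr : cos r < 1.
  by rewrite -cos0 ltr_cos ?in_itv/= ?lexx ?(ltW r0) ?rpi ?(ltW pi0).
pose C := 2 * M / (1 - cos r).
have C0 : 0 < C by rewrite divr_gt0 ?mulr_gt0 ?subr_gt0.
exists C => // x y; wlog xy : x y / x <= y.
  move=> H xL yL; have [/H|/ltW /H] := leP x y; first exact.
  by rewrite distrC -cosN opprB; exact.
move=> /andP[x0 xL] /andP[y0 yL].
have C1 : 0 <= C * (1 - cos (x - y)) by rewrite mulr_ge0 ?(ltW C0)// subr_ge0 cos_le1.
have [yxr|yxr] := ltP (y - x) r.
  have : `|f y - f x| < e / 2.
    by apply: dP; rewrite ?x0 ?y0// ger0_norm ?subr_ge0//; exact: lt_le_trans rd.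
  lra.
have [Lyx|Lyx] := ltP (L - r) (y - x).
  have h1 : `|f L - f y| < e / 2.
    by apply: dP; rewrite ?y0 ?lexx// ?twopi_ge0// ger0_norm ?subr_ge0//; lra.
  have h2 : `|f x - f 0| < e / 2.
    by apply: dP; rewrite ?x0 ?lexx// ?twopi_ge0// ger0_norm ?subr0//; lra.
  have : `|f y - f x| <= `|f L - f y| + `|f x - f 0|.
    rewrite distrC (_ : f x - f y = (f L - f y) + (f x - f 0)); first exact: ler_normD.
    by rewrite fL; ring.
  lra.
have : cos (x - y) <= cos r.
  rewrite -cosN opprB.
  have [yxp|yxp] := leP (y - x) pi.
    by rewrite leNgt ltr_cos ?in_itv/= -?leNgt//; lra.
  by rewrite -cosN -(@cosD2pi R) leNgt ltr_cos ?in_itv/= -?leNgt//; lra.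
move=> cr; have : 2 * M <= C * (1 - cos (x - y)).
  by rewrite /C -mulrA ler_peMr ?mulr_ge0 ?(ltW M0)// mulrC ler_pdivlMr ?subr_gt0//; lra.
have := ler_normB (f y) (f x).
have := MP x; have := MP y; rewrite x0 xL y0 yL => /(_ isT) ? /(_ isT) ?; lra.
Qed.

(** The normalized convolutions of [f] with the kernels converge to [f]: by
    [periodic_modulus] the error is at most [e / 2] plus [C] times the mean of
    [1 - cos (x - y)] under the kernel, and this mean is
    [2 - kernel_mass n.+1 / kernel_mass n = 1 / (n + 1)]. *)
Lemma trig_dense f e : cts 0 L f -> f L = f 0 -> 0 < e ->
  exists2 psi, trig psi & forall x, 0 <= x <= L -> `|psi x - f x| <= e.
Proof.
move=> cf fL e0; have e20 : 0 < e / 2 by rewrite divr_gt0.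
have [C C0 CP] := periodic_modulus cf fL e20.
pose n := Num.truncn (C / (e / 2)).
have nC : C / (n%:R + 1) <= e / 2.
  rewrite ler_pdivrMr ?ltr_wpDl// mulrC -ler_pdivrMr//.
  by rewrite natr1 ltW// truncnS_gt.
pose c := (kernel_mass n)^-1.
have m0 := kernel_mass_gt0 n.
have c0 : 0 < c by rewrite invr_gt0.
exists (fun x => c * rint 0 L (fun y => f y * kernel n x y)).
  exact/trigZ/trig_convolution.
move=> x xL.
have kc := @kernel_cts n x; have ki := cts_itg kc; have k1i := cts_itg (@kernel_cts n.+1 x).
have fki := cts_itg (ctsM cf kc).
have K0 y : 0 <= 1 + cos x * cos y + sin x * sin y.
  by rewrite -addrA -cosB; have := cos_geN1 (x - y); lra.
have -> : c * rint 0 L (fun y => f y * kernel n x y) - f x =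
    c * rint 0 L (fun y => f y * kernel n x y - f x * kernel n x y).
  rewrite (rintB fki (itgZ _ ki)) (rintZ _ ki) rint_kernel mulrBr; congr (_ - _).
  by rewrite mulrCA mulVf ?mulr1// gt_eqF.
have di := itgB fki (itgZ (f x) ki).
rewrite normrM (ger0_norm (ltW c0)) mulrC ler_pdivrMr//.
rewrite (le_trans (normr_rint di))//.
have bi := itgB (itgZ (e / 2 + 2 * C) ki) (itgZ C k1i).
apply: (@le_trans _ _ (rint 0 L (fun y => (e / 2 + 2 * C) * kernel n x y - C * kernel n.+1 x y))).
  apply: le_rint => //; first exact: itg_norm.
  move=> y yL; rewrite -mulrBl normrM (ger0_norm (exprn_ge0 _ (K0 y))).
  rewrite [leRHS](_ : _ = (e / 2 + C * (1 - cos (x - y))) * kernel n x y).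
    by rewrite ler_wpM2r ?exprn_ge0// CP.
  by rewrite exprS cosB /=; ring.
rewrite (rintB (itgZ _ ki) (itgZ _ k1i)) (rintZ _ ki) (rintZ _ k1i) !rint_kernel /=.
rewrite (_ : _ - _ = (e / 2 + C / (n%:R + 1)) * kernel_mass n); last first.
  by field; rewrite gt_eqF// ltr_wpDl.
by rewrite ler_pM2r//; lra.
Qed.

Lemma cts_rint_eq0 a b g : cts a b g -> a < b -> (forall x, a <= x <= b -> 0 <= g x) ->
  rint a b g = 0 -> forall x, a <= x <= b -> g x = 0.
Proof.
move=> cg ab g0 ig x xab; apply/eqP; apply: contraT => gx.
have gx0 : 0 < g x by rewrite lt_neqAle eq_sym gx g0.
have [|d d0 dP] := (ctsP a b g).1 cg x xab (g x / 2); first by rewrite divr_gt0.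
pose s := Num.max a (x - d / 2); pose t := Num.min b (x + d / 2).
have as_ : a <= s by rewrite le_max lexx.
have tb : t <= b by rewrite ge_min lexx.
have xs : x - d / 2 <= s by rewrite le_max lexx orbT.
have tx : t <= x + d / 2 by rewrite ge_min lexx orbT.
have st : s < t by rewrite lt_min !gt_max; lra.
have gi := cts_itg cg.
have sb : s <= b by lra.
have : rint s t (fun=> g x / 2) <= rint s t g.
  apply: le_rint; [exact: itg_cst|exact: itgS gi|].
  move=> y yst; have : `|g y - g x| < g x / 2.
    by apply: dP; [lra|rewrite ltr_norml; lra].
  by rewrite ltr_norml; lra.
rewrite rint_cst ?(ltW st)//.
have : 0 < g x / 2 * (t - s) by rewrite mulr_gt0 ?subr_gt0// divr_gt0.
have : rint a b g = rint a s g + (rint s t g + rint t b g).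
  rewrite (rint_cat as_ sb)// (rint_cat (ltW st) tb)//; exact: itgS gi.
have : 0 <= rint a s g by apply: rint_ge0 => y ys; apply: g0; lra.
have : 0 <= rint t b g by apply: rint_ge0 => y ys; apply: g0; lra.
rewrite ig; lra.
Qed.

(** By Lebesgue's differentiation theorem for the primitive of [f]. *)
Lemma rint_eq0_ae a b f : a < b -> itg a b f ->
  (forall x, a <= x <= b -> rint a x f = 0) -> {ae mu, forall x, a <= x <= b -> f x = 0}.
Proof.
move=> ab fi f0; pose g := f \_ `[a, b].
have gi : mu.-integrable setT (EFin \o g).
  by move: fi; rewrite /itg integrable_mkcond//= (restrict_EFin f).
have gS A : measurable A -> mu.-integrable A (EFin \o g).
  by move=> mA; exact: integrableS gi.
have g0 x : \int[mu]_(y in `]-oo, x]) g y = 0.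
  rewrite /g -Rintegral_mkcondr.
  have [xa|ax] := ltP x a.
    rewrite (_ : _ `&` _ = set0) ?Rintegral_set0// -subset0 => y [] /=.
    by rewrite !in_itv/= => yx /andP[ay _]; move: (le_trans ay yx); rewrite leNgt xa.
  rewrite (_ : _ `&` _ = [set` `[a, Num.min x b]]).
    apply: f0; rewrite ge_min lexx orbT le_min ax andbT; exact: ltW.
  apply/seteqP; split => y /=; rewrite !in_itv/= le_min.
    by case=> -> /andP[-> ->].
  by move=> /and3P[-> -> ->].
have [||N [mN N0 NP]] := @FTC1Ny R g; first by move=> y; exact: gS.
  by apply: integrable_locally => //; exact: measurable_itv.
exists N; split => // x /= xf; apply: NP => /= -[_ gx]; apply: xf => xab.
have : g x = f x by rewrite /g patchE mem_set//= in_itv.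
move=> <-; rewrite -gx (_ : (fun x => _) = cst 0) ?derive1_cst//.
by apply/funext => y; rewrite g0.
Qed.

(** A trigonometric polynomial of zero mean is the derivative of another one,
    so that by parts the primitive [P] of [f] is orthogonal to it, and
    [Q = P - mean P] is orthogonal to all of them. Approximating [Q] uniformly
    shows that it is orthogonal to itself. *)
Lemma fundamental_lemma f : itg 0 L f ->
  (forall psi, trig psi -> rint 0 L (fun x => f x * psi x) = 0) ->
  {ae mu, forall x, 0 <= x <= L -> f x = 0}.
Proof.
move=> fi f0; have L0 : (0 : R) <= L by exact: twopi_ge0.
pose P (x : R) : R := rint 0 x f.
have aP : ac 0 L P f by exact: rint_ac.
have cP := ac_cts L0 aP.
have P0 : P 0 = 0 by exact: rint_pt.
have PL : P L = 0.
  rewrite -(f0 _ (trig_cst 1)) /P; apply: eq_rint => x _; by rewrite mulr1.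
pose m := rint 0 L P / L; pose Q (x : R) : R := P x - m.
have cQ : cts 0 L Q by apply: ctsB => //; exact: cts_cst.
have Qchi chi : trig chi -> rint 0 L (fun x => Q x * chi x) = 0.
  move=> tchi; have [Psi [c [tPsi dPsi]]] := trig_antiderivative tchi.
  have cchi : cts 0 L chi by apply: continuous_cts; exact: trig_continuous.
  have aPsi : ac 0 L Psi (fun x => chi x - c).
    by apply: (ac_is_derive L0 (fun y _ => dPsi y)); apply: ctsB => //; exact: cts_cst.
  have aPPsi := acM L0 aP aPsi.
  have i1 : itg 0 L (fun x => f x * Psi x).
    by apply: itgM_cts => //; apply: continuous_cts; exact: trig_continuous.
  have Pchi := cts_itg (ctsM cP cchi).
  have := ac_rint L0 aPPsi; rewrite P0 PL !mul0r subrr.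
  rewrite (rintD i1 (itgM_cts (cts_itg cP) (ctsB cchi (@cts_cst R 0 L c)))) f0// add0r => E1.
  have E2 : rint 0 L (fun x => P x * chi x) = c * rint 0 L P.
    apply/eqP; rewrite -subr_eq0 -[X in _ == X]E1 -(rintZ _ (cts_itg cP)).
    rewrite -(rintB Pchi (itgZ _ (cts_itg cP))).
    by apply/eqP/eq_rint => x _; ring.
  have E3 : rint 0 L chi = c * L.
    have := ac_rint L0 aPsi; rewrite (rintB (cts_itg cchi) (@itg_cst R 0 L c)) rint_circle_cst.
    have := trig_periodic tPsi 0; rewrite add0r => ->; rewrite subrr => /eqP.
    by rewrite subr_eq0 => /eqP.
  rewrite (@eq_rint _ _ _ _ (fun x => P x * chi x - m * chi x)); last first.
    by move=> x _; rewrite /Q; ring.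
  rewrite (rintB Pchi (itgZ _ (cts_itg cchi))) (rintZ _ (cts_itg cchi)) E2 E3 /m.
  by rewrite [c * L]mulrC mulrA divfK ?gt_eqF ?twopi_gt0// mulrC subrr.
have QL : Q L = Q 0 by rewrite /Q PL P0.
have cQ2 := cts_itg (@ctsX R 0 L Q 2 cQ).
have Q20 : rint 0 L (fun x => Q x ^+ 2) = 0.
  apply/eqP; rewrite eq_le rint_sqr_ge0 andbT.
  pose N := rint 0 L (fun x => `|Q x|).
  have N0 : 0 <= N by apply: rint_ge0 => x _.
  apply/ler_addgt0Pr => e e0; rewrite add0r.
  have N1 : 0 < N + 1 by lra.
  have [chi tchi chiQ] := trig_dense cQ QL (divr_gt0 e0 N1).
  have cchi : cts 0 L chi by apply: continuous_cts; exact: trig_continuous.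
  rewrite -[leLHS]subr0 -[X in _ - X <= _](Qchi _ tchi) -(rintB cQ2 (cts_itg (ctsM cQ cchi))).
  have iN := itgZ (e / (N + 1)) (itg_norm (cts_itg cQ)).
  apply: (@le_trans _ _ (e / (N + 1) * N)).
    rewrite -(rintZ _ (itg_norm (cts_itg cQ))).
    apply: le_rint => //; first by apply: itgB => //; exact/cts_itg/ctsM.
    move=> x xL; rewrite (_ : _ - _ = (Q x - chi x) * Q x); last by ring.
    by rewrite (le_trans (ler_norm _))// normrM ler_wpM2r// distrC chiQ.
  by rewrite mulrAC ler_pdivrMr// ler_pM2l//; lra.
have Q0 : forall x, 0 <= x <= L -> Q x = 0.
  move=> x xL; apply/eqP; rewrite -sqrf_eq0; apply/eqP.
  apply: (@cts_rint_eq0 0 L (fun x => Q x ^+ 2)) => //; first exact: ctsX.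
  - exact: twopi_gt0.
  - by move=> y _; exact: sqr_ge0.
apply: rint_eq0_ae => //; first exact: twopi_gt0.
move=> x xL; have := Q0 _ xL; have := Q0 0; rewrite lexx L0 => /(_ isT).
by rewrite /Q P0 -/(P x); lra.
Qed.

End Trigonometric.

(** * Weak derivatives and their continuous primitives *)

Section WeakDerivatives.
Context {R : realType}.
Local Notation mu := (@lebesgue_measure R).
Local Notation L := (@pi R *+ 2 : R).
Implicit Types (a b c e s t m x y : R) (f g h u v w F G psi : R -> R) (k p n : nat).

Lemma in_circle x : (x \in (circle : set R)) = (0 <= x <= L).
Proof. by apply/idP/idP; rewrite inE /circle/= in_itv. Qed.

Lemma poweR2 (x : \bar R) : (0 <= x -> x `^ 2 = x ^+ 2)%E.
Proof.
case: x => [r|_|//]; last by rewrite poweRyr ?pnatr_eq0// expe2 mulyy.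
by rewrite lee_fin => r0; rewrite poweR_EFin powR_mulrn// EFin_expe.
Qed.

Lemma L2norm_ge0 u : (0 <= L2norm u)%E. Proof. exact: Lnorm_ge0. Qed.

Lemma sqr_L2norm u : (L2norm u ^+ 2 = \int[mu]_(x in circle) (u x ^+ 2)%:E)%E.
Proof.
rewrite -poweR2 ?L2norm_ge0// /L2norm poweR_Lnorm ?pnatr_eq0//.
rewrite [RHS]integral_mkcond; apply: eq_integral => x _ /=.
rewrite /patch; case: ifPn => _ /=; last by rewrite normr0 powR0// pnatr_eq0.
by rewrite powR_mulrn// real_normK ?num_real.
Qed.

Lemma L2per_sqi u : L2per u -> sqi 0 L u.
Proof.
move=> [_ mu_ u2]; have mu2 : measurable_fun (circle : set R) u.
  by apply: measurable_funTS.
split=> //; apply/integrableP; split.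
  by apply/measurable_EFinP; exact: measurable_funX.
rewrite (_ : \int[mu]_(x in _) _ = L2norm u ^+ 2)%E.
  by rewrite expe2 lte_mul_pinfty// ?L2norm_ge0// ge0_fin_numE ?L2norm_ge0.
by rewrite sqr_L2norm; apply: eq_integral => x _ /=; rewrite ger0_norm// sqr_ge0.
Qed.

Lemma sqr_L2normE u : sqi 0 L u ->
  (L2norm u ^+ 2 = (rint 0 L (fun x => u x ^+ 2))%:E)%E.
Proof.
by move=> [_ u2]; rewrite sqr_L2norm /rint /Rintegral fineK//; exact: integrable_fin_num.
Qed.

Lemma sqi_L2per u : periodic u L -> measurable_fun setT u -> sqi 0 L u -> L2per u.
Proof.
move=> pu mu_ su; split => //; rewrite ltNge leye_eq; apply/eqP => uoo.
by have := sqr_L2normE su; rewrite uoo expe2 mulyy.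
Qed.

Lemma L2perB u v : L2per u -> L2per v -> L2per (fun x => u x - v x).
Proof.
move=> u2 v2; apply: sqi_L2per.
- by move=> x; case: u2 => -> _ _; case: v2 => -> _ _.
- by apply: measurable_funB; [case: u2|case: v2].
- by apply: sqiB; exact: L2per_sqi.
Qed.

Lemma derive1_periodic f c : periodic f c -> periodic (derive1 f) c.
Proof.
move=> pf x; rewrite /derive1.
by under eq_fun do rewrite addrA !pf.
Qed.

Lemma test_derive1n psi k : test_function psi -> test_function (derive1n k psi).
Proof.
move=> [ppsi dpsi]; split; last first.
  move=> j x; rewrite (_ : derive1n j _ = derive1n (j + k) psi)//.
  by rewrite /derive1n iterD.
elim: k => [//|k ih] x; rewrite derive1nS; exact: derive1_periodic.
Qed.

Lemma test_continuous psi k : test_function psi -> continuous (derive1n k psi).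
Proof.
by move=> [_ dpsi] x; apply/differentiable_continuous/derivable1_diffP/dpsi.
Qed.

Lemma test_cts psi k a b : test_function psi -> cts a b (derive1n k psi).
Proof. by move=> tpsi; apply: continuous_cts; exact: test_continuous. Qed.

Lemma test_ac psi k a b : a <= b -> test_function psi ->
  ac a b (derive1n k psi) (derive1n k.+1 psi).
Proof.
move=> ab tpsi; rewrite derive1nS; apply: ac_derivable => //.
  by move=> x _; exact: tpsi.2.
by rewrite -derive1nS; exact: test_cts.
Qed.

Lemma test_ends psi : test_function psi -> psi L = psi 0.
Proof. by move=> [ppsi _]; have := ppsi 0; rewrite add0r. Qed.

Lemma rint_parts F f G g : ac 0 L F f -> ac 0 L G g -> F L = F 0 -> G L = G 0 ->
  rint 0 L (fun x => f x * G x) = - rint 0 L (fun x => F x * g x).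
Proof.
move=> aF aG FL GL; have L0 := @twopi_ge0 R.
have cF := ac_cts L0 aF; have cG := ac_cts L0 aG.
have i1 := itgM_cts aF.1 cG.
have i2 : itg 0 L (fun x => F x * g x).
  by apply: eq_itg (itgM_cts aG.1 cF) => x _; rewrite mulrC.
have := ac_rint L0 (acM L0 aF aG); rewrite (rintD i1 i2) FL GL subrr => /eqP.
by rewrite addr_eq0 => /eqP.
Qed.

Lemma ac_wderiv F f : ac 0 L F f -> F L = F 0 -> is_wderiv 1 F f.
Proof.
move=> aF FL psi tpsi.
have aP : ac 0 L psi (derive1n 1 psi) by exact: (@test_ac psi 0 0 L (@twopi_ge0 R) tpsi).
rewrite expr1 mulN1r -[LHS]opprK; congr (- _).
by have := rint_parts aF aP FL (test_ends tpsi).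
Qed.

Lemma wderiv_trans k u v w : is_wderiv k u v -> is_wderiv k.+1 u w -> is_wderiv 1 v w.
Proof.
move=> uv uw psi tpsi; have := uv _ (test_derive1n 1 tpsi); have := uw _ tpsi.
rewrite (_ : derive1n k (derive1n 1 psi) = derive1n k.+1 psi); last first.
  by rewrite /derive1n -iterD addn1.
move=> -> E; have k0 : (-1) ^+ k != 0 :> R by rewrite signr_eq0.
by apply: (mulfI k0); rewrite -E exprS mulN1r mulNr expr1 mulN1r mulrN.
Qed.

Lemma wderiv_comp k u v w : is_wderiv 1 u v -> is_wderiv k v w -> is_wderiv k.+1 u w.
Proof.
move=> uv vw psi tpsi; have := uv _ (test_derive1n k tpsi); have := vw _ tpsi.
rewrite (_ : derive1n 1 (derive1n k psi) = derive1n k.+1 psi)//.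
by move=> -> ->; rewrite expr1 exprS mulrA.
Qed.

Lemma wderiv0 u v : itg 0 L u -> itg 0 L v ->
  {ae mu, forall x, 0 <= x <= L -> u x = v x} -> is_wderiv 0 u v.
Proof.
move=> iu iv uv psi tpsi; rewrite expr0 mul1r.
have cp : cts 0 L psi by exact: (@test_cts psi 0).
apply: (ae_eq_rint (itg_measurable (itgM_cts iu cp)) (itg_measurable (itgM_cts iv cp))).
by apply: (aeS uv) => x uvx /uvx ->.
Qed.

Lemma ae_eq_wderivl k u u' v : itg 0 L u -> itg 0 L u' ->
  {ae mu, forall x, 0 <= x <= L -> u x = u' x} -> is_wderiv k u v -> is_wderiv k u' v.
Proof.
move=> iu iu' uu' uv psi tpsi; rewrite -(uv _ tpsi).
have cp : cts 0 L (derive1n k psi) by exact: test_cts.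
apply/esym/(ae_eq_rint (itg_measurable (itgM_cts iu cp)) (itg_measurable (itgM_cts iu' cp))).
by apply: (aeS uu') => x uu'x /uu'x ->.
Qed.

Lemma ae_eq_wderivr k u v v' : itg 0 L v -> itg 0 L v' ->
  {ae mu, forall x, 0 <= x <= L -> v x = v' x} -> is_wderiv k u v -> is_wderiv k u v'.
Proof.
move=> iv iv' vv' uv psi tpsi; rewrite (uv _ tpsi); congr (_ * _).
have cp : cts 0 L psi by exact: (@test_cts psi 0).
apply: (ae_eq_rint (itg_measurable (itgM_cts iv cp)) (itg_measurable (itgM_cts iv' cp))).
by apply: (aeS vv') => x vv'x /vv'x ->.
Qed.

Lemma wderiv_unique k u v v' : itg 0 L v -> itg 0 L v' ->
  is_wderiv k u v -> is_wderiv k u v' -> {ae mu, forall x, 0 <= x <= L -> v x = v' x}.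
Proof.
move=> iv iv' uv uv'.
apply: (aeS (fundamental_lemma (itgB iv iv') _)) => [psi tpsi|x + xL].
  have cp : cts 0 L psi by apply/continuous_cts/trig_continuous.
  rewrite (@eq_rint _ _ _ _ (fun x => v x * psi x - v' x * psi x)); last first.
    by move=> x _; rewrite mulrBl.
  rewrite (rintB (itgM_cts iv cp) (itgM_cts iv' cp)).
  have := uv _ (trig_test tpsi); rewrite (uv' _ (trig_test tpsi)).
  have /mulfI e : (-1) ^+ k != 0 :> R by rewrite signr_eq0.
  by move=> /e e'; rewrite /rint /circle in e' *; rewrite e' subrr.
by move=> /(_ xL)/eqP; rewrite subr_eq0 => /eqP.
Qed.

Lemma is_wderivB k u u' v v' : itg 0 L u -> itg 0 L u' -> itg 0 L v -> itg 0 L v' ->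
  is_wderiv k u v -> is_wderiv k u' v' ->
  is_wderiv k (fun x => u x - u' x) (fun x => v x - v' x).
Proof.
move=> iu iu' iv iv' uv uv' psi tpsi.
have cp : cts 0 L psi by exact: (@test_cts psi 0).
have ck : cts 0 L (derive1n k psi) by exact: test_cts.
have := rintB (itgM_cts iu ck) (itgM_cts iu' ck).
have := rintB (itgM_cts iv cp) (itgM_cts iv' cp).
under eq_rint do rewrite -mulrBl; move=> E1.
under eq_rint do rewrite -mulrBl; move=> E2.
have := uv _ tpsi; have := uv' _ tpsi; rewrite /rint /circle in E1 E2 * => E3 E4.
by rewrite E2 E3 E4 E1 mulrBr.
Qed.

(** A function and its weak derivative are linked by a periodic primitive: if
    [P] is a primitive of [v], then [u - P] is orthogonal to the derivatives of
    test functions, hence constant. *)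
Lemma weak_primitive u v : itg 0 L u -> itg 0 L v -> is_wderiv 1 u v ->
  exists F, [/\ ac 0 L F v, F L = F 0 & {ae mu, forall x, 0 <= x <= L -> u x = F x}].
Proof.
move=> iu iv uv; have L0 := @twopi_ge0 R.
pose P (x : R) : R := rint 0 x v.
have aP : ac 0 L P v by exact: rint_ac.
have cP := ac_cts L0 aP.
have PL : P L = P 0.
  have := uv _ (trig_test (trig_cst 1)); rewrite expr1 mulN1r.
  rewrite (_ : derive1n 1 _ = cst 0); last first.
    by apply/funext => x; rewrite derive1n1 derive1_cst.
  have -> : \int[mu]_(x in circle) (u x * cst 0 x) = 0.
    rewrite -/(rint 0 L _) (@eq_rint _ _ _ _ (fun=> 0)) ?rint_circle_cst ?mul0r// => x _.
    by rewrite mulr0.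
  move=> /esym/eqP; rewrite oppr_eq0 -/(rint 0 L _) => /eqP E.
  rewrite /P rint_pt -[RHS]E; apply: eq_rint => x _; by rewrite mulr1.
pose D x := u x - P x; have iD : itg 0 L D by exact: itgB iu (cts_itg cP).
pose c : R := rint 0 L D / L.
exists (fun x => P x + c); split.
- have := acD aP (@ac_cst R 0 L c); apply: ae_eq_ac; first exact: itg_measurable.
  by apply: aeW => x _; rewrite addr0.
- by rewrite PL.
have iDc : itg 0 L (fun x => D x - c) by apply: itgB => //; exact: itg_cst.
apply: (aeS (fundamental_lemma iDc _)) => [chi tchi|x + xL]; last first.
  by move=> /(_ xL); rewrite /D; lra.
have [Psi [d [tPsi dPsi]]] := trig_antiderivative tchi.
have cchi : cts 0 L chi by apply/continuous_cts/trig_continuous.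
have EPsi : derive1n 1 Psi = fun x => chi x - d.
  by apply/funext => x; rewrite derive1n1 derive1E; have [_ ->] := dPsi x.
have aPsi : ac 0 L Psi (fun x => chi x - d).
  by apply: (ac_is_derive L0 (fun y _ => dPsi y)); apply: ctsB => //; exact: cts_cst.
have cd : cts 0 L (fun x => chi x - d) by apply: ctsB => //; exact: cts_cst.
have E1 : rint 0 L (fun x => D x * (chi x - d)) = 0.
  have := uv _ (trig_test tPsi); have := ac_wderiv aP PL (trig_test tPsi).
  rewrite EPsi -/(rint 0 L _) => <-; rewrite -!/(rint 0 L _) => E.
  have := rintB (itgM_cts iu cd) (itgM_cts (cts_itg cP) cd); rewrite E subrr => H.
  rewrite -[RHS]H.
  by apply: eq_rint => x _; rewrite /D mulrBl.
have E2 : rint 0 L chi = d * L.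
  have := ac_rint L0 aPsi; rewrite (rintB (cts_itg cchi) (@itg_cst R 0 L d)) rint_circle_cst.
  by rewrite (test_ends (trig_test tPsi)) subrr => /eqP; rewrite subr_eq0 => /eqP.
rewrite (@eq_rint _ _ _ _ (fun x => (D x * (chi x - d) + d * D x) - c * chi x)); last first.
  by move=> x _; ring.
have i1 := itgM_cts iD cd.
rewrite (rintB (itgD i1 (itgZ d iD)) (itgZ c (cts_itg cchi))) (rintD i1 (itgZ d iD)).
rewrite (rintZ _ iD) (rintZ _ (cts_itg cchi)) E1 E2 add0r /c mulrCA.
by rewrite divfK ?gt_eqF ?twopi_gt0// subrr.
Qed.

Lemma wderivP p u k : Hper p u -> (k <= p)%N ->
  L2per (wderiv k u) /\ is_wderiv k u (wderiv k u).
Proof.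
move=> [_ _ H] /H[v v2 uv].
suff : [set v | L2per v /\ is_wderiv k u v] (wderiv k u) by [].
by apply: xgetPex; exists v.
Qed.

Lemma wderiv_eq k u v : L2per u -> L2per v -> is_wderiv k u v ->
  L2per (wderiv k u) /\ {ae mu, forall x, 0 <= x <= L -> wderiv k u x = v x}.
Proof.
move=> u2 v2 uv; have [w2 uw] : [set v | L2per v /\ is_wderiv k u v] (wderiv k u).
  by apply: xgetPex; exists v.
by split => //; apply: wderiv_unique uw uv; exact/sqi_itg/L2per_sqi.
Qed.

Lemma sqr_Hnorm p u : L2per (wderiv p u) ->
  (Hnorm p u ^+ 2 = (rint 0 L (fun x => wderiv p u x ^+ 2))%:E)%E.
Proof. by move=> /L2per_sqi; exact: sqr_L2normE. Qed.

(** [F0], ..., [F3] are the continuous representatives of a function of class H^4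
    and of its weak derivatives of orders [1] to [3]. *)
Definition smooth_rep u F0 F1 F2 F3 :=
  [/\ [/\ ac 0 L F0 F1, ac 0 L F1 F2, ac 0 L F2 F3 & ac 0 L F3 (wderiv 4 u)],
      [/\ F0 L = F0 0, F1 L = F1 0, F2 L = F2 0 & F3 L = F3 0],
      {ae mu, forall x, 0 <= x <= L -> u x = F0 x} &
      [/\ {ae mu, forall x, 0 <= x <= L -> wderiv 1 u x = F1 x},
      {ae mu, forall x, 0 <= x <= L -> wderiv 2 u x = F2 x} &
      {ae mu, forall x, 0 <= x <= L -> wderiv 3 u x = F3 x}]].

Lemma Hper4_rep u : Hper 4 u -> exists F0 F1 F2 F3, smooth_rep u F0 F1 F2 F3.
Proof.
move=> Hu; have L0 := @twopi_ge0 R.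
have iu : itg 0 L u by case: Hu => /L2per_sqi/sqi_itg.
have iw k : (k <= 4)%N -> itg 0 L (wderiv k u).
  by move=> /(wderivP Hu)[/L2per_sqi/sqi_itg].
have stp k : (k < 4)%N -> is_wderiv 1 (wderiv k u) (wderiv k.+1 u).
  move=> k4; apply: (@wderiv_trans k u); last exact: (wderivP Hu _).2.
  by apply: (wderivP Hu _).2; exact: ltnW.
have w1 : is_wderiv 1 u (wderiv 1 u) by exact: (wderivP Hu _).2.
have [F0 [a0 p0 e0]] := weak_primitive iu (iw 1%N isT) w1.
have [F1 [a1 p1 e1]] := weak_primitive (iw 1%N isT) (iw 2%N isT) (stp 1%N isT).
have [F2 [a2 p2 e2]] := weak_primitive (iw 2%N isT) (iw 3%N isT) (stp 2%N isT).
have [F3 [a3 p3 e3]] := weak_primitive (iw 3%N isT) (iw 4%N isT) (stp 3%N isT).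
exists F0, F1, F2, F3; split => //; split => //.
- by apply: ae_eq_ac e1 a0; exact: cts_measurable (ac_cts L0 a1).
- by apply: ae_eq_ac e2 a1; exact: cts_measurable (ac_cts L0 a2).
- by apply: ae_eq_ac e3 a2; exact: cts_measurable (ac_cts L0 a3).
Qed.

End WeakDerivatives.

(** * Functions on rectangles *)

Section Rectangles.
Context {R : realType}.
Local Notation mu := (@lebesgue_measure R).
Local Notation mu2 := (mu \x mu)%E.
Implicit Types (a b c d e s t x y : R) (f g h : R -> R) (G H : R -> R -> R) (n : nat).

Definition rect a b c d : set (R * R) := `[a, b] `*` `[c, d].

Definition measurable2 a b c d G :=
  measurable_fun (rect a b c d) (fun z : R * R => G z.1 z.2).

Definition itg2 a b c d G :=
  mu2.-integrable (rect a b c d) (fun z : R * R => (G z.1 z.2)%:E).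

Lemma measurable_rect a b c d : measurable (rect a b c d).
Proof. by apply: measurableX. Qed.

Lemma in_rect a b c d (z : R * R) :
  rect a b c d z <-> (a <= z.1 <= b) /\ (c <= z.2 <= d).
Proof. by rewrite /rect /= !in_itv. Qed.

Lemma subset_rect a b c d a' b' : a' <= a -> b <= b' -> rect a b c d `<=` rect a' b' c d.
Proof. by move=> a'a bb' z /in_rect[? ?]; apply/in_rect; split => //; lra. Qed.

Lemma itg2S a b c d a' b' G : a' <= a -> b <= b' -> itg2 a' b' c d G -> itg2 a b c d G.
Proof.
move=> a'a bb'; apply: integrableS; [exact: measurable_rect|exact: measurable_rect|].
exact: subset_rect.
Qed.

Lemma itg2_measurable a b c d G : itg2 a b c d G -> measurable2 a b c d G.
Proof. by move=> /(measurable_int _)/measurable_EFinP. Qed.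

Lemma itg2D a b c d G H : itg2 a b c d G -> itg2 a b c d H ->
  itg2 a b c d (fun s x => G s x + H s x).
Proof. by move=> iG iH; refine (integrableD _ iG iH); exact: measurable_rect. Qed.

Lemma itg2B a b c d G H : itg2 a b c d G -> itg2 a b c d H ->
  itg2 a b c d (fun s x => G s x - H s x).
Proof. by move=> iG iH; refine (integrableB _ iG iH); exact: measurable_rect. Qed.

Lemma itg2_norm a b c d G : itg2 a b c d G -> itg2 a b c d (fun s x => `|G s x|).
Proof. by move=> iG; exact: (integrable_norm iG). Qed.

Lemma le_itg2 a b c d G H : measurable2 a b c d G ->
  (forall s x, a <= s <= b -> c <= x <= d -> `|G s x| <= `|H s x|) ->
  itg2 a b c d H -> itg2 a b c d G.
Proof.
move=> mG GH; apply: le_integrable; first exact: measurable_rect.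
  exact/measurable_EFinP.
by move=> z /in_rect[? ?]; rewrite lee_fin GH.
Qed.

Lemma itg2_cst a b c d (k : R) : itg2 a b c d (fun _ _ => k).
Proof.
apply: measurable_bounded_integrable; [exact: measurable_rect| | |].
- suff : (mu2 (rect a b c d) < +oo)%E by [].
  have E : mu2 (rect a b c d) = (mu `[a, b]%classic * mu `[c, d]%classic)%E.
    by apply: product_measure1E.
  rewrite E !lebesgue_measure_itv/=.
  by do 2 case: ifP => _; rewrite -?EFinD ?mule0 ?mul0e// -EFinM ltry.
- exact: measurable_cst.
- by exists `|k|; split => // r kr z _; exact: ltW.
Qed.

Lemma itg2M_bounded a b c d G H (M : R) : itg2 a b c d G -> measurable2 a b c d H ->
  (forall s x, a <= s <= b -> c <= x <= d -> `|H s x| <= M) ->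
  itg2 a b c d (fun s x => G s x * H s x).
Proof.
move=> iG mH HM; have iM : itg2 a b c d (fun s x => M * G s x).
  by refine (integrableZl _ M iG); exact: measurable_rect.
apply: (le_itg2 _ _ iM).
  by apply: measurable_funM => //; exact: itg2_measurable.
move=> s x sab xcd; rewrite !normrM mulrC ler_wpM2r//.
by rewrite (le_trans (HM _ _ sab xcd))// ler_norm.
Qed.

Lemma itg2_bounded a b c d H (M : R) : measurable2 a b c d H ->
  (forall s x, a <= s <= b -> c <= x <= d -> `|H s x| <= M) -> itg2 a b c d H.
Proof.
move=> mH HM; have := itg2M_bounded (itg2_cst a b c d 1) mH HM.
by apply: eq_integrable => //; [exact: measurable_rect|move=> z _; rewrite mul1r].
Qed.

Lemma measurable2_snd a b c d f : measurable_fun `[c, d] f -> measurable2 a b c d (fun _ => f).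
Proof.
move=> mf; have mf' : measurable_fun setT (f \_ `[c, d]).
  by apply/(measurable_restrictT _ _).1.
have : measurable_fun (rect a b c d) ((f \_ `[c, d]) \o snd).
  by apply: measurable_funTS; apply: measurableT_comp.
apply: eq_measurable_fun => z; rewrite inE => /in_rect[_ zcd] /=.
by rewrite patchE mem_set//= in_itv.
Qed.

(** A function that is measurable in [x] and continuous in [s] is the limit of
    its step approximations in [s]. *)
Lemma measurable2_cts a b c d G : a < b ->
  (forall s, a <= s <= b -> measurable_fun `[c, d] (G s)) ->
  (forall x, c <= x <= d -> cts a b (G^~ x)) -> measurable2 a b c d G.
Proof.
move=> ab mG cG; pose h n : R := (b - a) / n.+1%:R.
have h0 n : 0 < h n by rewrite divr_gt0 ?subr_gt0.
pose I n k : set R := `[a + k%:R * h n, a + k.+1%:R * h n[%classic.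
pose S n (z : R * R) : R :=
  \sum_(k < n.+2) (\1_(I n k) z.1 * (G (a + k%:R * h n) \_ `[c, d]) z.2).
have mS n : measurable_fun (rect a b c d) (S n).
  apply: measurable_sum => k.
  have [kn|kn] := leqP k n.+1; last by have := ltn_ord k; rewrite ltnS leqNgt kn.
  apply: measurable_funM; apply: measurable_funTS.
    apply: (@measurableT_comp _ _ _ _ _ _ (\1_(I n k) : R -> R) _ fst) => //.
    apply: measurable_indic; exact: measurable_itv.
  apply: (@measurableT_comp _ _ _ _ _ _ (G (a + k%:R * h n) \_ `[c, d]) _ snd) => //.
  apply/(measurable_restrictT _ _).1 => //; apply: mG.
  have k0 : 0 <= (k : nat)%:R * h n by rewrite mulr_ge0// ltW.
  have : (k : nat)%:R * h n <= n.+1%:R * h n by rewrite ler_wpM2r ?ler_nat// ltW.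
  rewrite {2}/h mulrC [n.+1%:R * _]mulrC divfK ?pnatr_eq0// mulrC; lra.
have step n (z : R * R) : rect a b c d z ->
    exists2 r, a <= r <= b & `|r - z.1| <= h n /\ S n z = G r z.2.
  move=> /in_rect[/andP[az zb] zcd].
  pose k := Num.truncn ((z.1 - a) / h n).
  have q0 : 0 <= (z.1 - a) / h n by rewrite divr_ge0 ?subr_ge0// ltW.
  have [k1 k2] : k%:R * h n <= z.1 - a /\ z.1 - a < k.+1%:R * h n.
    by split; [rewrite -ler_pdivlMr// truncn_le|rewrite -ltr_pdivrMr// truncnS_gt].
  have kn : (k < n.+2)%N.
    rewrite ltnS -(ler_nat R); have : k%:R * h n <= n.+1%:R * h n.
      rewrite (le_trans k1)// /h mulrC divfK ?pnatr_eq0//; lra.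
    by rewrite ler_pM2r.
  exists (a + k%:R * h n); first by have := h0 n; have : 0 <= k%:R * h n; [rewrite mulr_ge0// ltW|lra].
  split.
    rewrite ler_distl; move: k2; rewrite -natr1 mulrDl mul1r; lra.
  rewrite /S (bigD1 (Ordinal kn))//= big1 ?addr0.
    rewrite indicE mem_set ?mul1r; last by rewrite /I /= in_itv/=; lra.
    by rewrite patchE mem_set//= in_itv.
  move=> j jk; rewrite indicE memNset ?mul0r// /I /= in_itv/= => /andP[j1 j2].
  case/eqP : jk; apply: val_inj => /=; apply/eqP; rewrite eqn_leq -ltnS -(ltnS k).
  rewrite -(ltr_nat R) -(ltr_nat R k); apply/andP; split.
    by rewrite -(ltr_pM2r (h0 n)); lra.
  by rewrite -(ltr_pM2r (h0 n)); lra.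
apply: (@measurable_fun_cvg _ _ _ _ S) => //.
move=> z zr; have [zab zcd] := (in_rect _ _ _ _ _).1 zr.
apply/cvgrPdist_lt => e e0.
have [d0 d00 dP] := (ctsP a b _).1 (cG _ zcd) _ zab _ e0.
have hn : \forall n \near \oo, h n < d0.
  have : h n @[n --> \oo] --> (b - a) * 0.
    by apply: cvgMr; exact: cvg_harmonic.
  rewrite mulr0 => /cvgrPdist_lt/(_ _ d00); apply: filterS => n.
  by rewrite sub0r normrN gtr0_norm.
near=> n; have [r rab [rz ->]] := step n z zr.
rewrite distrC; apply: dP => //; rewrite (le_lt_trans rz)//.
by near: n.
Unshelve. all: by end_near. Qed.

Definition rint2 a b c d G : R := \int[mu2]_(z in rect a b c d) G z.1 z.2.

Section FubiniRect.
Variables (a b c d : R) (G : R -> R -> R).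
Hypothesis iG : itg2 a b c d G.

Let f : R * R -> \bar R := (fun z => (G z.1 z.2)%:E) \_ (rect a b c d).

Let fi : mu2.-integrable setT f.
Proof. by apply/(integrable_mkcond _ _).1 => //; exact: measurable_rect. Qed.

Let fE1 s : a <= s <= b -> (fun x => f (s, x)) = (EFin \o G s) \_ `[c, d].
Proof.
move=> sab; apply/funext => x; rewrite /f !patchE; congr (if _ then _ else _).
by apply/idP/idP; rewrite !inE /rect /= !in_itv/= sab; [case|].
Qed.

Let fE2 x : c <= x <= d -> (fun s => f (s, x)) = (EFin \o G^~ x) \_ `[a, b].
Proof.
move=> xcd; apply/funext => s; rewrite /f !patchE; congr (if _ then _ else _).
by apply/idP/idP; rewrite !inE /rect /= !in_itv/= xcd; [case|].
Qed.

Lemma itg2_section : {ae mu, forall x, c <= x <= d -> itg a b (G^~ x)}.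
Proof.
apply: (aeS (ae_integrable2 fi)) => x + xcd; rewrite (fE2 xcd) => ?.
by rewrite /itg integrable_mkcond.
Qed.

Let fine_itg (F : R -> \bar R) g a' b' : mu.-integrable setT F ->
  (forall s, a' <= s <= b' -> g s = fine (F s)) ->
  itg a' b' g /\ (rint a' b' g)%:E = (\int[mu]_(s in `[a', b']) F s)%E.
Proof.
move=> iF gF.
have iF' : mu.-integrable `[a', b'] F by exact: integrableS iF.
have mg : measurable_fun `[a', b'] g.
  have : measurable_fun `[a', b'] (fine \o F).
    by apply: measurableT_comp => //; exact: measurable_int iF'.
  by apply: eq_measurable_fun => s; rewrite inE/= in_itv/= => /gF.
have ig : itg a' b' g.
  apply: le_integrable iF' => //; first exact/measurable_EFinP.
  move=> s; rewrite /= in_itv/= => /gF ->.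
  by case: (F s) => [r||] //=; rewrite normr0 leey.
split => //; rewrite /rint /Rintegral fineK; last exact: integrable_fin_num.
apply: ae_eq_integral => //; [exact/measurable_EFinP|exact: measurable_int iF'|].
have Fae : {ae mu, forall s, `[a', b']%classic s -> F s \is a fin_num}.
  by apply: integrable_ae.
apply: (aeS Fae) => s Fs /= sab.
by rewrite gF ?fineK ?Fs//; move: sab; rewrite in_itv.
Qed.

Let integrable_G : mu.-integrable setT (fubini_G mu f).
Proof.
have mf : measurable_fun setT f by exact: measurable_int fi.
apply/integrableP; split; first exact: measurable_fubini_G fi.
have fi' : (\int[mu]_y \int[mu]_x `|f (x, y)| < +oo)%E by apply/integrable21ltyP.
apply: le_lt_trans fi'.
apply: ge0_le_integral => //.
- by apply: measurableT_comp => //; exact: measurable_fubini_G fi.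
- have mf' : measurable_fun setT (abse \o f) by exact: measurableT_comp.
  by refine (@measurable_fun_fubini_tonelli_G _ _ _ _ R mu _ mf' _) => z /=.
- by move=> x _; apply: le_abse_integral => //; exact: measurableT_comp.
Qed.

Lemma fubini_rect : [/\ itg a b (fun s => rint c d (G s)), itg c d (fun x => rint a b (G^~ x)) &
  rint a b (fun s => rint c d (G s)) = rint c d (fun x => rint a b (G^~ x))].
Proof.
have g1 s : a <= s <= b -> rint c d (G s) = fine (fubini_F mu f s).
  by move=> sab; rewrite /fubini_F (fE1 sab) -integral_mkcond.
have g2 x : c <= x <= d -> rint a b (G^~ x) = fine (fubini_G mu f x).
  by move=> xcd; rewrite /fubini_G (fE2 xcd) -integral_mkcond.
have [i1 e1] := fine_itg (integrable_fubini_F fi) g1.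
have [i2 e2] := fine_itg integrable_G g2.
split; [exact: i1|exact: i2|apply: EFin_inj; rewrite e1 e2].
rewrite integral_mkcond [RHS]integral_mkcond.
rewrite (_ : fubini_F mu f \_ `[a, b] = fubini_F mu f); last first.
  apply/funext => s; rewrite patchE; case: ifPn => // sab.
  apply/esym; rewrite /fubini_F; apply: integral0_eq => x _.
  rewrite /f patchE memNset// => /in_rect[/= sab' _].
  by move: sab; rewrite notin_setE /= in_itv.
rewrite (_ : fubini_G mu f \_ `[c, d] = fubini_G mu f); last first.
  apply/funext => x; rewrite patchE; case: ifPn => // xcd.
  apply/esym; rewrite /fubini_G; apply: integral0_eq => s _.
  rewrite /f patchE memNset// => /in_rect[/= _ xcd'].
  by move: xcd; rewrite notin_setE /= in_itv.
exact: (Fubini fi).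
Qed.

Lemma rint2E : rint2 a b c d G = rint a b (fun s => rint c d (G s)).
Proof.
have g1 s : a <= s <= b -> rint c d (G s) = fine (fubini_F mu f s).
  by move=> sab; rewrite /fubini_F (fE1 sab) -integral_mkcond.
have [i1 e1] := fine_itg (integrable_fubini_F fi) g1.
apply: EFin_inj; rewrite e1 /rint2 /Rintegral fineK; last first.
  by apply: integrable_fin_num => //; exact: measurable_rect.
rewrite integral_mkcond -/f -(integral12_prod_meas1 fi) [RHS]integral_mkcond.
apply: eq_integral => s _; rewrite patchE; case: ifPn => // sab.
rewrite /fubini_F; apply: integral0_eq => x _.
rewrite /f patchE memNset// => /in_rect[/= sab' _].
by move: sab; rewrite notin_setE /= in_itv.
Qed.

End FubiniRect.

Lemma rint2B a b c d G H : itg2 a b c d G -> itg2 a b c d H ->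
  rint2 a b c d (fun s x => G s x - H s x) = rint2 a b c d G - rint2 a b c d H.
Proof. by move=> iG iH; refine (RintegralB _ iG iH); exact: measurable_rect. Qed.

Lemma rint2Z a b c d k G : itg2 a b c d G ->
  rint2 a b c d (fun s x => k * G s x) = k * rint2 a b c d G.
Proof. by move=> iG; refine (RintegralZl _ _ iG); exact: measurable_rect. Qed.

Lemma normr_rint2 a b c d G : itg2 a b c d G ->
  `|rint2 a b c d G| <= rint2 a b c d (fun s x => `|G s x|).
Proof. by move=> iG; refine (le_normr_Rintegral _ iG); exact: measurable_rect. Qed.

Lemma le_rint2 a b c d G H : itg2 a b c d G -> itg2 a b c d H ->
  (forall s x, a <= s <= b -> c <= x <= d -> G s x <= H s x) ->
  rint2 a b c d G <= rint2 a b c d H.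
Proof.
move=> iG iH GH; refine (le_Rintegral _ iG iH _); first exact: measurable_rect.
by move=> z /in_rect[? ?]; exact: GH.
Qed.

End Rectangles.

(** * Lower integrals *)

Section LowerIntegral.
Context {R : realType}.
Local Notation mu := (@lebesgue_measure R).
Implicit Types (a b : R).
Local Open Scope ereal_scope.

(** The integral of a nonnegative function is a supremum over simple functions,
    so it is monotone even where the larger function is not known to be
    measurable. *)
Lemma le_lower_integral (D : set R) (f g : R -> \bar R) :
  (forall x, D x -> 0 <= f x) -> (forall x, D x -> f x <= g x) ->
  \int[mu]_(x in D) f x <= \int[mu]_(x in D) g x.
Proof.
move=> f0 fg; rewrite integral_mkcond [leRHS]integral_mkcond.
have h0 x : 0 <= (f \_ D) x.
  by rewrite patchE; case: ifPn => //; rewrite inE => /f0.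
have hg x : (f \_ D) x <= (g \_ D) x.
  by rewrite !patchE; case: ifPn => //; rewrite inE => /fg.
rewrite !ge0_integralTE//; last by move=> x; exact: le_trans (h0 x) (hg x).
apply: le_ereal_sup => _ [h /= hf <-].
by exists h => //= x; exact: le_trans (hf x) (hg x).
Qed.

Lemma ae_le_lower_integral a b (f g : R -> \bar R) : measurable_fun `[a, b] f ->
  (forall x, (a <= x <= b)%R -> 0 <= f x) -> (forall x, (a <= x <= b)%R -> 0 <= g x) ->
  {ae mu, forall x, (a <= x <= b)%R -> f x <= g x} ->
  \int[mu]_(x in `[a, b]) f x <= \int[mu]_(x in `[a, b]) g x.
Proof.
move=> mf f0 g0 [N [mN N0 NP]].
rewrite (ge0_negligible_integral _ _ _ _ N0)//.
rewrite integral_mkcond [leRHS]integral_mkcond; apply: le_lower_integral => x _.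
  by rewrite patchE; case: ifPn => //; rewrite inE => -[]; rewrite /= in_itv/= => /f0.
rewrite !patchE; case: ifPn => [|_].
  rewrite inE /= => -[xab xN]; rewrite ifT; last by rewrite inE.
  move: xab; rewrite in_itv/= => xab.
  by apply: contrapT => fgx; apply: xN; apply: NP => /= /(_ xab).
by case: ifPn => //; rewrite inE /= in_itv/= => /g0.
Qed.

Lemma dominated_lower_integral a b (f : R -> R) (g : R -> \bar R) :
  measurable_fun `[a, b] f ->
  (forall x, (a <= x <= b)%R -> (0 <= f x)%R) -> (forall x, (a <= x <= b)%R -> 0 <= g x) ->
  {ae mu, forall x, (a <= x <= b)%R -> (f x)%:E <= g x} ->
  \int[mu]_(x in `[a, b]) g x < +oo ->
  itg a b f /\ (rint a b f)%:E <= \int[mu]_(x in `[a, b]) g x.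
Proof.
move=> mf f0 g0 fg goo.
have fle : \int[mu]_(x in `[a, b]) (f x)%:E <= \int[mu]_(x in `[a, b]) g x.
  by apply: ae_le_lower_integral => //; exact/measurable_EFinP.
have fi : itg a b f.
  apply/integrableP; split; first exact/measurable_EFinP.
  rewrite (le_lt_trans _ goo)// (le_trans _ fle)//.
  rewrite le_eqVlt; apply/orP; left; apply/eqP.
  apply: eq_integral => x; rewrite inE /= in_itv/= => xab.
  by rewrite ger0_norm// f0.
by split => //; rewrite /rint /Rintegral fineK//; exact: integrable_fin_num.
Qed.

End LowerIntegral.

(** * Regularity in time of the approximation *)

Section Approximation.
Context {R : realType}.
Local Notation mu := (@lebesgue_measure R).
Local Notation L := (@pi R *+ 2 : R).
Local Notation L0 := (@twopi_ge0 R).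
Implicit Types (a b c e s t x y : R) (f g h u v w chi : R -> R).

Lemma rint_sqr_le a b f (M : R) : a <= b -> itg a b (fun x => f x ^+ 2) ->
  (forall x, a <= x <= b -> f x ^+ 2 <= M) ->
  rint a b (fun x => f x ^+ 2) <= M * (b - a).
Proof.
by move=> ab fi fM; rewrite -rint_cst//; apply: le_rint => //; exact: itg_cst.
Qed.

Lemma poincare_crude F f : ac 0 L F f -> sqi 0 L f -> F L = F 0 -> rint 0 L F = 0 ->
  rint 0 L (fun x => F x ^+ 2) <= 16 * rint 0 L (fun x => f x ^+ 2).
Proof.
move=> aF sf FL F0; have cF := ac_cts L0 aF.
have := rint_sqr_le L0 (cts_itg (@ctsX R 0 L F 2 cF)) (fun x => zero_mean_sup aF sf FL F0 (x := x)).
have := rint_sqr_ge0 0 L f; set I := rint 0 L _ => I0.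
have : 2 * I * L <= 2 * I * 8 by rewrite ler_wpM2l ?mulr_ge0// twopi_le8.
by rewrite subr0; lra.
Qed.

Lemma ac_zero_mean F f : ac 0 L F f -> F L = F 0 -> rint 0 L f = 0.
Proof. by move=> aF FL; rewrite (ac_rint L0 aF) FL subrr. Qed.

Section Rep.
Variables (u F0 F1 F2 F3 : R -> R).
Hypotheses (Hu : Hper 4 u) (Fu : smooth_rep u F0 F1 F2 F3).

Lemma rep_cts : [/\ cts 0 L F0, cts 0 L F1, cts 0 L F2 & cts 0 L F3].
Proof. by case: Fu => [[a0 a1 a2 a3] _ _ _]; split; apply: (ac_cts L0); eassumption. Qed.

Lemma rep_zero_mean :
  [/\ rint 0 L F0 = 0, rint 0 L F1 = 0, rint 0 L F2 = 0 & rint 0 L F3 = 0].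
Proof.
have [c0 _ _ _] := rep_cts.
case: Fu => [[a0 a1 a2 a3] [p0 p1 p2 p3] e0 _]; split; last 3 first.
- exact: ac_zero_mean a0 p0.
- exact: ac_zero_mean a1 p1.
- exact: ac_zero_mean a2 p2.
case: Hu => u2 u0 _; rewrite -[RHS]u0 -/(rint 0 L u); apply/esym/ae_eq_rint => //.
- exact: sqi_measurable (L2per_sqi u2).
- exact: cts_measurable.
Qed.

Lemma rep_poincare : let N := rint 0 L (fun x => wderiv 4 u x ^+ 2) in
  rint 0 L (fun x => u x ^+ 2) <= 256 * (256 * N) /\
  rint 0 L (fun x => wderiv 3 u x ^+ 2) <= 16 * N.
Proof.
move=> N; have [c0 c1 c2 c3] := rep_cts; have [m0 m1 m2 m3] := rep_zero_mean.
have s4 : sqi 0 L (wderiv 4 u) by apply/L2per_sqi; exact: (wderivP Hu _).1.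
have s3 : sqi 0 L (wderiv 3 u) by apply/L2per_sqi; exact: (wderivP Hu _).1.
have su : sqi 0 L u by case: Hu => /L2per_sqi.
case: Fu => [[a0 a1 a2 a3] [p0 p1 p2 p3] e0 [e1 e2 e3]].
have eqn f g : sqi 0 L f -> cts 0 L g -> {ae mu, forall x, 0 <= x <= L -> f x = g x} ->
    rint 0 L (fun x => f x ^+ 2) = rint 0 L (fun x => g x ^+ 2).
  move=> sf cg fg; apply: ae_eq_rint.
  - exact: itg_measurable sf.2.
  - exact: cts_measurable (@ctsX R 0 L g 2 cg).
  - by apply: (aeS fg) => x fgx /fgx ->.
rewrite (eqn _ _ su c0 e0) (eqn _ _ s3 c3 e3).
have := poincare_crude a0 (cts_sqi c1) p0 m0; have := poincare_crude a1 (cts_sqi c2) p1 m1.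
have := poincare_crude a2 (cts_sqi c3) p2 m2; have := poincare_crude a3 s4 p3 m3.
rewrite -/N; lra.
Qed.

End Rep.

(** Uniform approximation by trigonometric polynomials gives approximation in
    the quadratic sense. *)
Lemma trig_dense_sqr f e : cts 0 L f -> f L = f 0 -> 0 < e ->
  exists chi, [/\ trig chi, `|rint 0 L (fun x => f x * chi x) - rint 0 L (fun x => f x ^+ 2)| <= e &
    rint 0 L (fun x => chi x ^+ 2) <= rint 0 L (fun x => f x ^+ 2) + e].
Proof.
move=> cf fL e0; have [M M0 fM] := cts_bounded cf.
pose r := Num.min 1 (e / (8 * (2 * M + 1))).
have k0 : 0 < 8 * (2 * M + 1) by rewrite mulr_gt0//; lra.
have r0 : 0 < r by rewrite lt_min ltr01 divr_gt0.
have r1 : r <= 1 by rewrite ge_min lexx.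
have re : r * (8 * (2 * M + 1)) <= e by rewrite -ler_pdivlMr// ge_min lexx orbT.
have [chi tchi chif] := trig_dense cf fL r0; exists chi.
have cc : cts 0 L chi by apply/continuous_cts/trig_continuous.
have if2 := cts_itg (@ctsX R 0 L f 2 cf); have ifc := cts_itg (ctsM cf cc).
have ic2 := cts_itg (@ctsX R 0 L chi 2 cc).
have Lle (k : R) : 0 <= k -> k * L <= k * 8 by move=> k0'; rewrite ler_wpM2l// twopi_le8.
split => //.
- rewrite -(rintB ifc if2) (le_trans (normr_rint (itgB ifc if2)))//.
  apply: (@le_trans _ _ (rint 0 L (fun=> M * r))).
    apply: le_rint; [exact/itg_norm/itgB|exact: itg_cst|].
    move=> x xL; rewrite expr2 -mulrBr normrM ler_pM//; [exact: fM|exact: chif].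
  rewrite rint_circle_cst (le_trans (Lle _ _))//; first by rewrite mulr_ge0 ?ltW.
  by rewrite (le_trans _ re)//; nra.
- rewrite -lerBlDl -(rintB ic2 if2).
  apply: (@le_trans _ _ (rint 0 L (fun=> r * (2 * M + 1)))).
    apply: le_rint; [exact/itgB|exact: itg_cst|].
    move=> x xL; rewrite subr_sqr (le_trans (ler_norm _))// normrM ler_pM//; first exact: chif.
    rewrite (_ : chi x + f x = (chi x - f x) + 2 * f x); last by ring.
    rewrite (le_trans (ler_normD _ _))// normrM ger0_norm//.
    by have := chif _ xL; have := fM _ xL; lra.
  rewrite rint_circle_cst (le_trans (Lle _ _))//; first by rewrite mulr_ge0 ?ltW//; lra.
  by rewrite (le_trans _ re)//; lra.
Qed.

End Approximation.

Section ApproximationRegularity.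
Context {R : realType}.
Local Notation mu := (@lebesgue_measure R).
Local Notation L := (@pi R *+ 2 : R).
Local Notation L0 := (@twopi_ge0 R).
Variables (T : R) (phi phit : R -> R -> R).
Hypotheses (T0 : 0 < T) (Hphi : approximation_on T phi phit).
Implicit Types (a b c e s t x y N : R) (f g h u v w chi psi : R -> R).

Lemma phi_Hper4 t : 0 <= t <= T -> Hper 4 (phi t).
Proof. by move=> tT; have [+ _ _] := Hphi; apply; rewrite in_itv. Qed.

Lemma phit_Hper4 : {ae mu, forall s, 0 <= s <= T -> Hper 4 (phit s)}.
Proof.
by have [_ [_ H _] _] := Hphi; apply: (aeS H) => s + sT; apply; rewrite in_itv.
Qed.

Lemma phit_Hnorm_lty : (\int[mu]_(s in `[0%R, T]) (Hnorm 4 (phit s) ^+ 2) < +oo)%E.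
Proof. by have [_ [_ _ H] _] := Hphi. Qed.

Lemma sqr_Hnorm_ge0 k u : (0 <= Hnorm k u ^+ 2)%E.
Proof. by rewrite expe_ge0// L2norm_ge0. Qed.

Lemma phit_measurable2 : measurable2 0 T 0 L phit.
Proof.
have [_ [mp _ _] _] := Hphi; apply: measurable_funS mp.
  by apply: measurableX.
by move=> z /in_rect[? _]; rewrite /= in_itv.
Qed.

Definition phit_energy : R := fine (\int[mu]_(s in `[0%R, T]) (Hnorm 4 (phit s) ^+ 2))%E.

Lemma phit_energy_ge0 : 0 <= phit_energy.
Proof. by apply: fine_ge0; apply: integral_ge0 => s _; exact: sqr_Hnorm_ge0. Qed.

Lemma phit_energyE :
  (\int[mu]_(s in `[0%R, T]) (Hnorm 4 (phit s) ^+ 2) = phit_energy%:E)%E.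
Proof.
rewrite fineK// ge0_fin_numE ?phit_Hnorm_lty//.
by apply: integral_ge0 => s _; exact: sqr_Hnorm_ge0.
Qed.

Lemma phit_itg2 : itg2 0 T 0 L phit.
Proof.
pose f : R * R -> \bar R := (fun z => (phit z.1 z.2 ^+ 2)%:E) \_ (rect 0 T 0 L).
have f0 z : (0 <= f z)%E by rewrite /f patchE; case: ifPn => // _; rewrite lee_fin sqr_ge0.
have mf : measurable_fun setT f.
  apply/(measurable_restrictT _ _).1; first exact: measurable_rect.
  by apply/measurable_EFinP; apply: measurable_funX; exact: phit_measurable2.
pose h s := (\int[mu]_y f (s, y))%E.
have mh : measurable_fun setT h by refine (@measurable_fun_fubini_tonelli_F _ _ _ _ R mu _ mf f0).
have h0 s : (0 <= h s)%E by apply: integral_ge0.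
pose k : R := (256 * 256)^-1.
have c0 : 0 < 256 * 256 :> R by rewrite mulr_gt0 ?ltr0n.
have k0 : 0 < k by rewrite invr_gt0.
have hoo : (\int[mu]_(s in `[0%R, T]) (k%:E * h s) < +oo)%E.
  apply: le_lt_trans phit_Hnorm_lty; apply: ae_le_lower_integral.
  - by apply: measurable_funTS; exact: measurable_funeM.
  - by move=> s _; rewrite mule_ge0// lee_fin ltW.
  - by move=> s _; exact: sqr_Hnorm_ge0.
  apply: (aeS phit_Hper4) => s + sT => /(_ sT) Hs.
  have [F0 [F1 [F2 [F3 Fs]]]] := Hper4_rep Hs.
  have [p0 _] := rep_poincare Hs Fs.
  have ps : sqi 0 L (phit s) by case: Hs => /L2per_sqi.
  rewrite sqr_Hnorm; last exact: (wderivP Hs _).1.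
  have -> : h s = (rint 0 L (fun x => phit s x ^+ 2))%:E.
    rewrite -(sqr_L2normE ps) sqr_L2norm [RHS]integral_mkcond; apply: eq_integral => y _.
    rewrite /f !patchE; congr (if _ then _ else _); apply/idP/idP; rewrite !inE.
      by move=> [].
    by move=> yL; split => //=; rewrite in_itv.
  by rewrite -EFinM lee_fin /k (ler_pdivrMl _ _ c0) -mulrA.
have fi : (mu \x mu)%E.-integrable setT f.
  apply/integrable12ltyP => //.
  have -> : (\int[mu]_x \int[mu]_y `|f (x, y)| = \int[mu]_(s in `[0%R, T]) h s)%E.
    rewrite [RHS]integral_mkcond; apply: eq_integral => s _; rewrite patchE.
    case: ifPn => sT; first by apply: eq_integral => y _; rewrite gee0_abs.
    apply: integral0_eq => y _; rewrite /f patchE memNset ?abse0// => -[sT' _].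
    by move: sT; rewrite notin_setE.
  move: hoo; rewrite ge0_integralZl//.
  - by apply: contraTT; rewrite -!leNgt !leye_eq => /eqP ->; rewrite gt0_muley// lte_fin.
  - exact: measurable_funTS.
  - by rewrite lee_fin ltW.
have i2 : itg2 0 T 0 L (fun s x => phit s x ^+ 2).
  by apply/(integrable_mkcond _ _).2 => //; exact: measurable_rect.
apply: (le_itg2 phit_measurable2 _ (itg2D (itg2_cst 0 T 0 L 1) i2)) => s x _ _.
rewrite [leRHS]ger0_norm ?addr_ge0 ?sqr_ge0// -[phit s x ^+ 2]real_normK ?num_real//.
by have := sqr_ge0 (`|phit s x| - 1); rewrite sqrrB1; have := normr_ge0 (phit s x); lra.
Qed.

Lemma phit_itg2M psi : cts 0 L psi -> itg2 0 T 0 L (fun s x => phit s x * psi x).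
Proof.
move=> cpsi; have [M _ MP] := cts_bounded cpsi.
apply: (@itg2M_bounded _ _ _ _ _ _ (fun _ => psi) M phit_itg2).
  by apply: measurable2_snd; exact: cts_measurable.
by move=> s x _ xL; exact: MP.
Qed.

Lemma phi_increment s t : 0 <= s -> s <= t -> t <= T ->
  {ae mu, forall x, 0 <= x <= L -> phi t x - phi s x = rint s t (phit^~ x)}.
Proof.
move=> s0 st tT; have [_ _ H] := Hphi.
have Hs : s \in `[0, T] by rewrite in_itv/=; lra.
have Ht : t \in `[0, T] by rewrite in_itv/=; lra.
apply: (aeS2 (H _ Hs) (aeS2 (H _ Ht) (itg2_section phit_itg2) (fun x p q => conj p q))).
move=> x -> [-> ix] xL; rewrite -!/(rint 0 _ (phit^~ x)).
rewrite (rint_cat s0 st); last by apply: itgS (ix xL).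
by ring.
Qed.

Lemma phi_pairing psi s t : 0 <= s -> s <= t -> t <= T -> cts 0 L psi ->
  rint 0 L (fun x => (phi t x - phi s x) * psi x) =
  rint s t (fun r => rint 0 L (fun x => phit r x * psi x)).
Proof.
move=> s0 st tT cpsi; have i2 : itg2 s t 0 L (fun r x => phit r x * psi x).
  by apply: itg2S (phit_itg2M cpsi).
have [_ ix ->] := fubini_rect i2.
have iphi r : 0 <= r <= T -> itg 0 L (phi r).
  by move=> /phi_Hper4[/L2per_sqi/sqi_itg].
have it : itg 0 L (phi t) by apply: iphi; lra.
have is_ : itg 0 L (phi s) by apply: iphi; lra.
apply: ae_eq_rint.
- by apply: itg_measurable; apply: itgM_cts => //; exact: itgB.
- exact: itg_measurable ix.
have i1 : itg2 s t 0 L phit by apply: itg2S phit_itg2.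
apply: (aeS2 (phi_increment s0 st tT) (itg2_section i1)) => x + + xL.
move=> /(_ xL) -> /(_ xL) ixx.
by rewrite [LHS]mulrC -rintZ//; apply: eq_rint => r _; rewrite mulrC.
Qed.

(** By duality it suffices to bound the pairing of the third derivative of an
    increment of [phi] with [chi], which is the time integral of the pairing of
    [phit] with the third derivative of [chi]. *)
Lemma phi_pairing3 chi s t e N : 0 <= s -> s <= t -> t <= T -> trig chi -> 0 < e ->
  0 < N -> rint 0 L (fun x => chi x ^+ 2) <= N ->
  `|rint 0 L (fun x => (phi t x - phi s x) * derive1n 3 chi x)| <=
  (t - s) / (4 * e) + e * (16 * phit_energy * N).
Proof.
move=> s0 st tT tchi e0 N0 chiN; have tt := trig_test tchi.
have c3 : cts 0 L (derive1n 3 chi) by exact: test_cts.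
have cchi : cts 0 L chi by apply/continuous_cts/trig_continuous.
rewrite phi_pairing//.
pose q r := rint 0 L (fun x => phit r x * derive1n 3 chi x).
have [+ _ _] := fubini_rect (phit_itg2M c3); rewrite -/q => iq.
have mq : measurable_fun `[0, T] (fun r => q r ^+ 2).
  by apply: measurable_funX; exact: itg_measurable.
have qle : {ae mu, forall r, 0 <= r <= T ->
    (((16 * N)^-1 * q r ^+ 2)%:E <= Hnorm 4 (phit r) ^+ 2)%E}.
  apply: (aeS phit_Hper4) => r + rT => /(_ rT) Hr.
  have [F0 [F1 [F2 [F3 Fr]]]] := Hper4_rep Hr.
  have [_ p3] := rep_poincare Hr Fr.
  have s3 : sqi 0 L (wderiv 3 (phit r)) by apply/L2per_sqi; exact: (wderivP Hr _).1.
  rewrite sqr_Hnorm; last exact: (wderivP Hr _).1.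
  rewrite lee_fin ler_pdivrMl ?mulr_gt0//.
  have := (wderivP Hr (isT : (3 <= 4)%N)).2 _ tt.
  rewrite -!/(rint 0 L _) /q => ->; rewrite exprMn sqrr_sign mul1r.
  have := rint_CS s3 (cts_sqi cchi).
  set W := rint 0 L (fun x => wderiv 4 _ x ^+ 2) in p3 *.
  set V := rint 0 L (fun x => wderiv 3 _ x ^+ 2) in p3 *.
  have W0 : 0 <= W by exact: rint_sqr_ge0.
  move=> CS; rewrite (le_trans CS)//.
  rewrite (_ : 16 * N * W = (16 * W) * N); last by ring.
  by apply: ler_pM => //; exact: rint_sqr_ge0.
have [|||ik bk] := dominated_lower_integral _ _ _ qle phit_Hnorm_lty.
- by apply: measurable_funM.
- by move=> r _; rewrite mulr_ge0 ?sqr_ge0// invr_ge0 mulr_ge0// ltW.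
- by move=> r _; exact: sqr_Hnorm_ge0.
have iq2 : itg 0 T (fun r => q r ^+ 2).
  have := itgZ (16 * N) ik; apply: eq_itg => r _.
  by rewrite mulrA divff ?mul1r// gt_eqF// mulr_gt0.
have bq : rint 0 T (fun r => q r ^+ 2) <= 16 * phit_energy * N.
  move: bk; rewrite phit_energyE lee_fin rintZ// ler_pdivrMl ?mulr_gt0//.
  by rewrite mulrAC.
have iqs : itg s t q by apply: itgS iq.
have iq2s : itg s t (fun r => q r ^+ 2) by apply: itgS iq2.
rewrite (le_trans (normr_rint iqs))//.
apply: (@le_trans _ _ (rint s t (fun r => (4 * e)^-1 + e * q r ^+ 2))).
  apply: le_rint; [exact: itg_norm|by apply: itgD; [exact: itg_cst|exact: itgZ]|].
  move=> r _; rewrite -[q r ^+ 2]real_normK ?num_real//.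
  have := sqr_ge0 (2 * e * `|q r| - 1); set z := `|q r| => H.
  rewrite -(ler_pM2l (_ : 0 < 4 * e)) ?mulr_gt0// mulrDr divff ?gt_eqF ?mulr_gt0//.
  move: H; rewrite (_ : (2 * e * z - 1) ^+ 2 = 1 + 4 * e * (e * z ^+ 2) - 4 * e * z); last by ring.
  by rewrite subr_ge0.
rewrite (rintD (itg_cst s t (4 * e)^-1) (itgZ e iq2s)) rint_cst// (rintZ _ iq2s).
rewrite mulrC lerD2l ler_pM2l// (le_trans _ bq)//.
rewrite (rint_cat s0 (le_trans st tT) iq2) (rint_cat st tT); last by apply: itgS iq2.
have := rint_sqr_ge0 0 s q; have := rint_sqr_ge0 t T q; lra.
Qed.

Lemma phi_reps : exists F0 F1 F2 F3 : R -> R -> R, forall t, 0 <= t <= T ->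
  smooth_rep (phi t) (F0 t) (F1 t) (F2 t) (F3 t).
Proof.
have /choice[F FP] : forall t, exists F : (R -> R) * (R -> R) * (R -> R) * (R -> R),
    0 <= t <= T -> smooth_rep (phi t) F.1.1.1 F.1.1.2 F.1.2 F.2.
  move=> t; have [tT|tT] := boolP (0 <= t <= T); last by exists (id, id, id, id).
  have [F0 [F1 [F2 [F3 Ft]]]] := Hper4_rep (phi_Hper4 tT).
  by exists (F0, F1, F2, F3).
exists (fun t => (F t).1.1.1), (fun t => (F t).1.1.2), (fun t => (F t).1.2), (fun t => (F t).2).
exact: FP.
Qed.

Section Reps.
Variables (F0 F1 F2 F3 : R -> R -> R).
Hypothesis FP : forall t, 0 <= t <= T ->
  smooth_rep (phi t) (F0 t) (F1 t) (F2 t) (F3 t).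

(** The bound on the pairings is tested on approximations of the increment of
    the third derivative, with [e] such that the last term is absorbed. *)
Lemma phi_rep3_sqr s t : 0 <= s -> s <= t -> t <= T ->
  rint 0 L (fun x => (F3 t x - F3 s x) ^+ 2) <= 16 * (phit_energy + 1) * (t - s).
Proof.
move=> s0 st tT.
have sT : 0 <= s <= T by lra.
have tT' : 0 <= t <= T by lra.
have Fs := FP sT; have Ft := FP tT'.
have [_ _ _ cs] := rep_cts Fs; have [_ _ _ ct] := rep_cts Ft.
pose f x := F3 t x - F3 s x.
have cf : cts 0 L f by exact: ctsB.
have fL : f L = f 0.
  by rewrite /f; case: Fs => [_ [_ _ _ ->] _ _]; case: Ft => [_ [_ _ _ ->] _ _].
have w r : 0 <= r <= T -> is_wderiv 3 (phi r) (F3 r).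
  move=> rT; have Hr := phi_Hper4 rT; have Fr := FP rT.
  have [_ _ _ cr] := rep_cts Fr.
  apply: (ae_eq_wderivr _ (cts_itg cr) _ (wderivP Hr (isT : (3 <= 4)%N)).2).
    by apply/sqi_itg/L2per_sqi; exact: (wderivP Hr _).1.
  by case: Fr => _ _ _ [].
have iphi r : 0 <= r <= T -> itg 0 L (phi r) by move=> /phi_Hper4[/L2per_sqi/sqi_itg].
have wf := is_wderivB (iphi _ tT') (iphi _ sT) (cts_itg ct) (cts_itg cs) (w _ tT') (w _ sT).
set N := rint 0 L (fun x => (F3 t x - F3 s x) ^+ 2).
have N0 : 0 <= N by apply: rint_ge0 => x _; exact: sqr_ge0.
set B := phit_energy; have B0 : 0 <= B by exact: phit_energy_ge0.
apply/ler_addgt0Pr => e e0; have e30 : 0 < e / 3 by rewrite divr_gt0.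
have [chi [tchi h1 h2]] := trig_dense_sqr cf fL e30.
have k0 : 0 < (32 * (B + 1))^-1 :> R by rewrite invr_gt0; lra.
have Ne : 0 < N + e / 3 by lra.
have := phi_pairing3 s0 st tT tchi k0 Ne h2.
have -> : rint 0 L (fun x => (phi t x - phi s x) * derive1n 3 chi x) =
    - rint 0 L (fun x => f x * chi x).
  by have := wf _ (trig_test tchi); rewrite -!/(rint 0 L _) => ->; rewrite -signr_odd expr1 mulN1r.
rewrite normrN -/B => h3.
have h4 := ler_norm (rint 0 L (fun x => f x * chi x)).
have E1 : (t - s) / (4 / (32 * (B + 1))) = 8 * (B + 1) * (t - s).
  by field; lra.
have E2 : (32 * (B + 1))^-1 * (16 * B * (N + e / 3)) <= (N + e / 3) / 2.
  rewrite ler_pdivrMl; last lra.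
  by rewrite -subr_ge0 (_ : _ - _ = 16 * (N + e / 3)); [rewrite mulr_ge0// ltW|field].
rewrite E1 in h3; move: h1; rewrite ler_norml -/N => /andP[h1 _].
lra.
Qed.

(** By [zero_mean_sup] the Hoelder bound on the third derivatives carries over to
    the maximum norms of the lower ones. *)
Lemma phi_rep2_sup s t x : 0 <= s -> s <= t -> t <= T -> 0 <= x <= L ->
  (F2 t x - F2 s x) ^+ 2 <= 32 * (phit_energy + 1) * (t - s).
Proof.
move=> s0 st tT xL.
have sT : 0 <= s <= T by lra.
have tT' : 0 <= t <= T by lra.
have Fs := FP sT; have Ft := FP tT'.
have [_ c1s c2s c3s] := rep_cts Fs; have [_ c1t c2t c3t] := rep_cts Ft.
have [_ _ ms _] := rep_zero_mean (phi_Hper4 sT) Fs.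
have [_ _ mt _] := rep_zero_mean (phi_Hper4 tT') Ft.
have H := phi_rep3_sqr s0 st tT.
case: Fs Ft => [[_ _ as_ _] [_ _ ps _] _ _] [[_ _ at_ _] [_ _ pt _] _ _].
have := zero_mean_sup (acB at_ as_) (cts_sqi (ctsB c3t c3s)) _ _ xL.
rewrite ps pt (rintB (cts_itg c2t) (cts_itg c2s)) ms mt subrr => /(_ erefl erefl).
lra.
Qed.

Lemma phi_rep1_sup s t x : 0 <= s -> s <= t -> t <= T -> 0 <= x <= L ->
  (F1 t x - F1 s x) ^+ 2 <= 512 * (phit_energy + 1) * (t - s).
Proof.
move=> s0 st tT xL.
have sT : 0 <= s <= T by lra.
have tT' : 0 <= t <= T by lra.
have Fs := FP sT; have Ft := FP tT'.
have [_ c1s c2s c3s] := rep_cts Fs; have [_ c1t c2t c3t] := rep_cts Ft.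
have [_ ms _ _] := rep_zero_mean (phi_Hper4 sT) Fs.
have [_ mt _ _] := rep_zero_mean (phi_Hper4 tT') Ft.
have H y := @phi_rep2_sup s t y s0 st tT.
case: Fs Ft => [[_ as_ _ _] [_ ps _ _] _ _] [[_ at_ _ _] [_ pt _ _] _ _].
have := zero_mean_sup (acB at_ as_) (cts_sqi (ctsB c2t c2s)) _ _ xL.
rewrite ps pt (rintB (cts_itg c1t) (cts_itg c1s)) ms mt subrr => /(_ erefl erefl).
have := rint_sqr_le L0 (cts_itg (@ctsX R 0 L _ 2 (ctsB c2t c2s))) H.
have B0 := phit_energy_ge0.
set M := 32 * _ * _; have M0 : 0 <= M by rewrite !mulr_ge0//; lra.
have : M * L <= M * 8 by rewrite ler_wpM2l// twopi_le8.
rewrite subr0 (_ : 512 * _ * _ = 16 * M); last by rewrite /M; ring.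
lra.
Qed.

End Reps.

End ApproximationRegularity.

(** * The weight [A] and the dual norm *)

Section Linfty.
Context {R : realType}.
Local Notation mu := (@lebesgue_measure R).
Local Notation L := (@pi R *+ 2 : R).
Implicit Types (a b c e s t x y M : R) (f g h u v w : R -> R).

Lemma LinftynormE u : Linftynorm u = ess_sup mu (abse \o (EFin \o (u \_ circle))).
Proof.
rewrite /Linftynorm unlock /= ifT//.
by rewrite -set_itvNyy lebesgue_measure_itv /= addye.
Qed.

Lemma Linftynorm_le u M : 0 <= M -> {ae mu, forall x, 0 <= x <= L -> `|u x| <= M} ->
  (Linftynorm u <= M%:E)%E.
Proof.
move=> M0 uM; rewrite LinftynormE; apply/ess_supP; apply: (aeS uM) => x ux /=.
rewrite lee_fin patchE in_circle; case: ifPn => [/ux//|_]; by rewrite normr0.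
Qed.

Lemma Linftynorm_ge0 u : (0 <= Linftynorm u)%E. Proof. exact: Lnorm_ge0. Qed.

Lemma Linftynorm_ge u : {ae mu, forall x, 0 <= x <= L -> (`|u x|%:E <= Linftynorm u)%E}.
Proof.
have := ess_sup_ge mu (abse \o (EFin \o (u \_ circle))); rewrite -LinftynormE => H.
by apply: (aeS H) => x /= + xL; rewrite patchE in_circle xL.
Qed.

Lemma cts_ae_le f M : cts 0 L f -> {ae mu, forall x, 0 <= x <= L -> f x <= M} ->
  forall x, 0 <= x <= L -> f x <= M.
Proof.
move=> cf fM x xL; pose g (y : R) : R := (f y - M) + `|f y - M|.
have cfM : cts 0 L (fun y => f y - M) by apply: ctsB => //; exact: cts_cst.
have cg : cts 0 L g by apply: ctsD => //; exact: cts_norm.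
have g0 y : 0 <= g y by rewrite /g; have := ler_norm (- (f y - M)); rewrite normrN; lra.
suff : g x = 0 by rewrite /g; have := normr_ge0 (f x - M); lra.
apply: (cts_rint_eq0 cg (@twopi_gt0 R)) => //.
rewrite -[RHS](mul0r L) -rint_circle_cst; apply: ae_eq_rint.
- exact: cts_measurable.
- exact: measurable_cst.
apply: (aeS fM) => y fy /fy; rewrite /g => h.
by rewrite ler0_norm ?subr_le0// subrr.
Qed.

End Linfty.

Section Weight.
Context {R : realType}.
Local Notation L := (@pi R *+ 2 : R).
Variables (T : R) (phi phit : R -> R -> R).
Hypotheses (T0 : 0 < T) (Hphi : approximation_on T phi phit).
Variables (F0 F1 F2 F3 : R -> R -> R).
Hypothesis FP : forall t, 0 <= t <= T ->
  smooth_rep (phi t) (F0 t) (F1 t) (F2 t) (F3 t).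
Implicit Types (a b c e s t x y M : R).

Definition phi_sup s : R := fine (Linftynorm (wderiv 2 (phi s))).

Lemma rep_Linftynorm_le s M : 0 <= s <= T -> 0 <= M ->
  (forall x, 0 <= x <= L -> `|F2 s x| <= M) -> (Linftynorm (wderiv 2 (phi s)) <= M%:E)%E.
Proof.
move=> sT M0 FM; apply: Linftynorm_le => //.
by have [_ _ _ [_ e2 _]] := FP sT; apply: (aeS e2) => x + xL => /(_ xL) ->; exact: FM.
Qed.

Lemma phi_supE s : 0 <= s <= T -> Linftynorm (wderiv 2 (phi s)) = (phi_sup s)%:E.
Proof.
move=> sT; have [_ _ c2 _] := rep_cts (FP sT).
have [M M0 MP] := cts_bounded c2.
rewrite fineK// ge0_fin_numE ?Linftynorm_ge0//.
by apply: le_lt_trans (rep_Linftynorm_le sT (ltW M0) MP) _; rewrite ltry.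
Qed.

Lemma phi_sup_ge0 s : 0 <= phi_sup s.
Proof. exact/fine_ge0/Linftynorm_ge0. Qed.

Lemma phi_sup_ge s x : 0 <= s <= T -> 0 <= x <= L -> `|F2 s x| <= phi_sup s.
Proof.
move=> sT; have [_ _ c2 _] := rep_cts (FP sT).
move: x; apply: cts_ae_le; first exact: cts_norm.
have [_ _ _ [_ e2 _]] := FP sT.
apply: (aeS2 (Linftynorm_ge (wderiv 2 (phi s))) e2) => x + + xL.
by move=> /(_ xL) + /(_ xL) e; rewrite phi_supE// lee_fin e.
Qed.

Lemma phi_rep2_sup_sym s t x : 0 <= s <= T -> 0 <= t <= T -> 0 <= x <= L ->
  (F2 t x - F2 s x) ^+ 2 <= 32 * (phit_energy T phit + 1) * `|t - s|.
Proof.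
move=> /andP[s0 sT] /andP[t0 tT] xL; have [st|/ltW ts] := leP s t.
  by rewrite ger0_norm ?subr_ge0//; exact: (phi_rep2_sup Hphi FP).
by rewrite distrC ger0_norm ?subr_ge0// -sqrrN opprB; exact: (phi_rep2_sup Hphi FP).
Qed.

(** The square of a distance is at most [K h], hence the distance is
    continuous in [h]. *)
Lemma sqr_modulus (K e : R) : 0 <= K -> 0 < e -> exists2 d, 0 < d &
  forall h z : R, 0 <= h -> h < d -> z ^+ 2 <= K * h -> `|z| < e.
Proof.
move=> K0 e0; exists (e ^+ 2 / (K + 1)); first by rewrite divr_gt0 ?exprn_gt0//; lra.
move=> h z h0; rewrite ltr_pdivlMr; last lra.
move=> hd zK; rewrite ltNge; apply/negP => ez.
have : e ^+ 2 <= z ^+ 2.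
  by rewrite -[z ^+ 2]real_normK ?num_real// lerXn2r// ?nnegrE ?ltW.
by rewrite leNgt (le_lt_trans zK)// (le_lt_trans _ hd)// mulrC ler_wpM2l//; lra.
Qed.

Lemma phi_sup_cts : cts 0 T phi_sup.
Proof.
apply/ctsP => s sT e e0; have e20 : 0 < e / 2 by rewrite divr_gt0.
have B0 := phit_energy_ge0 T phit.
have K0 : 0 <= 32 * (phit_energy T phit + 1) by rewrite mulr_ge0//; lra.
have [d d0 dP] := sqr_modulus K0 e20; exists d => // t tT ts.
have close x : 0 <= x <= L -> `|F2 t x - F2 s x| < e / 2.
  by move=> xL; apply: (dP `|t - s|) => //; exact: phi_rep2_sup_sym.
have le_sup r r' : 0 <= r <= T -> 0 <= r' <= T ->
    (forall x, 0 <= x <= L -> `|F2 r x - F2 r' x| < e / 2) -> phi_sup r <= phi_sup r' + e / 2.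
  move=> rT rT' h; rewrite -lee_fin -phi_supE//; apply: rep_Linftynorm_le => //.
    by rewrite addr_ge0 ?phi_sup_ge0// ltW.
  move=> x xL; have := h _ xL; have := phi_sup_ge rT' xL.
  have := ler_normD (F2 r x - F2 r' x) (F2 r' x); rewrite subrK; lra.
have h1 := le_sup _ _ tT sT close.
have h2 : phi_sup s <= phi_sup t + e / 2.
  by apply: le_sup => // x xL; rewrite distrC; exact: close.
by rewrite ltr_norml; lra.
Qed.

Definition weight_rate s : R := 18 * phi_sup s ^+ 2 - 1 / 4.

Lemma weight_rate_cts : cts 0 T weight_rate.
Proof.
apply: ctsB; last exact: cts_cst.
by apply: ctsM; [exact: cts_cst|apply: ctsX; exact: phi_sup_cts].
Qed.

Lemma weightE t : 0 <= t <= T -> A phi t = rint 0 t weight_rate.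
Proof.
move=> /andP[t0 tT]; rewrite /A.
have cp : cts 0 t (fun s => phi_sup s ^+ 2).
  by apply: ctsX; apply: ctsS phi_sup_cts => //.
rewrite (rintB (itgZ 18 (cts_itg cp)) (@itg_cst R 0 t (1 / 4))).
rewrite (rintZ _ (cts_itg cp)) rint_cst// subr0 mulNr addrC; congr (18 * fine _ - _).
apply: eq_integral => s; rewrite inE/= in_itv/= => sT.
by rewrite phi_supE ?EFin_expe//; lra.
Qed.

Lemma weight_ac : ac 0 T (A phi) weight_rate.
Proof.
have a := rint_ac (ltW T0) (cts_itg weight_rate_cts).
by apply: eq_ac a => // [t tT|]; [rewrite weightE|exact: ltW].
Qed.

End Weight.

Section DualNorm.
Context {R : realType}.
Local Notation L := (@pi R *+ 2 : R).
Local Notation L0 := (@twopi_ge0 R).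
Implicit Types (f g h u v w : R -> R).

Lemma Hper0 : Hper 1 (fun=> 0 : R).
Proof.
have s0 : sqi 0 L (fun=> 0 : R) by apply: cts_sqi; exact: cts_cst.
have p0 : L2per (fun=> 0 : R) by apply: sqi_L2per.
split => //.
  by rewrite /zero_mean -/(rint 0 L _) rint_circle_cst mul0r.
move=> k _; exists (fun=> 0) => // psi _; rewrite -!/(rint 0 L _).
have z h : rint 0 L (fun x => 0 * h x) = 0.
  by rewrite (@eq_rint _ _ _ _ (fun=> 0)) ?rint_circle_cst ?mul0r// => x _; rewrite mul0r.
by rewrite !z mulr0.
Qed.

Lemma Hm1norm_ge0 f : (0 <= Hm1norm f)%E.
Proof.
apply: ereal_sup_ubound; exists (fun=> 0) => /=; last first.
  by under eq_integral do rewrite mulr0; rewrite integral0.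
have s0 : sqi 0 L (fun=> 0 : R) by apply: cts_sqi; exact: cts_cst.
have p0 : L2per (fun=> 0 : R) by apply: sqi_L2per.
split; first exact: Hper0.
have w0 : is_wderiv 1 (fun=> 0 : R) (fun=> 0) by apply: ac_wderiv => //; exact: ac_cst.
have [w2 w_eq] := wderiv_eq p0 p0 w0.
rewrite leNgt; apply/negP => H1.
have := sqr_Hnorm w2.
have -> : rint 0 L (fun x => wderiv 1 (fun=> 0 : R) x ^+ 2) = 0.
  rewrite -[RHS](mul0r L) -rint_circle_cst; apply: ae_eq_rint.
  - by apply: itg_measurable; exact: (L2per_sqi w2).2.
  - exact: measurable_cst.
  - by apply: (aeS w_eq) => x e /e ->; rewrite expr0n.
by move/eqP; rewrite expe_eq0/= gt_eqF// (lt_trans _ H1).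
Qed.

Lemma sqr_le1e (x : \bar R) : (0 <= x -> x ^+ 2 = 1 -> x <= 1)%E.
Proof.
case: x => [r|_|//]; last by rewrite expe2 mulyy.
rewrite lee_fin -EFin_expe => r0 [/eqP]; rewrite sqrp_eq1// => /eqP ->.
exact: lexx.
Qed.

(** [v] divided by the norm of its derivative [w] is a competitor in the
    definition of the dual norm. *)
Lemma Hm1norm_young f v w : sqi 0 L f -> L2per v -> zero_mean v -> L2per w ->
  is_wderiv 1 v w ->
  ((2 * rint 0 L (fun x => f x * v x) - rint 0 L (fun x => w x ^+ 2) / 2)%:E <=
   2%:E * Hm1norm f ^+ 2)%E.
Proof.
move=> sf v2 v0 w2 vw; have sv := L2per_sqi v2; have sw := L2per_sqi w2.
set J := rint 0 L (fun x => f x * v x); set W := rint 0 L (fun x => w x ^+ 2).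
have W0 : 0 <= W by exact: rint_sqr_ge0.
have N0 := Hm1norm_ge0 f.
have [J0|J0] := leP J 0.
  apply: (@le_trans _ _ 0%E); first by rewrite lee_fin; lra.
  by rewrite mule_ge0// expe_ge0.
have Wp : 0 < W.
  rewrite lt_neqAle W0 andbT eq_sym; apply: contraTneq J0 => Wz.
  have [P [aP PL vP]] := weak_primitive (sqi_itg sv) (sqi_itg sw) vw.
  have P0 : rint 0 L P = 0.
    rewrite -[RHS]v0 -/(rint 0 L v); apply/esym/ae_eq_rint => //.
    - exact: sqi_measurable.
    - exact: cts_measurable (ac_cts L0 aP).
  have Pz x : 0 <= x <= L -> P x = 0.
    move=> xL; have := zero_mean_sup aP sw PL P0 xL; rewrite -/W Wz mulr0 => h.
    by apply/eqP; rewrite -sqrf_eq0 eq_le h sqr_ge0.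
  suff -> : J = 0 by rewrite ltxx.
  rewrite -[RHS](mul0r L) -rint_circle_cst; apply: ae_eq_rint.
  - exact: itg_measurable (sqiM sf sv).
  - exact: measurable_cst.
  - by apply: (aeS vP) => x + xL => /(_ xL) ->; rewrite Pz// mulr0.
pose b := Num.sqrt W; have b0 : 0 < b by rewrite sqrtr_gt0.
have bW : b ^+ 2 = W by rewrite sqr_sqrtr.
have Z (k : R) (z : R -> R) : L2per z -> L2per (fun x => k * z x).
  move=> z2; apply: sqi_L2per.
  - by move=> x; case: z2 => [-> _ _].
  - by apply: measurable_funM => //; case: z2.
  - exact/sqiZ/L2per_sqi.
have vw' : is_wderiv 1 (fun x => b^-1 * v x) (fun x => b^-1 * w x).
  move=> psi tpsi; rewrite -!/(rint 0 L _).
  have c0 : cts 0 L psi by exact: (@test_cts R psi 0).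
  have c1 : cts 0 L (derive1n 1 psi) by exact: test_cts.
  rewrite (@eq_rint _ _ _ _ (fun x => b^-1 * (v x * derive1n 1 psi x))); last first.
    by move=> x _; rewrite mulrA.
  rewrite [X in _ = _ * X](@eq_rint _ _ _ _ (fun x => b^-1 * (w x * psi x))); last first.
    by move=> x _; rewrite mulrA.
  rewrite (rintZ _ (itgM_cts (sqi_itg sv) c1)) (rintZ _ (itgM_cts (sqi_itg sw) c0)).
  by have := vw _ tpsi; rewrite -!/(rint 0 L _) => ->; rewrite mulrCA.
have Hv : Hper 1 (fun x => b^-1 * v x).
  split; first exact: Z.
    by rewrite /zero_mean -/(rint 0 L _) (rintZ _ (sqi_itg sv)) [X in _ * X]v0 mulr0.
  move=> [|[|//]] _; last by exists (fun x => b^-1 * w x) => //; exact: Z.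
  exists (fun x => b^-1 * v x); first exact: Z.
  have iv : itg 0 L (fun x => b^-1 * v x) by apply: sqi_itg; exact: sqiZ.
  by apply: wderiv0 => //; apply: aeW.
have [u2 ue] := wderiv_eq (Z _ _ v2) (Z _ _ w2) vw'.
pose vb (x : R) : R := b^-1 * v x.
have H1 : (Hnorm 1 vb <= 1)%E.
  apply: sqr_le1e; first exact: L2norm_ge0.
  rewrite sqr_Hnorm//; congr EFin.
  have -> : rint 0 L (fun x => wderiv 1 vb x ^+ 2) =
      rint 0 L (fun x => b^-1 ^+ 2 * w x ^+ 2).
    apply: ae_eq_rint.
    - by apply: itg_measurable; exact: (L2per_sqi u2).2.
    - by apply: itg_measurable; apply: itgZ; exact: sw.2.
    - by apply: (aeS ue) => x e /e ->; rewrite exprMn.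
  by rewrite (rintZ _ sw.2) -/W -bW -exprMn mulVf ?expr1n// gt_eqF.
have JN : ((J / b)%:E <= Hm1norm f)%E.
  apply: ereal_sup_ubound; exists vb => //.
  have fv := sqiM sf (sqiZ b^-1 sv).
  have -> : J / b = rint 0 L (fun x => f x * vb x).
    rewrite mulrC /J -rintZ; last exact: sqiM.
    by apply: eq_rint => x _; rewrite /vb; ring.
  by rewrite /rint /Rintegral fineK//; exact: integrable_fin_num.
have Jb0 : 0 <= J / b by rewrite ltW// divr_gt0.
apply: (@le_trans _ _ (2 * (J / b) ^+ 2)%:E).
  rewrite lee_fin -bW (_ : J = J / b * b); last by rewrite divfK// gt_eqF.
  by rewrite mulfK ?gt_eqF//; have := sqr_ge0 (2 * (J / b) - b); rewrite sqrrB !exprMn; lra.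
rewrite EFinM lee_pmul2l// EFin_expe !expe2.
by apply: lee_pmul => //; rewrite lee_fin.
Qed.

End DualNorm.

(** * Smoothness of the solution *)

Section Solution.
Context {R : realType}.
Local Notation L := (@pi R *+ 2 : R).
Variables (tau : \bar R) (u : R -> R -> R).
Hypothesis Hu : solution_on tau u.
Implicit Types (a b c e s t x y M : R) (w : seq bool).

Definition before t := 0 < t /\ (t%:E < tau)%E.

Lemma before_between s t x : 0 < s -> (t%:E < tau)%E -> s <= x <= t -> before x.
Proof.
move=> s0 tt /andP[sx xt]; split; first exact: lt_le_trans sx.
by apply: le_lt_trans tt; rewrite lee_fin.
Qed.

Lemma pderiv_smooth w t x : before t ->
  [/\ derivable ((pderiv w u)^~ x) t 1, derivable (pderiv w u t) x 1 &
      {for (t, x), continuous (fun z : R * R => pderiv w u z.1 z.2)}].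
Proof. by move=> [t0 tt]; case: Hu => _ _ _ H _; exact: H. Qed.

Lemma pderiv_cts w t a b : before t -> cts a b (pderiv w u t).
Proof.
move=> tb; apply: derivable_within_continuous => x _.
have [_ d _] := @pderiv_smooth w t x tb; exact: d.
Qed.

Lemma pderiv_cts_time w s t x : 0 < s -> (t%:E < tau)%E -> cts s t ((pderiv w u)^~ x).
Proof.
move=> s0 tt; apply: derivable_within_continuous => y; rewrite in_itv/= => yst.
have [d _ _] := @pderiv_smooth w y x (before_between s0 tt yst); exact: d.
Qed.

Lemma pderiv_ac w t a b : a <= b -> before t ->
  ac a b (pderiv w u t) (pderiv (false :: w) u t).
Proof.
move=> ab tb; apply: ac_derivable => //; last exact: (@pderiv_cts (false :: w)).
move=> x _; have [_ d _] := @pderiv_smooth w t x tb; exact: d.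
Qed.

Lemma pderiv_ac_time w s t x : 0 < s -> s <= t -> (t%:E < tau)%E ->
  ac s t ((pderiv w u)^~ x) ((pderiv (true :: w) u)^~ x).
Proof.
move=> s0 st tt; apply: ac_derivable => //; last exact: (@pderiv_cts_time (true :: w)).
move=> y yst; have [d _ _] := @pderiv_smooth w y x (before_between s0 tt yst); exact: d.
Qed.

Lemma pderiv_bounded w s t : 0 < s -> (t%:E < tau)%E ->
  exists2 M, 0 < M & forall y x, s <= y <= t -> 0 <= x <= L -> `|pderiv w u y x| <= M.
Proof.
move=> s0 tt; have cR : compact (rect s t 0 L).
  by apply: compact_setX; exact: segment_compact.
have cw : {within rect s t 0 L, continuous (fun z : R * R => pderiv w u z.1 z.2)}.
  apply: continuous_in_subspaceT => -[y x]; rewrite inE => /in_rect[/= yst _].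
  by have [] := @pderiv_smooth w y x (before_between s0 tt yst).
have [M [Mr MP]] := compact_bounded (continuous_compact cw cR).
exists (`|M| + 1); first by rewrite ltr_wpDl.
move=> y x yst xL; apply: MP; first by rewrite ltr_pwDr// ler_norm.
by exists (y, x) => //; apply/in_rect.
Qed.

Lemma pderiv_lipschitz w s t : 0 < s -> (t%:E < tau)%E ->
  exists2 M, 0 < M & forall y z x, s <= y -> y <= z -> z <= t -> 0 <= x <= L ->
    `|pderiv w u z x - pderiv w u y x| <= M * (z - y).
Proof.
move=> s0 tt; have [M M0 MP] := pderiv_bounded (true :: w) s0 tt.
exists M => // y z x sy yz zt xL.
have y0 : 0 < y by exact: lt_le_trans sy.
have zt' : (z%:E < tau)%E by apply: le_lt_trans tt; rewrite lee_fin.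
have a := @pderiv_ac_time w y z x y0 yz zt'.
rewrite -(ac_rint yz a) (le_trans (normr_rint a.1))// -rint_cst//.
apply: le_rint; [exact: itg_norm a.1|exact: itg_cst|].
by move=> r ryz; apply: MP => //; lra.
Qed.

Lemma pderiv_measurable2 w s t : 0 < s -> s < t -> (t%:E < tau)%E ->
  measurable2 s t 0 L (pderiv w u).
Proof.
move=> s0 st tt; apply: measurable2_cts => //.
- by move=> y yst; apply: cts_measurable; apply: pderiv_cts; exact: before_between yst.
- by move=> x _; exact: pderiv_cts_time.
Qed.

Lemma solution_Hper t : 0 <= t -> (t%:E < tau)%E -> Hper 1 (u t).
Proof. by move=> t0 tt; case: Hu => _ H _ _ _; exact: H. Qed.

Lemma pderiv_periodic k t : before t -> periodic (pderiv (nseq k false) u t) L.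
Proof.
move=> [t0 tt]; elim: k => [|k ih] /=.
  by have [[]] := solution_Hper (ltW t0) tt.
exact: derive1_periodic.
Qed.

Lemma pderiv_ends k t : before t ->
  pderiv (nseq k false) u t L = pderiv (nseq k false) u t 0.
Proof. by move=> tb; have := pderiv_periodic k tb 0; rewrite add0r. Qed.

Lemma pderiv_L2per k t : before t -> L2per (pderiv (nseq k false) u t).
Proof.
move=> tb; apply: sqi_L2per; first exact: pderiv_periodic.
  apply: continuous_measurable_fun => x; apply/differentiable_continuous/derivable1_diffP.
  by have [] := @pderiv_smooth (nseq k false) t x tb.
by apply: cts_sqi; exact: pderiv_cts.
Qed.

Lemma solution_equation t x : before t ->
  pderiv [:: true] u t x = - pderiv (nseq 4 false) u t x -
    (2 * pderiv (nseq 2 false) u t x ^+ 2 +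
     2 * pderiv (nseq 1 false) u t x * pderiv (nseq 3 false) u t x).
Proof.
move=> tb; have [t0 tt] := tb; have [_ _ _ _ /(_ t x t0 tt)] := Hu.
rewrite /growth_equation_at => E.
have dU k y : is_derive y 1 (pderiv (nseq k false) u t) (pderiv (nseq k.+1 false) u t y).
  have [_ d _] := @pderiv_smooth (nseq k false) t y tb.
  by apply: DeriveDef => //; rewrite -derive1E.
set U1 := pderiv (nseq 1 false) u t in dU *.
set U2 := pderiv (nseq 2 false) u t in dU *.
set U3 := pderiv (nseq 3 false) u t in dU *.
have E1 : derive1 (fun y => derive1 (u t) y ^+ 2) = fun y => 2 * U1 y * U2 y.
  apply/funext => y; have d1 : is_derive y 1 U1 (U2 y) := dU 1%N y.
  have -> : (fun y => derive1 (u t) y ^+ 2) = U1 ^+ 2 by rewrite exprfctE.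
  rewrite derive1E derive_val /GRing.scale/= expr1; ring.
have E2 : derive1n 2 (fun y => derive1 (u t) y ^+ 2) x = 2 * U2 x ^+ 2 + 2 * U1 x * U3 x.
  rewrite derive1nS derive1n1 E1.
  have d1 : is_derive x 1 U1 (U2 x) := dU 1%N x.
  have d2 : is_derive x 1 U2 (U3 x) := dU 2%N x.
  have -> : (fun y => 2 * U1 y * U2 y) = (2 \*o U1) * U2 by [].
  by rewrite derive1E derive_val /GRing.scale/=; ring.
by rewrite -E2 -E.
Qed.

End Solution.

(** * The energy identity *)

Section EnergyIdentity.
Context {R : realType}.
Local Notation mu := (@lebesgue_measure R).
Local Notation L := (@pi R *+ 2 : R).
Local Notation L0 := (@twopi_ge0 R).
Variables (tau : \bar R) (u : R -> R -> R) (T : R) (phi phit : R -> R -> R).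
Hypotheses (Hu : solution_on tau u) (T0 : 0 < T) (Hphi : approximation_on T phi phit).
Variables (F0 F1 F2 F3 : R -> R -> R).
Hypothesis FP : forall t, 0 <= t <= T ->
  smooth_rep (phi t) (F0 t) (F1 t) (F2 t) (F3 t).
Variables (t0 t1 : R).
Hypotheses (t00 : 0 < t0) (t01 : t0 < t1) (t1T : t1 <= T) (t1tau : (t1%:E < tau)%E).
Implicit Types (a b c e s t x y r M : R) (psi : R -> R).

Local Notation U k := (pderiv (nseq k false) u).
Definition D0 t x : R := U 0%N t x - F0 t x.
Definition D1 t x : R := U 1%N t x - F1 t x.
Definition D2 t x : R := U 2%N t x - F2 t x.
Definition D3 t x : R := U 3%N t x - F3 t x.
Definition Dt t x : R := pderiv [:: true] u t x - phit t x.

Definition energy t : R := rint 0 L (fun x => D1 t x ^+ 2).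
Definition energy_rate t : R := - (2 * rint 0 L (fun x => Dt t x * D2 t x)).

Local Ltac wlra := move: (t00) (t01) (t1T) (T0); lra.

Lemma in_window s : t0 <= s <= t1 -> 0 <= s <= T /\ before tau s.
Proof.
move=> /[dup] st /andP[ts st1]; split; last exact: before_between t00 t1tau st.
by rewrite (le_trans (ltW t00) ts) (le_trans st1 t1T).
Qed.

Lemma D_ac s : 0 <= s <= T -> before tau s -> [/\ ac 0 L (D0 s) (D1 s), ac 0 L (D1 s) (D2 s),
  ac 0 L (D2 s) (D3 s) & ac 0 L (D3 s) (fun x => U 4%N s x - wderiv 4 (phi s) x)].
Proof.
move=> sT sb; have [[a0 a1 a2 a3] _ _ _] := FP sT.
split; apply: acB => //.
- exact: (pderiv_ac Hu [::] L0 sb).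
- exact: (pderiv_ac Hu (nseq 1 false) L0 sb).
- exact: (pderiv_ac Hu (nseq 2 false) L0 sb).
- exact: (pderiv_ac Hu (nseq 3 false) L0 sb).
Qed.

Lemma D_ends s : 0 <= s <= T -> before tau s ->
  [/\ D0 s L = D0 s 0, D1 s L = D1 s 0, D2 s L = D2 s 0 & D3 s L = D3 s 0].
Proof.
move=> sT sb; have [_ [p0 p1 p2 p3] _ _] := FP sT.
rewrite /D0 /D1 /D2 /D3 p0 p1 p2 p3.
by rewrite (pderiv_ends Hu 0 sb) (pderiv_ends Hu 1 sb) (pderiv_ends Hu 2 sb) (pderiv_ends Hu 3 sb).
Qed.

Lemma D_cts s : 0 <= s <= T -> before tau s ->
  [/\ cts 0 L (D0 s), cts 0 L (D1 s), cts 0 L (D2 s) & cts 0 L (D3 s)].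
Proof.
by move=> sT sb; have [a0 a1 a2 a3] := D_ac sT sb; split; apply: (ac_cts L0); eassumption.
Qed.

Lemma energy_increment s t : t0 <= s -> s <= t -> t <= t1 ->
  energy t - energy s = - rint 0 L (fun x => (D0 t x - D0 s x) * (D2 t x + D2 s x)).
Proof.
move=> t0s st tt1.
have [sT sb] : 0 <= s <= T /\ before tau s by apply: in_window; wlra.
have [tT tb] : 0 <= t <= T /\ before tau t by apply: in_window; wlra.
have [as0 as1 _ _] := D_ac sT sb; have [at0 at1 _ _] := D_ac tT tb.
have [es0 es1 _ _] := D_ends sT sb; have [et0 et1 _ _] := D_ends tT tb.
have [_ cs1 _ _] := D_cts sT sb; have [_ ct1 _ _] := D_cts tT tb.
have := rint_parts (acB at0 as0) (acD at1 as1); rewrite es0 es1 et0 et1 => /(_ erefl erefl) <-.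
rewrite /energy -(rintB (cts_itg (@ctsX R 0 L _ 2 ct1)) (cts_itg (@ctsX R 0 L _ 2 cs1))).
by apply: eq_rint => x _; rewrite subr_sqr.
Qed.

Lemma Dt_itg2 : itg2 t0 t1 0 L Dt.
Proof.
apply: itg2B; last by apply: itg2S (phit_itg2 Hphi) => //; wlra.
have [M _ MP] := pderiv_bounded Hu [:: true] t00 t1tau.
exact: itg2_bounded (pderiv_measurable2 Hu [:: true] t00 t01 t1tau) MP.
Qed.

Lemma D0_increment s t : t0 <= s -> s <= t -> t <= t1 ->
  {ae mu, forall x, 0 <= x <= L -> D0 t x - D0 s x = rint s t (Dt^~ x)}.
Proof.
move=> t0s st tt1.
have [sT sb] : 0 <= s <= T /\ before tau s by apply: in_window; wlra.
have [tT tb] : 0 <= t <= T /\ before tau t by apply: in_window; wlra.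
have [_ _ es _] := FP sT; have [_ _ et _] := FP tT.
have s0 : 0 <= s by wlra.
have tT' : t <= T by wlra.
have i1 : itg2 s t 0 L phit by apply: itg2S (phit_itg2 Hphi) => //; wlra.
have H := aeS2 es et (fun x p q => conj p q).
have H' := aeS2 (phi_increment Hphi s0 st tT') (itg2_section i1) (fun x p q => conj p q).
apply: (aeS2 H H') => x [esx etx] [px ix] xL.
rewrite /D0 -(esx xL) -(etx xL).
have [s0' [_ tt]] := (lt_le_trans t00 t0s, tb).
have au := pderiv_ac_time Hu [::] x s0' st tt.
have -> : rint s t (Dt^~ x) = rint s t (pderiv [:: true] u ^~ x) - rint s t (phit^~ x).
  by rewrite -(rintB au.1 (ix xL)).
by rewrite (ac_rint st au) -(px xL) /=; ring.
Qed.

Lemma D2_unif e : 0 < e -> exists2 d, 0 < d & forall s t x, t0 <= s -> s <= t -> t <= t1 ->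
  t - s < d -> 0 <= x <= L -> `|D2 t x - D2 s x| < e.
Proof.
move=> e0; have e20 : 0 < e / 2 by rewrite divr_gt0.
have [M M0 MP] := pderiv_lipschitz Hu (nseq 2 false) t00 t1tau.
have B0 := phit_energy_ge0 T phit.
have K0 : 0 <= 32 * (phit_energy T phit + 1) by rewrite mulr_ge0//; wlra.
have [d d0 dP] := sqr_modulus K0 e20.
exists (Num.min d (e / 2 / M)); first by rewrite lt_min d0 divr_gt0.
move=> s t x t0s st tt1; rewrite lt_min => /andP[td]; rewrite ltr_pdivlMr// => tM xL.
have h1 : `|F2 t x - F2 s x| < e / 2.
  apply: (dP (t - s)) => //; first by rewrite subr_ge0.
  by apply: (phi_rep2_sup Hphi FP) => //; wlra.
have h2 := MP _ _ _ t0s st tt1 xL.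
rewrite (_ : D2 t x - D2 s x = (U 2%N t x - U 2%N s x) - (F2 t x - F2 s x)); last first.
  rewrite /D2; move: (U 2%N t x) (U 2%N s x) => y z; ring.
rewrite (le_lt_trans (ler_normB _ _))//; move: h2; rewrite [M * _]mulrC; wlra.
Qed.

Lemma D2_cts_time x : 0 <= x <= L -> cts t0 t1 (D2^~ x).
Proof.
move=> xL; apply/ctsP => s st e e0; have [d d0 dP] := D2_unif e0; exists d => // t tt ts.
have [st'|/ltW ts'] := leP s t.
  apply: dP => //; [wlra|wlra|].
  by move: ts; rewrite ger0_norm ?subr_ge0.
rewrite distrC; apply: dP => //; [wlra|wlra|].
by move: ts; rewrite distrC ger0_norm ?subr_ge0.
Qed.

Lemma D2_measurable2 : measurable2 t0 t1 0 L D2.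
Proof.
apply: measurable2_cts => //; last exact: D2_cts_time.
move=> s /in_window[sT sb]; have [_ _ c2 _] := D_cts sT sb; exact: cts_measurable.
Qed.

Lemma D2_bounded : exists2 M, 0 < M & forall s x, t0 <= s <= t1 -> 0 <= x <= L -> `|D2 s x| <= M.
Proof.
have [M M0 MP] := pderiv_bounded Hu (nseq 2 false) t00 t1tau.
have [N N0 NP] := cts_bounded (phi_sup_cts Hphi FP).
exists (M + N); first exact: addr_gt0.
move=> s x st xL; have [sT sb] := in_window st.
have := NP _ sT; rewrite ger0_norm ?phi_sup_ge0//.
have := phi_sup_ge FP sT xL; have := MP _ _ st xL.
by have := ler_normB (U 2%N s x) (F2 s x); rewrite /D2; wlra.
Qed.

Lemma DtD2_itg2 : itg2 t0 t1 0 L (fun s x => Dt s x * D2 s x).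
Proof.
by have [M _ MP] := D2_bounded; exact: itg2M_bounded Dt_itg2 D2_measurable2 MP.
Qed.

Lemma energy_pairing s t : t0 <= s -> s <= t -> t <= t1 ->
  itg2 s t 0 L (fun r x => Dt r x * (D2 t x + D2 s x)) /\
  energy t - energy s = - rint2 s t 0 L (fun r x => Dt r x * (D2 t x + D2 s x)).
Proof.
move=> t0s st tt1.
have [sT sb] : 0 <= s <= T /\ before tau s by apply: in_window; wlra.
have [tT tb] : 0 <= t <= T /\ before tau t by apply: in_window; wlra.
have [cs0 _ cs2 _] := D_cts sT sb; have [ct0 _ ct2 _] := D_cts tT tb.
pose psi x := D2 t x + D2 s x.
have cpsi : cts 0 L psi by exact: ctsD.
have [M _ MP] := cts_bounded cpsi.
have iDt : itg2 s t 0 L Dt by apply: itg2S Dt_itg2.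
have i2 : itg2 s t 0 L (fun r x => Dt r x * psi x).
  apply: (@itg2M_bounded _ _ _ _ _ _ (fun _ => psi) M iDt).
    by apply: measurable2_snd; exact: cts_measurable.
  by move=> r x _ xL; exact: MP.
split; first exact: i2.
rewrite (energy_increment t0s st tt1) (rint2E i2); congr (- _).
have [_ ix ->] := fubini_rect i2.
apply: ae_eq_rint.
- by apply: cts_measurable; apply: ctsM => //; exact: ctsB.
- exact: itg_measurable ix.
apply: (aeS2 (D0_increment t0s st tt1) (itg2_section iDt)) => x + + xL.
move=> /(_ xL) -> /(_ xL) ixx.
by rewrite [LHS]mulrC -rintZ//; apply: eq_rint => r _; rewrite mulrC.
Qed.

(** [energy] is the pairing of the difference [D0] with the second derivative
    [- D2], and only [D0] is differentiated in time. The increment over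
    [[s, t]] pairs [Dt] with [- (D2 s + D2 t)], which is uniformly close to
    [- 2 D2]. *)
Lemma energy_ac : ac t0 t1 energy energy_rate.
Proof.
have iDt := Dt_itg2; have iN := itg2_norm iDt; have iDD := DtD2_itg2.
have [im _ _] := fubini_rect iN.
have [iq _ _] := fubini_rect iDD.
have iq2 : itg t0 t1 energy_rate by apply: itgN; exact: itgZ iq.
apply: (increment_ac iq2 im) => e e0.
have e20 : 0 < e / 2 by rewrite divr_gt0.
have [d d0 dP] := D2_unif e20; exists d => // s t t0s st tt1 tsd.
have S2 H : itg2 t0 t1 0 L H -> itg2 s t 0 L H by apply: itg2S.
have [i2 ->] := energy_pairing t0s st tt1.
have i1 := S2 _ iDD; have iNs := S2 _ iN.
have i1' : itg2 s t 0 L (fun r x => 2 * (Dt r x * D2 r x)).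
  have := itg2D i1 i1; apply: eq_integrable; first exact: measurable_rect.
  by move=> z _ /=; congr EFin; ring.
have iqs : itg s t (fun r => rint 0 L (fun x => Dt r x * D2 r x)) by apply: itgS iq.
have -> : rint s t energy_rate = - rint2 s t 0 L (fun r x => 2 * (Dt r x * D2 r x)).
  by rewrite rint2Z// (rint2E i1) /energy_rate (rintN (itgZ 2 iqs)) (rintZ _ iqs).
rewrite opprK addrC -rint2B//.
rewrite (le_trans (normr_rint2 (itg2B i1' i2)))// -(rint2E iNs) -rint2Z//.
apply: le_rint2.
- exact: itg2_norm (itg2B i1' i2).
- by refine (integrableZl _ e iNs); exact: measurable_rect.
move=> r x rst xL.
rewrite (_ : _ - _ = Dt r x * ((D2 r x - D2 s x) - (D2 t x - D2 r x))); last by ring.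
rewrite normrM mulrC ler_wpM2r// (le_trans (ler_normB _ _))//.
have h1 : `|D2 t x - D2 r x| < e / 2 by apply: dP => //; wlra.
have h2 : `|D2 r x - D2 s x| < e / 2 by apply: dP => //; wlra.
wlra.
Qed.

End EnergyIdentity.

(** * The energy inequality *)

Section Nonlinear.
Context {R : realType}.
Local Notation L := (@pi R *+ 2 : R).
Local Notation L0 := (@twopi_ge0 R).
Variables (d1 d2 d3 d4 f1 f2 f3 : R -> R) (n : R).
Hypotheses (a1 : ac 0 L d1 d2) (a2 : ac 0 L d2 d3) (a3 : ac 0 L d3 d4).
Hypotheses (b1 : ac 0 L f1 f2) (b2 : ac 0 L f2 f3) (c3 : cts 0 L f3).
Hypotheses (p1 : d1 L = d1 0) (p2 : d2 L = d2 0) (p3 : d3 L = d3 0).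
Hypotheses (q1 : f1 L = f1 0) (q2 : f2 L = f2 0).
Hypotheses (m1 : rint 0 L d1 = 0) (f2n : forall x, 0 <= x <= L -> `|f2 x| <= n).

Local Notation S f := (rint 0 L (fun x => f x ^+ 2)).

Let cd1 : cts 0 L d1. Proof. exact: ac_cts L0 a1. Qed.
Let cd2 : cts 0 L d2. Proof. exact: ac_cts L0 a2. Qed.
Let cd3 : cts 0 L d3. Proof. exact: ac_cts L0 a3. Qed.
Let cf1 : cts 0 L f1. Proof. exact: ac_cts L0 b1. Qed.
Let cf2 : cts 0 L f2. Proof. exact: ac_cts L0 b2. Qed.

Local Ltac solve_cts := lazymatch goal with
  | |- cts _ _ (fun x => @?f x - @?g x) => apply: (@ctsB R _ _ f g); solve_cts
  | |- cts _ _ (fun x => @?f x + @?g x) => apply: (@ctsD R _ _ f g); solve_cts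
  | |- cts _ _ (fun x => @?f x ^+ ?k) => apply: (@ctsX R _ _ f k); solve_cts
  | |- cts _ _ (fun x => @?f x * @?g x) => apply: (@ctsM R _ _ f g); solve_cts
  | |- cts _ _ (fun _ => ?k) => exact: cts_cst
  | |- _ => assumption
  end.
Local Ltac solve_itg := apply: cts_itg; solve_cts.

Lemma sqr_interpolation : S d2 ^+ 2 <= S d1 * S d3.
Proof.
have -> : S d2 = - rint 0 L (fun x => d1 x * d3 x).
  by rewrite -(rint_parts a1 a2 p1 p2); apply: eq_rint => x _; rewrite expr2.
by rewrite sqrrN; apply: rint_CS; exact: cts_sqi.
Qed.

Lemma sqr_poincare2 : 81 / 100 * S d1 <= S d3.
Proof.
have W := wirtinger a1 (cts_sqi cd2) p1 m1; have I := sqr_interpolation.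
have E0 := rint_sqr_ge0 0 L d1; have P0 := rint_sqr_ge0 0 L d2.
have [E00|E00] := eqVneq (S d1) 0; first by rewrite E00 mulr0 rint_sqr_ge0.
have Ep : 0 < S d1 by rewrite lt_neqAle eq_sym E00.
rewrite -(ler_pM2l Ep) (le_trans _ I)//.
rewrite (_ : S d1 * _ = (9 / 10 * S d1) ^+ 2); last by field.
by rewrite lerXn2r ?nnegrE// mulr_ge0.
Qed.

(** [d2] is bounded by the norm of [d3], so the cubic integral is of higher
    order than the dissipation when [S d1] is small. *)
Lemma cubic_bound : S d1 <= 1 / 25 -> rint 0 L (fun x => d2 x ^+ 3) <= 3 / 10 * S d3.
Proof.
move=> E25; have B0 := rint_sqr_ge0 0 L d3; have P0 := rint_sqr_ge0 0 L d2.
pose r := Num.sqrt (2 * S d3).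
have r0 : 0 <= r by exact: sqrtr_ge0.
have r2 : r ^+ 2 = 2 * S d3 by rewrite sqr_sqrtr// mulr_ge0.
have Xr : rint 0 L (fun x => d2 x ^+ 3) <= r * S d2.
  rewrite -rintZ; last by solve_itg.
  apply: le_rint; [by solve_itg|by solve_itg|move=> x xL].
  rewrite exprS ler_wpM2r ?sqr_ge0// (le_trans (ler_norm _))//.
  rewrite -sqrtr_sqr ler_wsqrtr//.
  exact: (zero_mean_sup a2 (cts_sqi cd3) p2 (ac_zero_mean a1 p1)).
rewrite (le_trans Xr)// -(@ler_pXn2r _ 2)// ?nnegrE ?mulr_ge0//.
rewrite exprMn r2 (@le_trans _ _ (2 * S d3 * (S d1 * S d3)))//.
  by rewrite ler_wpM2l ?mulr_ge0// sqr_interpolation.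
rewrite (_ : 2 * _ * _ = 2 * S d1 * S d3 ^+ 2); last by ring.
by rewrite exprMn ler_wpM2r ?sqr_ge0//; move: E25; lra.
Qed.

Definition nonlinearity x : R :=
  2 * d2 x ^+ 2 + 4 * d2 x * f2 x + 2 * d1 x * d3 x + 2 * d1 x * f3 x + 2 * f1 x * d3 x.

Lemma nonlinearity_cts : cts 0 L nonlinearity.
Proof. by rewrite /nonlinearity; solve_cts. Qed.

(** Up to the derivative of the periodic function
    [d1 d2^2 + f1 d2^2 + 2 d1 d2 f2]. *)
Lemma rint_nonlinearity : rint 0 L (fun x => nonlinearity x * d2 x) =
  rint 0 L (fun x => d2 x ^+ 3) + rint 0 L (fun x => d2 x ^+ 2 * f2 x - 2 * d1 x * d3 x * f2 x).
Proof.
have a22 := acM L0 a2 a2; have a12 := acM L0 a1 a2.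
have aP := acD (acD (acM L0 a1 a22) (acM L0 b1 a22)) (acZ 2 (acM L0 a12 b2)).
have := ac_rint L0 aP; rewrite p1 p2 q1 q2 subrr => E.
have cN := nonlinearity_cts.
apply/eqP; rewrite -subr_eq0 -[X in _ == X]E; apply/eqP.
have i1 : itg 0 L (fun x => d2 x ^+ 3) by solve_itg.
have i2 : itg 0 L (fun x => d2 x ^+ 2 * f2 x - 2 * d1 x * d3 x * f2 x) by solve_itg.
have i3 : itg 0 L (fun x => nonlinearity x * d2 x) by solve_itg.
rewrite -(rintD i1 i2) -(rintB i3 (itgD i1 i2)).
by apply: eq_rint => x _; rewrite /nonlinearity; ring.
Qed.

(** Young's inequality for the products [d1 d3 f2] and, after an integration by
    parts, [n d2^2]. The weights are such that the terms with [d1] add up to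
    [18 n^2]. *)
Lemma cross_bound :
  2 * rint 0 L (fun x => d2 x ^+ 2 * f2 x - 2 * d1 x * d3 x * f2 x) <=
  S d3 / 2 + 18 * n ^+ 2 * S d1.
Proof.
have iE : itg 0 L (fun x => d1 x ^+ 2) by solve_itg.
have iB : itg 0 L (fun x => d3 x ^+ 2) by solve_itg.
have i2 : itg 0 L (fun x => d2 x ^+ 2) by solve_itg.
have i13 : itg 0 L (fun x => d1 x * d3 x) by solve_itg.
have young : 2 * n * S d2 <= 1 / 6 * S d3 + 6 * n ^+ 2 * S d1.
  have -> : S d2 = - rint 0 L (fun x => d1 x * d3 x).
    by rewrite -(rint_parts a1 a2 p1 p2); apply: eq_rint => x _; rewrite expr2.
  rewrite mulrN -mulNr -(rintZ _ i13) -(rintZ _ iB) -(rintZ _ iE).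
  rewrite -(rintD (itgZ _ iB) (itgZ _ iE)).
  apply: le_rint; [exact: itgZ|by apply: itgD; exact: itgZ|move=> x _].
  by have := sqr_ge0 (d3 x + 6 * n * d1 x); nra.
have iX : itg 0 L (fun x => d2 x ^+ 2 * f2 x - 2 * d1 x * d3 x * f2 x) by solve_itg.
rewrite -(rintZ 2 iX).
apply: (@le_trans _ _ (rint 0 L (fun x => 2 * n * d2 x ^+ 2 +
    (1 / 3 * d3 x ^+ 2 + 12 * n ^+ 2 * d1 x ^+ 2)))).
  apply: le_rint; [exact: itgZ|by solve_itg|move=> x /f2n fn].
  have [fn1 fn2] : f2 x <= n /\ - n <= f2 x by move: fn; rewrite ler_norml => /andP[].
  have h1 : d2 x ^+ 2 * f2 x <= d2 x ^+ 2 * n by rewrite ler_wpM2l ?sqr_ge0.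
  have h2 : f2 x ^+ 2 * d1 x ^+ 2 <= n ^+ 2 * d1 x ^+ 2.
    rewrite ler_wpM2r ?sqr_ge0// -[f2 x ^+ 2]real_normK ?num_real//.
    by rewrite lerXn2r ?nnegrE// (le_trans _ fn).
  have := sqr_ge0 (d3 x + 6 * f2 x * d1 x).
  move: h1 h2; set g := f2 x; set y := d1 x; set z := d3 x; set v := d2 x => h1 h2 h3.
  have h4 : (z + 6 * g * y) ^+ 2 = z ^+ 2 + 12 * (y * z * g) + 36 * (g ^+ 2 * y ^+ 2) by ring.
  rewrite h4 in h3.
  rewrite (_ : 2 * (_ - _) = 2 * (v ^+ 2 * g) - 4 * (y * z * g)); last by ring.
  by move: h1 h2 h3; lra.
rewrite (rintD (itgZ _ i2) (itgD (itgZ _ iB) (itgZ _ iE))).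
rewrite (rintD (itgZ _ iB) (itgZ _ iE)) !rintZ//.
move: young; lra.
Qed.

(** Of the term [- 2 S d3], a quarter pays for the cross terms, a quarter is
    kept, and the rest dominates the cubic term and leaves [- 2 / 5 S d3],
    which by the Poincare inequality is at most [- S d1 / 4]. *)
Lemma dissipation : S d1 <= 1 / 25 ->
  2 * (rint 0 L (fun x => d4 x * d2 x) + rint 0 L (fun x => nonlinearity x * d2 x)) <=
  (18 * n ^+ 2 - 1 / 4) * S d1 - S d3 / 2.
Proof.
move=> E25; have X := cubic_bound E25; have Y := cross_bound; have P := sqr_poincare2.
rewrite rint_nonlinearity (rint_parts a3 a2 p3 p2).
rewrite (@eq_rint _ _ _ (fun x => d3 x * d3 x) (fun x => d3 x ^+ 2)); last first.
  by move=> x _; rewrite expr2.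
move: X Y P (rint_sqr_ge0 0 L d1); lra.
Qed.

End Nonlinear.

Section EnergyInequality.
Context {R : realType}.
Local Notation mu := (@lebesgue_measure R).
Local Notation L := (@pi R *+ 2 : R).
Local Notation L0 := (@twopi_ge0 R).
Variables (tau : \bar R) (u : R -> R -> R) (T : R) (phi phit : R -> R -> R).
Hypotheses (Hu : solution_on tau u) (Hphi : approximation_on T phi phit).
Variables (F0 F1 F2 F3 : R -> R -> R).
Hypothesis FP : forall t, 0 <= t <= T ->
  smooth_rep (phi t) (F0 t) (F1 t) (F2 t) (F3 t).
Implicit Types (s x : R).

Local Notation U k := (pderiv (nseq k false) u).

Lemma wderiv_phi_L2per s k : 0 <= s <= T -> (k <= 4)%N -> L2per (wderiv k (phi s)).
Proof. by move=> sT k4; exact: (wderivP (phi_Hper4 Hphi sT) k4).1. Qed.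

(** The square of the first derivative belongs to H^2 because its continuous
    representative [F1 ^ 2] is twice differentiable. *)
Lemma wderiv2_sqr s : 0 <= s <= T ->
  L2per (wderiv 2 (fun x => wderiv 1 (phi s) x ^+ 2)) /\
  {ae mu, forall x, 0 <= x <= L -> wderiv 2 (fun x => wderiv 1 (phi s) x ^+ 2) x =
     2 * F2 s x ^+ 2 + 2 * F1 s x * F3 s x}.
Proof.
move=> sT; have Fs := FP sT; have [_ c1 c2 c3] := rep_cts Fs.
have [[_ a1 a2 _] [_ p1 p2 _] _ [e1 e2 e3]] := Fs.
have [w1 w2 w3] : [/\ L2per (wderiv 1 (phi s)), L2per (wderiv 2 (phi s)) & L2per (wderiv 3 (phi s))].
  by split; exact: wderiv_phi_L2per.
have e123 := aeS2 e1 (aeS2 e2 e3 (fun x p q => conj p q)) (fun x p q => conj p q).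
pose g x := wderiv 1 (phi s) x ^+ 2.
pose h x := 2 * wderiv 2 (phi s) x ^+ 2 + 2 * wderiv 1 (phi s) x * wderiv 3 (phi s) x.
pose G x := F1 s x ^+ 2.
pose H x := 2 * F2 s x ^+ 2 + 2 * F1 s x * F3 s x.
have cG : cts 0 L G by exact: ctsX.
have cH : cts 0 L H.
  apply: ctsD; first by apply: ctsM; [exact: cts_cst|exact: ctsX].
  by apply: ctsM => //; apply: ctsM => //; exact: cts_cst.
have mg : measurable_fun setT g by apply: measurable_funX; case: w1.
have mh : measurable_fun setT h.
  apply: measurable_funD.
    by apply: measurable_funM => //; apply: measurable_funX; case: w2.
  by apply: measurable_funM; [apply: measurable_funM => //; case: w1|case: w3].
have Gg : {ae mu, forall x, 0 <= x <= L -> G x = g x}.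
  by apply: (aeS e1) => x + xL => /(_ xL) e; rewrite /g e.
have Hh : {ae mu, forall x, 0 <= x <= L -> H x = h x}.
  apply: (aeS e123) => x [+ [+ +]] xL => /(_ xL) q1 /(_ xL) q2 /(_ xL) q3.
  by rewrite /h q1 q2 q3.
have sg : sqi 0 L g by apply: ae_eq_sqi Gg (cts_sqi cG); exact: measurable_funTS.
have sh : sqi 0 L h by apply: ae_eq_sqi Hh (cts_sqi cH); exact: measurable_funTS.
have pw k : L2per (wderiv k (phi s)) -> periodic (wderiv k (phi s)) L by case.
have g2 : L2per g by apply: sqi_L2per => // x; rewrite /g (pw _ w1).
have h2 : L2per h by apply: sqi_L2per => // x; rewrite /h (pw _ w1) (pw _ w2) (pw _ w3).
have wGH : is_wderiv 2 G H.
  apply: (@wderiv_comp _ 1 G (fun x => 2 * F1 s x * F2 s x)).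
    apply: ac_wderiv; last by rewrite /G p1.
    have aG : ac 0 L (fun x => F1 s x * F1 s x) (fun x => 2 * F1 s x * F2 s x).
      by apply: eq_acr (acM L0 a1 a1) => x _; ring.
    by apply: (eq_ac _ L0 aG) => x _; rewrite /G expr2.
  apply: ac_wderiv; last by rewrite p1 p2.
  by apply: eq_acr (acM L0 (acZ 2 a1) a2) => x _; rewrite /H; ring.
have wgh : is_wderiv 2 g h.
  apply: (ae_eq_wderivl (cts_itg cG) (sqi_itg sg) Gg).
  exact: (ae_eq_wderivr (cts_itg cH) (sqi_itg sh) Hh wGH).
have [k2 ek] := wderiv_eq g2 h2 wgh; split => //.
by apply: (aeS2 ek Hh) => x + + xL => /(_ xL) -> /(_ xL) <-.
Qed.

Lemma Res_sqi s : 0 <= s <= T -> L2per (phit s) -> sqi 0 L (Res phi phit s).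
Proof.
move=> sT ps; have [w2 _] := wderiv2_sqr sT.
apply: sqiD; last exact: L2per_sqi w2.
by apply: sqiD; apply: L2per_sqi => //; exact: wderiv_phi_L2per.
Qed.

(** The equations of [u] and [phi] give the time derivative of the difference as
    minus the sum of its fourth derivative, the nonlinear terms and the
    residual. Pairing with the second derivative, [dissipation] bounds the first
    two, and the kept quarter of the dissipation absorbs the residual. *)
Lemma energy_inequality s : 0 <= s <= T -> before tau s -> Hper 4 (phit s) ->
  energy u F1 s <= 1 / 25 ->
  ((energy_rate u phit F2 s - weight_rate phi s * energy u F1 s)%:E <=
   2%:E * Hm1norm (Res phi phit s) ^+ 2)%E.
Proof.
move=> sT sb Hp E25; have Fs := FP sT.
have ps : L2per (phit s) by case: Hp.
have sR := Res_sqi sT ps.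
have [_ b1 b2 b3] := rep_cts Fs.
have [[_ a1 a2 _] [_ p1 p2 _] _ [e1 e2 e3]] := Fs.
have [d01 d12 d23 d34] := D_ac Hu FP sT sb.
have [q0 q1 q2 q3] := D_ends Hu FP sT sb.
have [_ k1 k2 k3] := D_cts Hu FP sT sb.
have [u2p u3p u4p] : [/\ L2per (U 2%N s), L2per (U 3%N s) & L2per (U 4%N s)].
  by split; [exact: (pderiv_L2per Hu 2 sb)|exact: (pderiv_L2per Hu 3 sb)|exact: (pderiv_L2per Hu 4 sb)].
have [w2p w3p w4p] : [/\ L2per (wderiv 2 (phi s)), L2per (wderiv 3 (phi s)) &
    L2per (wderiv 4 (phi s))] by split; exact: wderiv_phi_L2per.
pose d4 x := U 4%N s x - wderiv 4 (phi s) x.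
have s4 : sqi 0 L d4 by apply: L2per_sqi; exact: L2perB.
pose v x := U 2%N s x - wderiv 2 (phi s) x.
pose w x := U 3%N s x - wderiv 3 (phi s) x.
have v2 : L2per v by exact: L2perB.
have w2 : L2per w by exact: L2perB.
have vD : {ae mu, forall x, 0 <= x <= L -> v x = D2 u F2 s x}.
  by apply: (aeS e2) => x + xL => /(_ xL) e; rewrite /v e.
have wD : {ae mu, forall x, 0 <= x <= L -> w x = D3 u F3 s x}.
  by apply: (aeS e3) => x + xL => /(_ xL) e; rewrite /w e.
have v0 : zero_mean v.
  rewrite /zero_mean -/(rint 0 L v) -[RHS](ac_zero_mean d12 q1); apply: ae_eq_rint => //.
  - exact: sqi_measurable (L2per_sqi v2).
  - exact: cts_measurable.
have i2 := sqi_itg (L2per_sqi u2p); have i3 := sqi_itg (L2per_sqi u3p).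
have j2 := sqi_itg (L2per_sqi w2p); have j3 := sqi_itg (L2per_sqi w3p).
have vw : is_wderiv 1 v w.
  apply: (is_wderivB i2 j2 i3 j3).
    apply: ac_wderiv; first exact: (pderiv_ac Hu (nseq 2 false) L0 sb).
    exact: (pderiv_ends Hu 2 sb).
  have Hs := phi_Hper4 Hphi sT.
  exact: wderiv_trans (wderivP Hs (isT : (2 <= 4)%N)).2 (wderivP Hs (isT : (3 <= 4)%N)).2.
apply: le_trans (Hm1norm_young sR v2 v0 w2 vw); rewrite lee_fin.
have -> : rint 0 L (fun x => w x ^+ 2) = rint 0 L (fun x => D3 u F3 s x ^+ 2).
  apply: ae_eq_rint.
  - by apply: itg_measurable; exact: (L2per_sqi w2).2.
  - by apply: cts_measurable; exact: ctsX.
  - by apply: (aeS wD) => x e /e ->.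
have sD2 := cts_sqi k2.
have -> : rint 0 L (fun x => Res phi phit s x * v x) =
    rint 0 L (fun x => Res phi phit s x * D2 u F2 s x).
  apply: ae_eq_rint.
  - by apply: itg_measurable; apply: sqiM => //; exact: L2per_sqi.
  - by apply: itg_measurable; exact: sqiM.
  - by apply: (aeS vD) => x e /e ->.
pose N := nonlinearity (D1 u F1 s) (D2 u F2 s) (D3 u F3 s) (F1 s) (F2 s) (F3 s).
have cN : cts 0 L N by apply: nonlinearity_cts; eassumption.
have iN : itg 0 L (fun x => N x * D2 u F2 s x) by apply: cts_itg; exact: ctsM.
have i4 : itg 0 L (fun x => d4 x * D2 u F2 s x) by exact: sqiM.
have iR : itg 0 L (fun x => Res phi phit s x * D2 u F2 s x) by exact: sqiM.
have E : rint 0 L (fun x => Dt u phit s x * D2 u F2 s x) =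
    - (rint 0 L (fun x => d4 x * D2 u F2 s x) + rint 0 L (fun x => N x * D2 u F2 s x) +
       rint 0 L (fun x => Res phi phit s x * D2 u F2 s x)).
  rewrite -(rintD i4 iN) -(rintD (itgD i4 iN) iR) -(rintN (itgD (itgD i4 iN) iR)).
  apply: ae_eq_rint.
  - apply: measurable_funM; last exact: cts_measurable.
    have mU : measurable_fun `[0, L] (pderiv [:: true] u s).
      by apply: cts_measurable; exact: (@pderiv_cts R tau u Hu [:: true] s 0 L sb).
    exact: (measurable_funB mU (sqi_measurable (L2per_sqi ps))).
  - by apply: itg_measurable; apply: itgN; apply: itgD => //; exact: itgD.
  have [_ ew] := wderiv2_sqr sT.
  apply: (aeS ew) => x + xL => /(_ xL) e.
  have := solution_equation Hu x sb.
  rewrite /Dt /Res e /N /nonlinearity /d4 /D1 /D2 /D3.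
  move: (pderiv [:: true] u s x) (U 1%N s x) (U 2%N s x) (U 3%N s x) (U 4%N s x).
  by move=> ut u1 u2 u3 u4 ->; ring.
have fn x : 0 <= x <= L -> `|F2 s x| <= phi_sup phi s by exact: (phi_sup_ge FP).
have H := dissipation d12 d23 d34 a1 a2 b3 q1 q2 q3 p1 p2 (ac_zero_mean d01 q0) fn E25.
rewrite /energy_rate E /weight_rate /energy; move: H; rewrite -/N -/d4; lra.
Qed.

End EnergyInequality.

(** * The Gronwall argument *)

Section ChainRule.
Context {R : realType}.
Implicit Types (a b s t x y : R) (F G f g : R -> R).

(** By the mean value and intermediate value theorems, the increment of
    [G \o F] over [[s, t]] is the integral of [g (F r0) * f] for some [r0] in
    [[s, t]]. *)
Lemma ac_comp a b F f G g : a <= b -> ac a b F f ->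
  (forall x, is_derive x 1 G (g x)) -> continuous g ->
  ac a b (fun x => G (F x)) (fun x => g (F x) * f x).
Proof.
move=> ab aF dG cg; have cF := ac_cts ab aF.
have cgF : cts a b (fun x => g (F x)).
  by move=> x; apply: (continuous_comp (cF x)); exact: cg.
have i1 : itg a b (fun x => g (F x) * f x).
  by apply: eq_itg (itgM_cts aF.1 cgF) => x _; rewrite mulrC.
apply: (increment_ac i1 (itg_norm aF.1)) => e e0.
have [d d0 dP] := cts_unif cgF e0; exists d => // s t as_ st tb tsd.
have cFs : cts s t F by exact: ctsS cF.
have [r0 r0st E] : exists2 r0, s <= r0 <= t & G (F t) - G (F s) = g (F r0) * (F t - F s).
  have cG y z : {within `[y, z], continuous G}.
    apply: continuous_subspaceT => x.
    by have [/derivable1_diffP/differentiable_continuous] := dG x.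
  have [Fst|/ltW Fts] := leP (F s) (F t).
    have [x + E] := MVT_segment Fst (fun x _ => dG x) (cG _ _); rewrite in_itv/= => xF.
    have [|r + rx] := IVT st cFs (v := x); first by rewrite min_l ?max_r.
    by rewrite in_itv/= => rst; exists r; rewrite ?rx.
  have [x + E] := MVT_segment Fts (fun x _ => dG x) (cG _ _); rewrite in_itv/= => xF.
  have [|r + rx] := IVT st cFs (v := x); first by rewrite min_r ?max_l.
  rewrite in_itv/= => rst; exists r => //.
  by rewrite rx -[LHS]opprB E -mulrN opprB.
have ifs : itg s t f by apply: itgS aF.1.
have i1s : itg s t (fun x => g (F x) * f x) by apply: itgS i1.
rewrite E (ac_increment as_ st tb aF) -(rintZ _ ifs) -(rintB (itgZ _ ifs) i1s).
rewrite (le_trans (normr_rint (itgB (itgZ _ ifs) i1s)))// -(rintZ _ (itg_norm ifs)).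
apply: le_rint; [exact: itg_norm (itgB (itgZ _ ifs) i1s)|exact: itgZ (itg_norm ifs)|].
move=> x xst; rewrite -mulrBl normrM ler_wpM2r//; apply/ltW/dP; [lra|lra|].
by rewrite ltr_norml; lra.
Qed.

End ChainRule.

Section Gronwall.
Context {R : realType}.
Local Notation mu := (@lebesgue_measure R).
Variables (tau : \bar R) (u : R -> R -> R) (T : R) (phi phit : R -> R -> R).
Hypotheses (Hu : solution_on tau u) (T0 : 0 < T) (Hphi : approximation_on T phi phit).
Variables (F0 F1 F2 F3 : R -> R -> R).
Hypothesis FP : forall t, 0 <= t <= T ->
  smooth_rep (phi t) (F0 t) (F1 t) (F2 t) (F3 t).
Implicit Types (s t x e : R).

Definition residual_integral t : \bar R :=
  (\int[mu]_(s in `[0%R, t])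
     (Hm1norm (Res phi phit s) ^+ 2 * (expR (A phi t - A phi s))%:E))%E.

Lemma residual_integral_ge0 t : (0 <= residual_integral t)%E.
Proof.
apply: integral_ge0 => s _.
by rewrite mule_ge0 ?expe_ge0 ?Hm1norm_ge0// lee_fin expR_ge0.
Qed.

(** The energy times [expR (A t - A r)] has derivative [k r], by the product
    rule. As the dual norm of the residual is not evidently measurable in time,
    the integral of its square is a lower integral; it is compared with that of
    the positive part of [k], which is measurable. *)
Lemma gronwall s t : 0 < s -> s < t -> t <= T -> (t%:E < tau)%E ->
  (forall r, s <= r < t -> energy u F1 r <= 1 / 25) ->
  (residual_integral t < +oo)%E ->
  energy u F1 t <= energy u F1 s * expR (A phi t - A phi s) +
                   2 * fine (residual_integral t).
Proof.
move=> s0 st tT ttau E25 Ioo.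
have aE := energy_ac Hu T0 Hphi FP s0 st tT ttau.
have aA : ac s t (fun x => A phi x) (weight_rate phi).
  by apply: acS (weight_ac T0 Hphi FP) => //; exact: ltW.
have aX : ac s t (fun r => A phi t - A phi r) (fun r => - weight_rate phi r).
  by apply: eq_acr (acB (@ac_cst R s t (A phi t)) aA) => r _; rewrite sub0r.
have aW := ac_comp (ltW st) aX (@is_derive_expR R) (@continuous_expR R).
have aH := acM (ltW st) aE aW.
pose k r := expR (A phi t - A phi r) *
  (energy_rate u phit F2 r - weight_rate phi r * energy u F1 r).
have ik : itg s t k by apply: eq_itg aH.1 => r _; rewrite /k; ring.
have Ek : energy u F1 t = energy u F1 s * expR (A phi t - A phi s) + rint s t k.
  have := ac_rint (ltW st) aH; rewrite (subrr (A phi t)) expR0 (mulr1 (energy u F1 t)).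
  rewrite (_ : rint s t _ = rint s t k); last by apply: eq_rint => r _; rewrite /k; ring.
  by move=> ->; ring.
pose f r := Num.max 0 (k r) / 2.
have mf : measurable_fun `[s, t] f.
  apply: measurable_funM => //; apply: measurable_maxr => //; exact: itg_measurable ik.
pose g r := (Hm1norm (Res phi phit r) ^+ 2 * (expR (A phi t - A phi r))%:E)%E.
have g0 r : (0 <= g r)%E.
  by rewrite mule_ge0 ?expe_ge0 ?Hm1norm_ge0// lee_fin expR_ge0.
have f0 r : 0 <= f r by rewrite /f divr_ge0// le_max lexx.
have gle : (\int[mu]_(r in `[s, t]) g r <= residual_integral t)%E.
  rewrite /residual_integral integral_mkcond [leRHS]integral_mkcond.
  apply: le_lower_integral => r _; first by rewrite patchE; case: ifPn.
  rewrite !patchE; case: ifPn => [|_]; last by case: ifPn => // _; exact: g0.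
  rewrite inE /= in_itv/= => /andP[sr rt]; rewrite ifT// inE /= in_itv/= rt andbT.
  by rewrite (le_trans _ sr)// ltW.
have fg : {ae mu, forall r, s <= r <= t -> ((f r)%:E <= g r)%E}.
  have tne : {ae mu, forall r, r <> t}.
    exists [set t]; split; [by []|exact: lebesgue_measure_set1|].
    by move=> r /= /contrapT.
  apply: (aeS2 (phit_Hper4 Hphi) tne) => r Hr rt /andP[sr rt'].
  have {}rt : r < t by rewrite lt_neqAle rt' andbT; apply/eqP.
  have rT : 0 <= r <= T by rewrite (le_trans (ltW s0) sr) (le_trans rt' tT).
  have rb : before tau r by apply: (before_between s0 ttau); rewrite sr rt'.
  have := energy_inequality Hu Hphi FP rT rb (Hr rT).
  rewrite E25 ?sr//; move=> /(_ isT) H.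
  rewrite /f /g; set w := expR _; have w0 : 0 < w by exact: expR_gt0.
  have [k0|k0] := leP (k r) 0; first by rewrite mul0r g0.
  pose z : R := (energy_rate u phit F2 r - weight_rate phi r * energy u F1 r) / 2.
  have -> : ((k r / 2)%:E = z%:E * w%:E)%E.
    by rewrite -EFinM /k -/w /z; congr EFin; ring.
  rewrite lee_wpmul2r ?lee_fin ?(ltW w0)//.
  by rewrite /z mulrC EFinM lee_pdivrMl.
have goo := le_lt_trans gle Ioo.
have [fi fle] := dominated_lower_integral mf (fun r _ => f0 r) (fun r _ => g0 r) fg goo.
have I0 := residual_integral_ge0 t.
have {}fle : rint s t f <= fine (residual_integral t).
  have IE : (fine (residual_integral t))%:E = residual_integral t.
    by rewrite fineK// ge0_fin_numE.
  by rewrite -lee_fin IE; exact: le_trans fle gle.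
rewrite Ek lerD2l (@le_trans _ _ (rint s t (fun r => 2 * f r)))//.
  apply: le_rint => //; first exact: itgZ.
  by move=> r _; rewrite /f mulrC divfK// le_max lexx orbT.
by rewrite (rintZ _ fi) ler_pM2l.
Qed.

End Gronwall.

(** * The a posteriori estimate *)

Section FinalEstimate.
Context {R : realType}.
Local Notation mu := (@lebesgue_measure R).
Local Notation L := (@pi R *+ 2 : R).
Local Notation L0 := (@twopi_ge0 R).

Lemma Hper_le (p k : nat) (f : R -> R) : (k <= p)%N -> Hper p f -> Hper k f.
Proof.
by move=> kp [f2 f0 H]; split => // j jk; apply: H; exact: leq_trans kp.
Qed.

Lemma wderivB (f g : R -> R) : Hper 1 f -> Hper 1 g ->
  L2per (wderiv 1 (f \- g)) /\
  {ae mu, forall x, 0 <= x <= L -> wderiv 1 (f \- g) x = wderiv 1 f x - wderiv 1 g x}.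
Proof.
move=> Hf Hg; have [f2 wf] := wderivP Hf (leqnn 1); have [g2 wg] := wderivP Hg (leqnn 1).
have fp : L2per f by case: Hf.
have gp : L2per g by case: Hg.
apply: wderiv_eq; [exact: L2perB|exact: L2perB|].
by apply: is_wderivB => //; exact: sqi_itg (L2per_sqi _).
Qed.

Lemma sqr_HnormB (f g F : R -> R) : Hper 1 f -> Hper 1 g -> sqi 0 L F ->
  {ae mu, forall x, 0 <= x <= L -> wderiv 1 f x - wderiv 1 g x = F x} ->
  (Hnorm 1 (f \- g)%R ^+ 2 = (rint 0 L (fun x => F x ^+ 2))%:E)%E.
Proof.
move=> Hf Hg sF fgF; have [w2 we] := wderivB Hf Hg.
rewrite sqr_Hnorm//; congr EFin; apply: ae_eq_rint.
- by apply: itg_measurable; exact: (L2per_sqi w2).2.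
- by apply: itg_measurable; exact: sF.2.
- by apply: (aeS2 we fgF) => x + + xL => /(_ xL) -> /(_ xL) ->.
Qed.

(** [Kstar] is [2 * 7 ^ 7] to the power [- 1 / 4], and [25 ^ 4 < 2 * 7 ^ 7]. *)
Lemma Kstar_lt : @Kstar R < 1 / 25.
Proof.
have K0 : 0 < 8 * (7 ^+ 7 / 4) :> R by rewrite mulr_gt0// divr_gt0// exprn_gt0.
have C0 := powR_gt0 (1 / 4) K0.
rewrite /Kstar /K powRN [1 / 25]div1r ltf_pV2 ?posrE//.
have -> : (25 : R) = (25 ^+ 4) `^ (1 / 4).
  rewrite -powR_mulrn// -powRrM.
  by rewrite (_ : _ * _ = 1 :> R) ?powRr1//; field.
apply: gt0_ltr_powR; rewrite ?nnegrE ?exprn_ge0 ?(ltW K0)//.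
rewrite (_ : 8 * (7 ^+ 7 / 4) = (2 * 7 * 49) * (49 * 49)); last by field.
rewrite (_ : 25 ^+ 4 = (25 * 25) * (25 * 25)); last by ring.
by apply: ltr_pM; rewrite ?mulr_ge0//; lra.
Qed.

Variables (tau : \bar R) (u : R -> R -> R) (T : R) (phi phit : R -> R -> R).
Hypotheses (Hu : solution_on tau u) (T0 : 0 < T) (Hphi : approximation_on T phi phit).
Variables (F0 F1 F2 F3 : R -> R -> R).
Hypothesis FP : forall t, 0 <= t <= T ->
  smooth_rep (phi t) (F0 t) (F1 t) (F2 t) (F3 t).
Implicit Types (s t x e : R).

Local Notation U k := (pderiv (nseq k false) u).

Lemma wderiv_solution t : before tau t ->
  {ae mu, forall x, 0 <= x <= L -> wderiv 1 (u t) x = U 1%N t x}.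
Proof.
move=> tb; apply: (wderiv_eq (pderiv_L2per Hu 0 tb) (pderiv_L2per Hu 1 tb) _).2.
apply: ac_wderiv; first exact: (pderiv_ac Hu [::] L0 tb).
exact: (pderiv_ends Hu 0 tb).
Qed.

Lemma phi_Hper1 t : 0 <= t <= T -> Hper 1 (phi t).
Proof. by move=> tT; apply: (@Hper_le 4) => //; exact: (phi_Hper4 Hphi). Qed.

Lemma energyE t : 0 < t -> t <= T -> (t%:E < tau)%E ->
  (Hnorm 1 (u t \- phi t)%R ^+ 2 = (energy u F1 t)%:E)%E.
Proof.
move=> t0 tT ttau; have tb : before tau t by [].
have tT' : 0 <= t <= T by rewrite ltW.
have [_ c1 _ _] := D_cts Hu FP tT' tb.
apply: sqr_HnormB.
- exact: (solution_Hper Hu (ltW t0) ttau).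
- exact: phi_Hper1.
- exact: cts_sqi.
have [_ _ _ [e1 _ _]] := FP tT'.
apply: (aeS2 (wderiv_solution tb) e1) => x + + xL => /(_ xL) -> /(_ xL) ->.
by [].
Qed.

Definition initial_energy : R :=
  rint 0 L (fun x => (wderiv 1 (u 0) x - wderiv 1 (phi 0) x) ^+ 2).

Lemma u0_Hper1 : Hper 1 (u 0).
Proof. by apply: (solution_Hper Hu) => //; case: Hu. Qed.

Lemma phi0_Hper1 : Hper 1 (phi 0).
Proof. by apply: phi_Hper1; rewrite lexx ltW. Qed.

Lemma initial_sqi : sqi 0 L (fun x => wderiv 1 (u 0) x - wderiv 1 (phi 0) x).
Proof.
apply: sqiB; apply: L2per_sqi.
  exact: (wderivP u0_Hper1 (leqnn 1)).1.
exact: (wderivP phi0_Hper1 (leqnn 1)).1.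
Qed.

Lemma initial_energyE : (Hnorm 1 (u 0 \- phi 0)%R ^+ 2 = initial_energy%:E)%E.
Proof.
apply: sqr_HnormB; [exact: u0_Hper1|exact: phi0_Hper1|exact: initial_sqi|].
exact: aeW.
Qed.

Lemma initial_energy_ge0 : 0 <= initial_energy.
Proof. exact: rint_sqr_ge0. Qed.

Lemma solution_near0 e : 0 < e -> exists2 d, 0 < d & forall t, 0 < t -> t < d -> (t%:E < tau)%E ->
  rint 0 L (fun x => (U 1%N t x - wderiv 1 (u 0) x) ^+ 2) <= e.
Proof.
move=> e0; have [tau0 _ H _ _] := Hu.
have s0 : 0 < Num.sqrt e by rewrite sqrtr_gt0.
have C := H 0 (lexx 0) tau0.
have : \forall t \near within [set t : R | 0 <= t /\ (t%:E < tau)%E] (nbhs (0 : R)),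
    (Hnorm 1 (u t \- u 0)%R < (Num.sqrt e)%:E)%E.
  apply: (C [set y | (y < (Num.sqrt e)%:E)%E]).
  by apply: open_ereal_lt'; rewrite lte_fin.
rewrite near_withinE => -[d /= d0 dP].
exists d => // t t0 td ttau.
have tb : before tau t by [].
have /= ut := dP t _ _.
have {}ut : (Hnorm 1 (u t \- u 0)%R < (Num.sqrt e)%:E)%E.
  by apply: ut; [rewrite /= sub0r normrN gtr0_norm|split; first exact: ltW].
have u0p := (wderivP u0_Hper1 (leqnn 1)).1.
have sq : sqi 0 L (fun x => U 1%N t x - wderiv 1 (u 0) x).
  by apply: sqiB; apply: L2per_sqi => //; exact: (pderiv_L2per Hu 1 tb).
rewrite -lee_fin -(@sqr_HnormB (u t) (u 0) _ _ u0_Hper1 sq).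
- rewrite -[e](sqr_sqrtr (ltW e0)) EFin_expe !expe2.
  by apply: lee_pmul; rewrite ?L2norm_ge0// (ltW ut).
- exact: (solution_Hper Hu (ltW t0) ttau).
- by apply: (aeS (wderiv_solution tb)) => x + xL => /(_ xL) ->.
Qed.

(** The energy, defined by pointwise values at positive times, is upper
    semicontinuous at time [0], as [u] and [phi] are continuous in H^1. *)
Lemma energy_near0 e : 0 < e -> exists2 d, 0 < d & forall t, 0 < t -> t < d -> t <= T ->
  (t%:E < tau)%E -> energy u F1 t <= initial_energy + e.
Proof.
move=> e0; have I0 := initial_energy_ge0; set E0 := initial_energy in I0 *.
(* [h] is the weight of Young's inequality, [r] the size of the squares of the
   increments [p] of the derivative of [u] and [q] of that of [phi]. *)
pose h : R := e / (2 * (E0 + 1)).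
have h0 : 0 < h by rewrite divr_gt0// mulr_gt0//; lra.
pose c : R := 1 + h^-1.
have c0 : 0 < c by rewrite /c addr_gt0// invr_gt0.
pose r : R := e / (8 * c); have r0 : 0 < r by rewrite divr_gt0// mulr_gt0.
have [d1 d10 d1P] := solution_near0 r0.
set B := phit_energy T phit; have B0 : 0 <= B by exact: phit_energy_ge0.
pose k : R := 512 * (B + 1); have k0 : 0 < k by apply: mulr_gt0; [rewrite ltr0n|rewrite ltr_wpDl].
have k80 : 0 < 8 * k by exact: mulr_gt0.
exists (Num.min d1 (r / (8 * k))); first by rewrite lt_min d10 divr_gt0.
move=> t t0; rewrite lt_min => /andP[td1]; rewrite (ltr_pdivlMr _ _ k80) => td2 tT ttau.
have tb : before tau t by [].
have tT' : 0 <= t <= T by rewrite ltW.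
have T0' : 0 <= (0 : R) <= T by rewrite lexx ltW.
have [_ c1 _ _] := rep_cts (FP tT'); have [_ c10 _ _] := rep_cts (FP T0').
have cU : cts 0 L (U 1%N t) by exact: (pderiv_cts Hu).
have u0p := L2per_sqi (wderivP u0_Hper1 (leqnn 1)).1.
have sg := initial_sqi.
pose g x : R := wderiv 1 (u 0) x - wderiv 1 (phi 0) x.
pose p x : R := U 1%N t x - wderiv 1 (u 0) x.
pose q x : R := F1 t x - F1 0 x.
have sp : sqi 0 L p by apply: sqiB => //; exact: cts_sqi.
have cq : cts 0 L q by exact: ctsB.
have sq : sqi 0 L q by exact: cts_sqi.
have p_le : rint 0 L (fun x => p x ^+ 2) <= r by exact: d1P.
have q_le : rint 0 L (fun x => q x ^+ 2) <= r.
  have qk x : 0 <= x <= L -> q x ^+ 2 <= k * t.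
    by move=> xL; have := phi_rep1_sup Hphi FP (lexx 0) (ltW t0) tT xL; rewrite subr0.
  rewrite (le_trans (rint_sqr_le L0 sq.2 qk))// subr0.
  rewrite (@le_trans _ _ (k * t * 8))//; last by move: td2; lra.
  by rewrite ler_wpM2l ?twopi_le8// mulr_ge0// ltW.
have -> : energy u F1 t = rint 0 L (fun x => (g x + (p x - q x)) ^+ 2).
  have [_ _ _ [e1 _ _]] := FP T0'; have [_ k1 _ _] := D_cts Hu FP tT' tb.
  apply: ae_eq_rint.
  - by apply: cts_measurable; exact: ctsX.
  - by apply: itg_measurable; exact: (sqiD sg (sqiB sp sq)).2.
  - by apply: (aeS e1) => x + xL => /(_ xL) E; rewrite /g /p /q E /D1; congr (_ ^+ 2); ring.
have i1 := itgZ (1 + h) sg.2; have i2 := itgZ (c * 2) sp.2; have i3 := itgZ (c * 2) sq.2.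
rewrite (@le_trans _ _ (rint 0 L (fun x => (1 + h) * g x ^+ 2 +
    (c * 2 * p x ^+ 2 + c * 2 * q x ^+ 2))))//.
  apply: le_rint; [exact: (sqiD sg (sqiB sp sq)).2|by apply: itgD => //; exact: itgD|].
  move=> x _; have pq : (p x - q x) ^+ 2 <= 2 * p x ^+ 2 + 2 * q x ^+ 2.
    by rewrite -subr_ge0 (_ : _ - _ = (p x + q x) ^+ 2) ?sqr_ge0//; ring.
  have young : 2 * (g x * (p x - q x)) <= h * g x ^+ 2 + h^-1 * (p x - q x) ^+ 2.
    set z := p x - q x; rewrite -(ler_pM2l h0) -subr_ge0.
    rewrite (_ : _ - _ = (h * g x - z) ^+ 2) ?sqr_ge0//.
    by move: (h) (h0) => y y0; field; rewrite gt_eqF.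
  have : c * (p x - q x) ^+ 2 <= c * (2 * p x ^+ 2 + 2 * q x ^+ 2) by rewrite ler_pM2l.
  by rewrite {1}/c sqrrD mulrDl mul1r; lra.
rewrite (rintD i1 (itgD i2 i3)) (rintD i2 i3) (rintZ _ sg.2) (rintZ _ sp.2) (rintZ _ sq.2).
rewrite -/E0 -/initial_energy.
have hE : h * E0 <= e / 2.
  rewrite /h mulrAC ler_pdivrMr ?mulr_gt0//; last lra.
  by rewrite (_ : e / 2 * _ = e * (E0 + 1)); [rewrite ler_pM2l//; lra|field].
have cr : c * r = e / 8 by rewrite /r; field; rewrite gt_eqF.
have cp : c * rint 0 L (fun x => p x ^+ 2) <= e / 8 by rewrite -cr ler_pM2l.
have cq' : c * rint 0 L (fun x => q x ^+ 2) <= e / 8 by rewrite -cr ler_pM2l.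
rewrite ![c * 2 * _]mulrAC.
rewrite -[initial_energy]/E0 mulrDl mul1r.
by move: hE cp cq'; move: (h * E0) (c * _) (c * _) => x y z; lra.
Qed.

End FinalEstimate.

Section Bootstrap.
Context {R : realType}.
Variables (tau : \bar R) (u : R -> R -> R) (T : R) (phi phit : R -> R -> R).
Hypotheses (Hu : solution_on tau u) (T0 : 0 < T) (Hphi : approximation_on T phi phit).
Variables (F0 F1 F2 F3 : R -> R -> R).
Hypothesis FP : forall t, 0 <= t <= T ->
  smooth_rep (phi t) (F0 t) (F1 t) (F2 t) (F3 t).
Implicit Types (s t x e : R).

Local Notation E := (energy u F1).
Local Notation E0 := (initial_energy u phi).
Local Notation J := (residual_integral phi phit).
Local Notation d0 := (u 0 \- phi 0).

Lemma weight0 : A phi 0 = 0.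
Proof. by rewrite (weightE Hphi FP) ?lexx ?ltW// rint_pt. Qed.

Lemma residual_integral0 : J 0 = 0%E.
Proof. by rewrite /residual_integral set_itv1 integral_set1. Qed.

Lemma error_boundE t : (J t < +oo)%E ->
  error_bound phi phit d0 t = (E0 * expR (A phi t) + 2 * fine (J t))%:E.
Proof.
move=> Joo; have JE : (fine (J t))%:E = J t.
  by rewrite fineK// ge0_fin_numE// residual_integral_ge0.
by rewrite /error_bound (initial_energyE Hu T0 Hphi) [RHS]EFinD !EFinM JE.
Qed.

Lemma error_bound_fin t k : (error_bound phi phit d0 t <= k%:E)%E -> (J t < +oo)%E.
Proof.
rewrite /error_bound (initial_energyE Hu T0 Hphi) -/(residual_integral phi phit t) => H.
rewrite ltey; apply/eqP => Joo; move: H.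
by rewrite Joo -EFinM gt0_muley ?lte_fin// addey// leye_eq.
Qed.

(** The Gronwall inequality is available on [[s, t]] for [0 < s]; letting [s]
    tend to [0] the energy at time [s] becomes that of the initial error. *)
Lemma gronwall0 t : 0 < t -> t <= T -> (t%:E < tau)%E ->
  (forall r, 0 < r < t -> E r <= 1 / 25) -> (J t < +oo)%E ->
  E t <= E0 * expR (A phi t) + 2 * fine (J t).
Proof.
move=> t0 tT ttau E25 Joo; apply/ler_addgt0Pr => e e0.
have I0 : 0 <= E0 by exact: initial_energy_ge0.
set C := expR (A phi t); have C0 : 0 < C by exact: expR_gt0.
have S0 : 0 < E0 + C + 1 by rewrite ltr_wpDr// ltr_wpDl.
pose h : R := Num.min 1 (e / (E0 + C + 1)).
have h0 : 0 < h by rewrite lt_min ltr01 divr_gt0.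
have hP : (E0 + h) * (C + h) <= E0 * C + e.
  have h1 : h <= 1 by rewrite ge_min lexx.
  have : h * (E0 + C + 1) <= e by rewrite -ler_pdivlMr// ge_min lexx orbT.
  have := ler_wpM2l (ltW h0) h1.
  by rewrite !mulrDl !mulrDr [h * C]mulrC [E0 * h]mulrC; lra.
have [d1 d10 d1P] := energy_near0 Hu T0 Hphi FP h0.
have aA := weight_ac T0 Hphi FP.
have cA : cts 0 T (fun r => expR (A phi t - A phi r)).
  have aX := acB (@ac_cst R 0 T (A phi t)) aA.
  exact: (ac_cts (ltW T0) (ac_comp (ltW T0) aX (@is_derive_expR R) (@continuous_expR R))).
have T0' : 0 <= (0 : R) <= T by rewrite lexx ltW.
have [d2 d20 d2P] := (ctsP _ _ _).1 cA 0 T0' h h0.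
pose m : R := Num.min t (Num.min d1 d2); have m0 : 0 < m by rewrite !lt_min t0 d10.
pose s : R := m / 2; have s0 : 0 < s by rewrite divr_gt0.
have sm : s < m by rewrite /s; move: (m) m0 => y; lra.
move: (sm); rewrite /m !lt_min => /and3P[st sd1 sd2].
have G := gronwall Hu T0 Hphi FP s0 st tT ttau _ Joo.
rewrite (le_trans (G _))//.
  by move=> r /andP[sr rt]; apply: E25; rewrite rt (lt_le_trans s0 sr).
rewrite [leRHS]addrAC lerD2r (le_trans _ hP)//.
have sT : s <= T by rewrite (le_trans (ltW st)).
have stau : (s%:E < tau)%E by rewrite (lt_trans _ ttau)// lte_fin.
apply: ler_pM; [exact: rint_sqr_ge0|exact: expR_ge0|exact: d1P|].
have : `|expR (A phi t - A phi s) - expR (A phi t - A phi 0)| < h.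
  by apply: d2P; rewrite ?(ltW s0)// subr0 gtr0_norm.
rewrite weight0 subr0 -/C => /ltr_normlW; lra.
Qed.

(** A continuity argument: at the first time [r] at which the energy reaches
    the threshold, it is still below it on [(0, r)], so that it satisfies the
    Gronwall bound at [r], which is at most [Kstar < 1 / 25]. *)
Lemma energy_below_threshold t : t <= T -> (t%:E < tau)%E ->
  (forall s, 0 <= s <= t -> (error_bound phi phit d0 s <= (@Kstar R)%:E)%E) ->
  forall s, 0 < s <= t -> E s <= 1 / 25.
Proof.
move=> tT ttau H s1 /andP[s10 s1t]; rewrite leNgt; apply/negP => E25.
have KS := @Kstar_lt R.
have t0 : 0 <= t by rewrite (le_trans (ltW s10)).
have I0 : E0 < 1 / 25.
  have := H 0; rewrite lexx t0 => /(_ isT).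
  rewrite error_boundE residual_integral0 ?ltry// weight0 expR0 mulr1 mulr0 addr0 lee_fin.
  by move=> /le_lt_trans; exact.
pose h : R := (1 / 25 - E0) / 2; have h0 : 0 < h by rewrite divr_gt0// subr_gt0.
have [d d_gt0 dP] := energy_near0 Hu T0 Hphi FP h0.
have small r : 0 < r -> r < d -> r <= t -> E r < 1 / 25.
  move=> r0 rd rt; have := dP r r0 rd (le_trans rt tT).
  have rtau : (r%:E < tau)%E by rewrite (le_lt_trans _ ttau)// lee_fin.
  by move=> /(_ rtau); rewrite /h; lra.
have ds1 : d <= s1.
  by rewrite leNgt; apply/negP => s1d; have := small _ s10 s1d s1t; rewrite ltNge ltW.
(* The energy is below the threshold on [(0, d)] and continuous on [[d / 2, s1]]. *)
have d20 : 0 < d / 2 by rewrite divr_gt0.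
have d2s1 : d / 2 < s1 by rewrite (lt_le_trans _ ds1)// ltr_pdivrMr// ltr_pMr// ltr1n.
have s1T := le_trans s1t tT.
have s1tau : (s1%:E < tau)%E by rewrite (le_lt_trans _ ttau)// lee_fin.
have cE : cts (d / 2) s1 E.
  exact: (ac_cts (ltW d2s1) (energy_ac Hu T0 Hphi FP d20 d2s1 s1T s1tau)).
pose B : set R := [set r | d / 2 <= r <= s1 /\ 1 / 25 <= E r].
have Bs1 : B s1 by split; [rewrite lexx ltW|exact: ltW].
have hiB : has_inf B by split; [exists s1|exists (d / 2) => r [/andP[]]].
pose r := inf B.
have dr : d / 2 <= r by apply: lb_le_inf => [|y [/andP[]]//]; exists s1.
have rs1 : r <= s1 by apply: ge_inf => //; exact: hiB.2.
have r0 : 0 < r by exact: lt_le_trans dr.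
have rt := le_trans rs1 s1t.
have below q : 0 < q < r -> E q <= 1 / 25.
  move=> /andP[q0 qr]; have [qd|dq] := ltP q d.
    by rewrite ltW// small// (le_trans (ltW qr)).
  rewrite leNgt; apply/negP => Eq; have : r <= q.
    apply: ge_inf; first exact: hiB.2.
    split; last exact: ltW.
    by rewrite (le_trans (ltW qr) rs1) andbT (le_trans _ dq)// ler_pdivrMr// ler_pMr// ler1n.
  by rewrite leNgt qr.
have rtau : (r%:E < tau)%E by rewrite (le_lt_trans _ ttau)// lee_fin.
have rb := H r; move: rb; rewrite (ltW r0) rt => /(_ isT) rb.
have Joo := error_bound_fin rb.
move: rb; rewrite (error_boundE Joo) lee_fin => rb.
have Er : E r < 1 / 25.
  by rewrite (le_lt_trans (gronwall0 r0 (le_trans rt tT) rtau below Joo))// (le_lt_trans rb).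
have gap : 0 < 1 / 25 - E r by rewrite subr_gt0.
have rI : d / 2 <= r <= s1 by rewrite dr.
have [b b0 bP] := (ctsP _ _ _).1 cE r rI _ gap.
have [q [qI Eq] qr] := inf_adherent b0 hiB.
have rq : r <= q by apply: ge_inf => //; exact: hiB.2.
have : `|E q - E r| < 1 / 25 - E r.
  apply: bP => //; rewrite ger0_norm ?subr_ge0//.
  by move: qr; rewrite -/r; lra.
by move/ltr_normlW; lra.
Qed.

End Bootstrap.

Theorem theorem8 (R : realType) (tau : \bar R) (u : R -> R -> R)
    (T : R) (phi phit : R -> R -> R) :
  maximal_solution tau u ->
  0 < T -> approximation_on T phi phit ->
  let d := fun t : R => u t \- phi t in
  forall t : R, 0 <= t <= T -> (t%:E < tau)%E ->
    (forall s : R, 0 <= s <= t ->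
       (error_bound phi phit (d 0%R) s <= (@Kstar R)%:E)%E) ->
    (Hnorm 1 (d t) ^+ 2 <= error_bound phi phit (d 0%R) t)%E.
Proof.
move=> [Hu _] T0 Hphi d t /andP[t0 tT] ttau H.
have [F0 [F1 [F2 [F3 FP]]]] := phi_reps Hphi.
have Joo : (residual_integral phi phit t < +oo)%E.
  by apply: (error_bound_fin Hu T0 Hphi (k := Kstar)); apply: H; rewrite t0 lexx.
rewrite /d (error_boundE Hu T0 Hphi Joo).
move: t0; rewrite le_eqVlt => /predU1P[t0|t0].
  rewrite -t0 (initial_energyE Hu T0 Hphi) residual_integral0.
  by rewrite (weight0 T0 Hphi FP) expR0 mulr1 mulr0 addr0.
rewrite (energyE Hu Hphi FP t0 tT ttau) lee_fin.
apply: (gronwall0 Hu T0 Hphi FP t0 tT ttau _ Joo) => r /andP[r0 rt].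
by apply: (energy_below_threshold Hu T0 Hphi FP tT ttau H); rewrite r0 ltW.
Qed.
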